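(* Let $n\ge 1$ be an integer and let $\alpha=\max\left(\frac n2-1,0\right)$. There is a constant $C>0$, independent of $x,\xi,u,t$, such that for all $x,\xi\in\mathbb{R}^n$, $u\in\mathbb{R}$ and $t>0$, with $\zeta=(x,0)$ and $\eta=(\xi,u)$ in $\mathbb{R}^{n+1}$, $$\left|K_t(x,\xi,u)\right|\le C\,t^{-\frac n2-1}\,\min\left(1+\frac{d_{CC}(\zeta,\eta)}{|x+\xi|},\;1+\frac{d_{CC}(\zeta,\eta)^2}{4t}\right)^{\alpha}e^{-\frac{1}{4t}d_{CC}(\zeta,\eta)^2},$$ where the first entry of the minimum is read as $+\infty$ if $x+\xi=0$.
   Context: On $\mathbb{R}^{n+1}=\mathbb{R}^n_x\times\mathbb{R}_u$ consider the vector fields $X_j=\partial_{x_j}$, $U_j=x_j\partial_u$ ($j=1,\dots,n$) and the Grushin operator $G=\sum_{j=1}^n(X_j^2+U_j^2)=\Delta_x+|x|^2\partial_u^2$. Carnot–Carathéodory distance: for $p\in\mathbb{R}^{n+1}$ and a tangent vector $v$ at $p$ put $\|v\|_p^2=\inf\{\sum_{j=1}^n(\alpha_j^2+\beta_j^2): v=\sum_{j=1}^n(\alpha_jX_j(p)+\beta_jU_j(p))\}$, with $\inf\varnothing=\infty$. A horizontal curve is an absolutely continuous curve $\gamma:[0,1]\to\mathbb{R}^{n+1}$ with $\dot\gamma(t)\in\mathrm{span}\{X_j(\gamma(t)),U_j(\gamma(t)):1\le j\le n\}$ for almost every $t$; its length is $L(\gamma)=\int_0^1\|\dot\gamma(t)\|_{\gamma(t)}\,dt$.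 Then $d_{CC}(p,q)$ is the infimum of $L(\gamma)$ over all horizontal curves $\gamma$ with $\gamma(0)=p$, $\gamma(1)=q$. Heat kernel: for $t>0$, $x,\xi\in\mathbb{R}^n$, $u\in\mathbb{R}$, $$K_t(x,\xi,u)=(4\pi t)^{-\frac n2-1}\int_{-\infty}^{\infty}\left(\frac{\lambda}{\sinh\lambda}\right)^{\frac n2}\exp\left(-\frac1{4t}\left(\lambda\coth\lambda\,(|x|^2+|\xi|^2)-\frac{2\lambda}{\sinh\lambda}\,x\cdot\xi-2i\lambda u\right)\right)d\lambda$$ (removable singularities at $\lambda=0$ are filled in by continuity). This is the heat kernel of $G$: the solution of $(\partial_t-G)v=0$, $v(0,\cdot)=f$ is $v(t,x,u)=\int_{\mathbb{R}}\int_{\mathbb{R}^n}K_t(x,\xi,u-\lambda)f(\xi,\lambda)\,d\xi\,d\lambda$ for $f\in\mathcal{S}(\mathbb{R}^{n+1})$. *)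

(* Defs.v *)
From HB Require Import structures.
From mathcomp Require Import all_boot all_order all_algebra.
From mathcomp Require Import all_classical all_reals all_analysis.
From mathcomp Require Import complex.

Set Implicit Arguments.
Unset Strict Implicit.
Unset Printing Implicit Defensive.

Import Order.TTheory GRing.Theory Num.Theory.
Import numFieldNormedType.Exports.

Local Open Scope classical_set_scope.
Local Open Scope ring_scope.

Definition dotv (R : realType) (n : nat) (x y : 'rV[R]_n) : R :=
  \sum_(j < n) x 0 j * y 0 j.

(* The library norm on ['rV[R]_n] is the sup norm, hence this definition. *)
Definition enorm (R : realType) (n : nat) (x : 'rV[R]_n) : R :=
  Num.sqrt (dotv x x).

(* R^(n+1) = R^n_x * R_u; [R^o] provides the [normedModType R] structure. *)
Notation grushin_space R n := ('rV[R]_n * R^o)%type.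

Definition Xvec (R : realType) (n : nat) (j : 'I_n) (p : grushin_space R n) :
  grushin_space R n := (delta_mx 0 j, 0).

Definition Uvec (R : realType) (n : nat) (j : 'I_n) (p : grushin_space R n) :
  grushin_space R n := (0, p.1 0 j).

Definition frame_comb (R : realType) (n : nat) (p : grushin_space R n)
    (a b : 'rV[R]_n) : grushin_space R n :=
  \sum_(j < n) (a 0 j *: Xvec j p + b 0 j *: Uvec j p).

Definition horizontal_vec (R : realType) (n : nat) (p v : grushin_space R n) :
  Prop := exists a b : 'rV[R]_n, v = frame_comb p a b.

(* Extended-real valued: [ereal_inf set0 = +oo] and [sqrte +oo = +oo]. *)
Definition cc_norm (R : realType) (n : nat) (p v : grushin_space R n) : \bar R :=
  sqrte (ereal_inf [set s : \bar R | exists a b : 'rV[R]_n,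
    v = frame_comb p a b /\
    s = (\sum_(j < n) (a 0 j ^+ 2 + b 0 j ^+ 2))%:E]).

Definition abs_continuous01 (R : realType) (V : normedModType R) (g : R -> V) :
    Prop :=
  forall e : R, 0 < e -> exists2 d : R, 0 < d &
    forall (m : nat) (a b : 'I_m -> R),
      (forall i, [/\ 0 <= a i, a i <= b i & b i <= 1]) ->
      trivIset setT (fun i => [set` `]a i, b i[]) ->
      \sum_(i < m) (b i - a i) < d ->
      \sum_(i < m) `|g (b i) - g (a i)| < e.

(* Curves are total functions on R of which only the values on [0, 1] matter;
   the derivative is two-sided, the endpoints being negligible. *)
Definition horizontal_curve (R : realType) (n : nat)
    (g : R -> grushin_space R n) : Prop :=
  abs_continuous01 g /\
  {ae (@lebesgue_measure R), forall t : R, t \in `[0, 1] ->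
     derivable g t 1 /\ horizontal_vec (g t) (derive1 g t)}.

Definition cc_length (R : realType) (n : nat) (g : R -> grushin_space R n) :
    \bar R :=
  (\int[@lebesgue_measure R]_(t in [set` `[0%R, 1%R]]) cc_norm (g t) (derive1 g t))%E.

Definition cc_edist (R : realType) (n : nat) (p q : grushin_space R n) : \bar R :=
  ereal_inf [set cc_length g | g in
    [set g | [/\ horizontal_curve g, g 0 = p & g 1 = q]]].

(* For n >= 1, [cc_edist] never takes the value +oo, any two points being joined
   by a horizontal curve of finite length, so [fine] only changes the type. *)
Definition d_CC (R : realType) (n : nat) (p q : grushin_space R n) : R :=
  fine (cc_edist p q).

Definition sinh (R : realType) (l : R) : R := (expR l - expR (- l)) / 2.

Definition cosh (R : realType) (l : R) : R := (expR l + expR (- l)) / 2.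

(* Removable singularities at 0 are filled in by continuity. *)
Definition l_over_sinh (R : realType) (l : R) : R :=
  if l == 0 then 1 else l / sinh l.

Definition l_coth (R : realType) (l : R) : R :=
  if l == 0 then 1 else l * (cosh l / sinh l).

Definition cexp (R : realType) (z : R[i]) : R[i] :=
  ((expR (complex.Re z))%:C * (cos (complex.Im z) +i* sin (complex.Im z)))%C.

Definition cintegral (R : realType) (f : R -> R[i]) : R[i] :=
  ((\int[@lebesgue_measure R]_l complex.Re (f l))
    +i* (\int[@lebesgue_measure R]_l complex.Im (f l)))%C.

Definition grushin_kernel (R : realType) (n : nat) (t : R) (x xi : 'rV[R]_n)
    (u : R) : R[i] :=
  (((4 * pi * t) `^ (- (n%:R / 2) - 1))%:C *
   cintegral (fun l : R =>
     (l_over_sinh l `^ (n%:R / 2))%:C *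
     cexp (- ((4 * t)^-1)%:C *
           ((l_coth l * (enorm x ^+ 2 + enorm xi ^+ 2)
             - 2 * l_over_sinh l * dotv x xi)%:C
            - 2 * 'i * l%:C * u%:C))))%C.

(* Main.v *)
(** With [A = |x + xi|^2 / 2] and [B = |x - xi|^2 / 2], the integrand is the
    exponential of
      [(n/2) log (z / sinh z) - (A z tanh (z/2) + B z coth (z/2) - 2 i u z) / (4 t)]
    at [z = lambda].  On the imaginary axis, at [z = 2 i r], the parenthesis takes the
    real value [V r = - 2 A r tan r + 2 B r cot r + 4 u r], and at the critical
    point [r0] in (0, pi/2] the number [V r0] is the squared length of an explicit
    horizontal curve from [(x, 0)] to [(xi, u)]; so [d_CC <= d0 := sqrt (V r0)].
    The integration contour is moved to
      [Im z = 2 r + l / (16 (1 + l))], [l = |Re z|],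
    whose slant keeps the real part of the parenthesis above [V r], with a gain
    proportional to [l] when [2 r] comes close to the pole [z = i pi]; there
    [(z / sinh z)^(n/2)] contributes the factor [(cos r)^(-alpha)].  One takes
    [r = r0], or a slightly smaller [r] when [r0] is too close to [pi/2], which
    costs a bounded factor, and [1 / cos r] is bounded by the weight at [d0].
    Since the weighted Gaussian of the statement is, up to a constant factor, a
    nonincreasing function of the distance, [d0] may be replaced by [d_CC]: no
    lower bound on the distance is needed. *)

Require Import Defs.
From HB Require Import structures.
From mathcomp Require Import all_boot all_order all_algebra.
From mathcomp Require Import all_classical all_reals all_analysis.
From mathcomp Require Import complex ring lra measurable_realfun.

Set Implicit Arguments.
Unset Strict Implicit.
Unset Printing Implicit Defensive.

Import Order.TTheory GRing.Theory Num.Theory.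
Import numFieldNormedType.Exports.

Local Open Scope ring_scope.

(** * Calculus and elementary inequalities *)

(** Write T = (2 r tan r)', S = - (2 r cot r)', nu = n/2 and k = 1 / (4 t). Then V' = 4 u - A T - B
    S with T and S increasing, so V is concave and V' >= 0 up to r0. The obstacle is that |z / sinh
    z|^nu costs (cos r)^(-nu) near i pi, more than the exponent alpha allows: the integrand must
    decay in l at a rate of order 1 / cos r, to win back one power by integration. When A = 0 a
    horizontal line gains only order l^2. A slant of height h adds h V'(r) / 2 to first order, and
    the tanh term adds a multiple of A T(r) l once l exceeds cos r; together the rate is a fixed
    fraction of 4 u - B S(r), which suffices as soon as k (4 u - B S(r)) cos r >= 1. Lowering r
    until this holds, or until cos r = 1/2, costs V at most (4 u - B S(r)) (r0 - r) <= 3 / k,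
    because r0 - r <= 3 cos r. The slanted contour has a corner on the imaginary axis. The shift is
    therefore made on the half-plane Re z > 0, where the logarithms are single-valued, and for the
    real part only. The slope 1/16 is small enough for the second-order error of the slant to be
    covered by the l^2 gain of a horizontal displacement. *)

Section derivation_rules.
Context {R : realType}.
Implicit Types (f g : R -> R) (x a b : R).

(* Pointwise versions of the library rules, which are stated for [f \+ g],
   [f \* g], etc., so that [drv] can apply them by matching the function body. *)
Lemma drv_cst x (k : R) : is_derive x 1 (fun=> k) 0.
Proof. exact: is_derive_cst. Qed.

Lemma drv_id x : is_derive x 1 (fun y : R => y) 1.
Proof. exact: is_derive_id. Qed.

Lemma drvD f g x a b : is_derive x 1 f a -> is_derive x 1 g b ->
  is_derive x 1 (fun y => f y + g y) (a + b).
Proof. exact: is_deriveD. Qed.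

Lemma drvN f x a : is_derive x 1 f a -> is_derive x 1 (fun y => - f y) (- a).
Proof. exact: is_deriveN. Qed.

Lemma drvM f g x a b : is_derive x 1 f a -> is_derive x 1 g b ->
  is_derive x 1 (fun y => f y * g y) (f x * b + g x * a).
Proof. exact: is_deriveM. Qed.

Lemma drvV f x a : f x != 0 -> is_derive x 1 f a ->
  is_derive x 1 (fun y => (f y)^-1) (- (f x) ^- 2 * a).
Proof. exact: is_deriveV. Qed.

Lemma drvX f (n : nat) x a : is_derive x 1 f a ->
  is_derive x 1 (fun y => f y ^+ n) (n%:R * f x ^+ n.-1 * a).
Proof.
move=> h; rewrite (_ : (fun _ => _) = f ^+ n); first exact: is_deriveX.
by apply/funext => y; rewrite exprfctE.
Qed.

Lemma drv_comp f g x a b : is_derive (g x) 1 f a -> is_derive x 1 g b ->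
  is_derive x 1 (fun y => f (g y)) (a * b).
Proof. exact: is_derive1_comp. Qed.

Lemma drv_expR f x a : is_derive x 1 f a ->
  is_derive x 1 (fun y => expR (f y)) (expR (f x) * a).
Proof. by move=> ?; apply: drv_comp. Qed.

Lemma drv_sin f x a : is_derive x 1 f a ->
  is_derive x 1 (fun y => sin (f y)) (cos (f x) * a).
Proof. by move=> ?; apply: drv_comp. Qed.

Lemma drv_cos f x a : is_derive x 1 f a ->
  is_derive x 1 (fun y => cos (f y)) (- sin (f x) * a).
Proof. by move=> ?; apply: drv_comp. Qed.

Lemma drv_atan f x a : is_derive x 1 f a ->
  is_derive x 1 (fun y => atan (f y)) ((1 + f x ^+ 2)^-1 * a).
Proof. by move=> ?; apply: drv_comp. Qed.

Lemma drv_ln f x a : 0 < f x -> is_derive x 1 f a ->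
  is_derive x 1 (fun y => ln (f y)) ((f x)^-1 * a).
Proof. by move=> f0 h; exact: (drv_comp (is_derive1_ln f0) h). Qed.

Lemma drv_cosh f x a : is_derive x 1 f a ->
  is_derive x 1 (fun y => cosh (f y)) (sinh (f x) * a).
Proof.
move=> h; rewrite /cosh /sinh; notypeclasses refine (is_derive_eq _ _).
  exact: (drvM (drvD (drv_expR h) (drv_expR (drvN h))) (drv_cst x 2^-1)).
by rewrite /=; ring.
Qed.

Lemma drv_sinh f x a : is_derive x 1 f a ->
  is_derive x 1 (fun y => sinh (f y)) (cosh (f x) * a).
Proof.
move=> h; rewrite /cosh /sinh; notypeclasses refine (is_derive_eq _ _).
  exact: (drvM (drvD (drv_expR h) (drvN (drv_expR (drvN h)))) (drv_cst x 2^-1)).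
by rewrite /=; ring.
Qed.

End derivation_rules.

Ltac drv := repeat lazymatch goal with
  | |- is_derive _ _ (fun _ => ?k) _ => exact: drv_cst
  | |- is_derive _ _ (fun y => y) _ => exact: drv_id
  | |- is_derive _ _ (fun y => @?f y + @?g y) _ => notypeclasses refine (@drvD _ f g _ _ _ _ _)
  | |- is_derive _ _ (fun y => - @?f y) _ => notypeclasses refine (@drvN _ f _ _ _)
  | |- is_derive _ _ (fun y => @?f y * @?g y) _ => notypeclasses refine (@drvM _ f g _ _ _ _ _)
  | |- is_derive _ _ (fun y => (@?f y)^-1) _ => notypeclasses refine (@drvV _ f _ _ _ _)
  | |- is_derive _ _ (fun y => (@?f y) ^+ ?n) _ => notypeclasses refine (@drvX _ f n _ _ _)
  | |- is_derive _ _ (fun y => expR (@?f y)) _ => notypeclasses refine (@drv_expR _ f _ _ _)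
  | |- is_derive _ _ (fun y => sin (@?f y)) _ => notypeclasses refine (@drv_sin _ f _ _ _)
  | |- is_derive _ _ (fun y => cos (@?f y)) _ => notypeclasses refine (@drv_cos _ f _ _ _)
  | |- is_derive _ _ (fun y => atan (@?f y)) _ => notypeclasses refine (@drv_atan _ f _ _ _)
  | |- is_derive _ _ (fun y => ln (@?f y)) _ => notypeclasses refine (@drv_ln _ f _ _ _ _)
  | |- is_derive _ _ (fun y => cosh (@?f y)) _ => notypeclasses refine (@drv_cosh _ f _ _ _)
  | |- is_derive _ _ (fun y => sinh (@?f y)) _ => notypeclasses refine (@drv_sinh _ f _ _ _)
  end.

Ltac drv_eq := notypeclasses refine (is_derive_eq _ _); [drv|rewrite /=].

Section elementary_inequalities.
Context {R : realType}.
Implicit Types (x y l : R).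

(** The mean value theorem as a comparison principle. The Taylor-type bounds below are chained
    through it: the derivative of each difference is the difference of a bound already proved. *)
Lemma ge0_of_derive (f df : R -> R) (b : R) :
  (forall x, 0 <= x <= b -> is_derive x 1 f (df x)) ->
  (forall x, 0 <= x <= b -> 0 <= df x) -> 0 <= f 0 ->
  forall x, 0 <= x <= b -> 0 <= f x.
Proof.
move=> fdf df0 f0 x /andP[x0 xb].
have [] := @MVT_segment _ f df 0 x x0.
- by move=> z /[!in_itv]/= /andP[z0 zx]; apply: fdf; rewrite (ltW z0) (le_trans (ltW zx)).
- apply: derivable_within_continuous => z /[!in_itv]/= /andP[z0 zx].
  by apply: ex_derive; apply: fdf; rewrite z0 (le_trans zx).
move=> z /[!in_itv]/= /andP[z0 zx] fE.
have : 0 <= df z * (x - 0).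
  by rewrite mulr_ge0 ?df0 ?subr0// z0 (le_trans zx).
by rewrite -fE; lra.
Qed.

Lemma cosh_ge1 x : 1 <= cosh x.
Proof.
rewrite /cosh expRN.
have e0 := expR_gt0 x; set e := expR x in e0 *.
rewrite ler_pdivlMr// mul1r -subr_ge0.
have -> : e + e^-1 - 2 = (e - 1) ^+ 2 / e by field; rewrite gt_eqF.
by rewrite divr_ge0 ?sqr_ge0 ?ltW.
Qed.

Lemma cosh2 x : cosh x ^+ 2 = 1 + sinh x ^+ 2.
Proof.
rewrite /cosh /sinh expRN.
by have e0 := expR_gt0 x; set e := expR x in e0 *; field; rewrite gt_eqF.
Qed.

Lemma sinh0 : sinh 0 = 0 :> R. Proof. by rewrite /sinh oppr0 subrr mul0r. Qed.
Lemma cosh0 : cosh 0 = 1 :> R.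
Proof. by rewrite /cosh oppr0 expR0 -(natrD _ 1 1) divff. Qed.

Lemma sinh_ge x : 0 <= x -> x <= sinh x.
Proof.
move=> x0; rewrite -subr_ge0.
apply: (@ge0_of_derive (fun y => sinh y - y) (fun y => cosh y - 1) x); last by rewrite x0 lexx.
- by move=> y _; drv_eq; ring.
- by move=> y _; rewrite subr_ge0 cosh_ge1.
- by rewrite sinh0 subrr.
Qed.

Lemma cosh_ge2 x : 0 <= x -> 1 + x ^+ 2 / 2 <= cosh x.
Proof.
move=> x0; rewrite -subr_ge0.
apply: (@ge0_of_derive (fun y => cosh y - (1 + y ^+ 2 / 2)) (fun y => sinh y - y) x);
   last by rewrite x0 lexx.
- by move=> y _; drv_eq; field.
- by move=> y /andP[y0 _]; rewrite subr_ge0 sinh_ge.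
- by rewrite cosh0; lra.
Qed.

Lemma sinh_ge3 x : 0 <= x -> x + x ^+ 3 / 6 <= sinh x.
Proof.
move=> x0; rewrite -subr_ge0.
apply: (@ge0_of_derive (fun y => sinh y - (y + y ^+ 3 / 6)) (fun y => cosh y - (1 + y ^+ 2 / 2)) x);
   last by rewrite x0 lexx.
- by move=> y _; drv_eq; field.
- by move=> y /andP[y0 _]; rewrite subr_ge0 cosh_ge2.
- by rewrite sinh0; lra.
Qed.

Lemma cosh_ge4 x : 0 <= x -> 1 + x ^+ 2 / 2 + x ^+ 4 / 24 <= cosh x.
Proof.
move=> x0; rewrite -subr_ge0.
apply: (@ge0_of_derive (fun y => cosh y - (1 + y ^+ 2 / 2 + y ^+ 4 / 24))
   (fun y => sinh y - (y + y ^+ 3 / 6)) x);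
   last by rewrite x0 lexx.
- by move=> y _; drv_eq; field.
- by move=> y /andP[y0 _]; rewrite subr_ge0 sinh_ge3.
- by rewrite cosh0; lra.
Qed.

Lemma sinh_le_mul_cosh x : 0 <= x -> sinh x <= x * cosh x.
Proof.
move=> x0; rewrite -subr_ge0.
apply: (@ge0_of_derive (fun y => y * cosh y - sinh y) (fun y => y * sinh y) x);
   last by rewrite x0 lexx.
- by move=> y _; drv_eq; ring.
- by move=> y /andP[y0 _]; rewrite mulr_ge0// (le_trans y0)// sinh_ge.
- by rewrite sinh0; lra.
Qed.

Lemma mul_sinh_ge2 x : 0 <= x -> 2 * (cosh x - 1) <= x * sinh x.
Proof.
move=> x0; rewrite -subr_ge0.
apply: (@ge0_of_derive (fun y => y * sinh y - 2 * (cosh y - 1)) (fun y => y * cosh y - sinh y) x);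
   last by rewrite x0 lexx.
- by move=> y _; drv_eq; ring.
- by move=> y /andP[y0 _]; rewrite subr_ge0 sinh_le_mul_cosh.
- by rewrite sinh0 cosh0; lra.
Qed.

(** Exact through order 4, unlike [mul_sinh_ge2]: with [cosh_ge4] it gives x sinh x - 2 (cosh x - 1)
    >= x^4 / 12, which [coth_gain] needs at small angles. *)
Lemma mul_sinh_ge4 x : 0 <= x -> 4 * (cosh x - 1) - x ^+ 2 <= x * sinh x.
Proof.
move=> x0; rewrite -subr_ge0.
apply: (@ge0_of_derive (fun y => y * sinh y - (4 * (cosh y - 1) - y ^+ 2))
  (fun y => y * cosh y - 3 * sinh y + 2 * y) x);
   last by rewrite x0 lexx.
- by move=> y _; drv_eq; ring.
- move=> y; apply: (@ge0_of_derive (fun y => y * cosh y - 3 * sinh y + 2 * y)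
    (fun y => y * sinh y - 2 * (cosh y - 1))).
  + by move=> z _; drv_eq; ring.
  + by move=> z /andP[z0 _]; rewrite subr_ge0 mul_sinh_ge2.
  + by rewrite sinh0 cosh0; lra.
- by rewrite sinh0 cosh0; lra.
Qed.

Lemma cosh_le1 x : 0 <= x <= 1 -> cosh x <= 5 / 2.
Proof.
move=> /andP[x0 x1].
have e1 : expR (1/2) <= 2 :> R.
  have := expR_ge1Dx (- (1/2) : R); rewrite expRN.
  have := expR_gt0 (1/2 : R); set e := expR _ => e0 h.
  have : e * (1 + - (1/2)) <= e * e^-1 by rewrite ler_pM2l.
  by rewrite divff ?gt_eqF//; lra.
have : expR x <= 4.
  apply: (@le_trans _ _ (expR 1)); first by rewrite ler_expR.
  have -> : 1 = 1/2 + 1/2 :> R by field.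
  rewrite expRD; have := expR_gt0 (1/2 : R); set e := expR _ in e1 * => e0; nra.
have : expR (- x) <= 1 by rewrite -expR0 ler_expR; lra.
by rewrite /cosh; lra.
Qed.

Lemma cosh_le_sqr x : 0 <= x <= 1 -> cosh x <= 1 + 5 / 4 * x ^+ 2.
Proof.
move=> x01; rewrite -subr_ge0; move: x x01.
apply: (@ge0_of_derive (fun y => 1 + 5 / 4 * y ^+ 2 - cosh y) (fun y => 5 / 2 * y - sinh y)).
- by move=> y _; drv_eq; field.
- apply: (@ge0_of_derive (fun y => 5 / 2 * y - sinh y) (fun y => 5 / 2 - cosh y)).
  + by move=> z _; drv_eq; ring.
  + by move=> z z01; rewrite subr_ge0 cosh_le1.
  + by rewrite sinh0; lra.
- by rewrite cosh0; lra.
Qed.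

Lemma sinh_ge_exp x : 0 <= x -> x * expR (x / 2) <= 2 * sinh x.
Proof.
move=> x0.
have -> : sinh x = 2 * sinh (x / 2) * cosh (x / 2).
  rewrite /sinh /cosh {1 2}(_ : x = x / 2 + x / 2); last by field.
  by rewrite opprD !expRD; field.
have h1 : x / 2 <= sinh (x / 2) by apply: sinh_ge; lra.
have h2 : expR (x / 2) <= 2 * cosh (x / 2).
  by rewrite /cosh; have := expR_gt0 (- (x / 2)); lra.
have := expR_gt0 (x / 2); nra.
Qed.

Lemma sin_le x : 0 <= x -> sin x <= x.
Proof.
move=> x0; rewrite -subr_ge0.
apply: (@ge0_of_derive (fun y => y - sin y) (fun y => 1 - cos y) x); last by rewrite x0 lexx.
- by move=> y _; rewrite subr_ge0 cos_le1.
- by rewrite sin0 subrr.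
Qed.

Lemma cos_ge2 x : 0 <= x -> 1 - x ^+ 2 / 2 <= cos x.
Proof.
move=> x0; rewrite -subr_ge0.
apply: (@ge0_of_derive (fun y => cos y - (1 - y ^+ 2 / 2)) (fun y => y - sin y) x); last by rewrite x0 lexx.
- by move=> y _; drv_eq; field.
- by move=> y /andP[y0 _]; rewrite subr_ge0 sin_le.
- by rewrite cos0; lra.
Qed.

Lemma sin_ge3 x : 0 <= x -> x - x ^+ 3 / 6 <= sin x.
Proof.
move=> x0; rewrite -subr_ge0.
apply: (@ge0_of_derive (fun y => sin y - (y - y ^+ 3 / 6)) (fun y => cos y - (1 - y ^+ 2 / 2)) x); last by rewrite x0 lexx.
- by move=> y _; drv_eq; field.
- by move=> y /andP[y0 _]; rewrite subr_ge0 cos_ge2.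
- by rewrite sin0; lra.
Qed.

(** Half-angles on the contour stay below 2 + 1/32, since pi / 2 < 2 and the slant adds at most 1/16
    to the full angle; 21/10 leaves some room, and the cubic bound on sine still yields a quarter
    there. *)
Lemma sin_ge_quarter x : 0 <= x <= 21 / 10 -> x / 4 <= sin x.
Proof.
move=> /andP[x0 x2]; apply: le_trans (sin_ge3 x0).
have : x ^+ 2 <= 441 / 100 by nra.
rewrite exprS; nra.
Qed.

Lemma sin_ge_third x : 0 <= x <= 2 -> x / 3 <= sin x.
Proof.
move=> /andP[x0 x2]; apply: le_trans (sin_ge3 x0).
have : x ^+ 2 <= 4 by nra.
rewrite exprS; nra.
Qed.

Lemma sin_sub_mul_cos_le x : 0 <= x -> sin x - x * cos x <= x ^+ 3 / 3.
Proof.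
move=> x0; rewrite -subr_ge0.
apply: (@ge0_of_derive (fun y => y ^+ 3 / 3 - (sin y - y * cos y)) (fun y => y * (y - sin y)) x); last by rewrite x0 lexx.
- by move=> y _; drv_eq; field.
- by move=> y /andP[y0 _]; rewrite mulr_ge0// subr_ge0 sin_le.
- by rewrite sin0; lra.
Qed.

Lemma sin_sub_mul_cos_ge x : 0 <= x <= 21 / 10 -> x ^+ 3 / 12 <= sin x - x * cos x.
Proof.
move=> x01; rewrite -subr_ge0; move: x x01.
apply: (@ge0_of_derive (fun y => sin y - y * cos y - y ^+ 3 / 12) (fun y => y * (sin y - y / 4))).
- by move=> y _; drv_eq; field.
- by move=> y /andP[y0 y2]; rewrite mulr_ge0// subr_ge0 sin_ge_quarter// y0.
- by rewrite sin0; lra.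
Qed.

Lemma cos_gt0_acute x : 0 < x < pi / 2 -> 0 < cos x.
Proof.
move=> /andP[x0 xp]; apply: cos_gt0_pihalf; rewrite xp andbT.
by rewrite (lt_trans _ x0)// oppr_lt0 divr_gt0 ?pi_gt0.
Qed.

End elementary_inequalities.

(** * Inequalities along the slanted contour *)

Section coth_shift.
Context {R : realType}.
Implicit Types (r l h : R).

(* The derivatives of [2 r tan r] and [- 2 r cot r]. *)
Definition saddleT r := 2 * (r + sin r * cos r) / cos r ^+ 2.
Definition saddleS r := 2 * (r - sin r * cos r) / sin r ^+ 2.

Lemma sin_double r : sin (2 * r) = 2 * sin r * cos r.
Proof. by rewrite (_ : 2 * r = r + r) ?sinD; ring. Qed.

Lemma cos_double r : cos (2 * r) = 1 - 2 * sin r ^+ 2.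
Proof.
have -> : 2 * r = r + r by ring.
by rewrite cosD; have h := cos2Dsin2 r; lra.
Qed.

Lemma cos_double' r : cos (2 * r) = 2 * cos r ^+ 2 - 1.
Proof. by rewrite cos_double; have h := cos2Dsin2 r; lra. Qed.

Lemma sin_mul_cos_le r : 0 <= r -> sin r * cos r <= r.
Proof.
move=> r0; have := @sin_le R (2 * r); rewrite sin_double mulr_ge0// => /(_ isT).
lra.
Qed.

(* The remainder of [y cot y] with respect to its tangent at [r]. *)
Lemma cot_tangent r e : 0 < r -> 0 <= e -> r + e <= 21 / 10 ->
  (r + e) * cos (r + e) / sin (r + e) - r * cos r / sin r + e / 2 * saddleS r
  = - ((e * sin e * (sin r - r * cos r) + r * sin r * (sin e - e * cos e))
    / (sin r ^+ 2 * sin (r + e))).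
Proof.
move=> r0 e0 re; rewrite /saddleS.
have s0 : 0 < sin r by have := @sin_ge_quarter _ r; lra.
have sp0 : 0 < sin (r + e) by have := @sin_ge_quarter _ (r + e); lra.
(* Once cos (r + e) and cos e are expressed through sin (r + e), sin e, sin r and cos r, the claim
   is a rational identity. *)
have H1 : cos (r + e) = (cos r * sin (r + e) - sin e) / sin r.
  apply: (mulIf (lt0r_neq0 s0)); rewrite divfK ?gt_eqF// cosD sinD.
  have := cos2Dsin2 r; set s := sin r; set c := cos r; set f := sin e; set d := cos e => h.
  have hf : f * (c ^+ 2 + s ^+ 2) = f by rewrite h mulr1.
  by rewrite -[X in _ = _ - X]hf; ring.
have H2 : cos e = (sin (r + e) - cos r * sin e) / sin r.
  by rewrite sinD; field; rewrite gt_eqF.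
rewrite H1 H2.
by field; rewrite !gt_eqF.
Qed.

(** Concavity of y cot y: both terms of the remainder in [cot_tangent] have a sign. *)
Lemma cot_tangent_le r e : 0 < r -> 0 <= e -> r + e <= 21 / 10 ->
  (r + e) * cos (r + e) / sin (r + e) - r * cos r / sin r + e / 2 * saddleS r <= 0.
Proof.
move=> r0 e0 re; rewrite cot_tangent// oppr_le0 divr_ge0//.
  have := @sin_sub_mul_cos_ge _ r; have := @sin_sub_mul_cos_ge _ e.
  have := @sin_ge_quarter _ r; have := @sin_ge_quarter _ e.
  have := exprn_ge0 3 (ltW r0); have := exprn_ge0 3 e0.
  rewrite (ltW r0) e0 /= => r3 e3 h1 h2 h3 h4.
  by rewrite addr_ge0// !mulr_ge0//; lra.
rewrite mulr_ge0 ?sqr_ge0//.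
by have := @sin_ge_quarter _ (r + e); lra.
Qed.

(** Uniform down to r = 0: since sin y - y cos y = O(y^3), the numerator of the remainder is at most
    e^2 r^2 (r + e) / 3, against a denominator of at least r^2 (r + e) / 36. *)
Lemma cot_tangent_ge r e : 0 < r -> r <= 2 -> 0 <= e -> r + e <= 21 / 10 ->
  - (12 * e ^+ 2) <=
  (r + e) * cos (r + e) / sin (r + e) - r * cos r / sin r + e / 2 * saddleS r.
Proof.
move=> r0 r2 e0 re; rewrite cot_tangent// lerN2.
have s0 : r / 3 <= sin r by have := @sin_ge_third _ r; lra.
have sp0 : (r + e) / 4 <= sin (r + e) by have := @sin_ge_quarter _ (r + e); lra.
have sr := sin_le (ltW r0).
have se := sin_le e0.
have se0 : 0 <= sin e by have := @sin_ge_quarter _ e; lra.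
have h1 := sin_sub_mul_cos_le e0.
have h2 := sin_sub_mul_cos_le (ltW r0).
have h3 := @sin_sub_mul_cos_ge _ r.
have h4 := @sin_sub_mul_cos_ge _ e.
have r3 := exprn_ge0 3 (ltW r0); have e3 := exprn_ge0 3 e0.
rewrite ler_pdivrMr; last by rewrite mulr_gt0 ?exprn_gt0//; lra.
apply: (@le_trans _ _ (e * e * (r ^+ 3 / 3) + r * r * (e ^+ 3 / 3))).
  apply: lerD; apply: ler_pM => //; rewrite ?mulr_ge0//; try lra.
    by apply: ler_pM; lra.
  by apply: ler_pM; lra.
have -> : e * e * (r ^+ 3 / 3) + r * r * (e ^+ 3 / 3) =
  12 * e ^+ 2 * ((r / 3) ^+ 2 * ((r + e) / 4)) by field.
rewrite ler_wpM2l//; first by rewrite mulr_ge0 ?sqr_ge0.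
by apply: ler_pM => //; rewrite ?sqr_ge0 ?lerXn2r ?nnegrE//; lra.
Qed.

(** The gain of Re (z coth (z/2)) when leaving the imaginary axis horizontally at height 2 x. With 2
    x cot x <= 2 - x^2 / 6, the numerator of the difference is at least x^2 (cosh l - 1) / 6 plus a
    term of order l^4, and the denominator is (cosh l - 1) + 2 sin(x)^2: both sides are of the form
    l^2 (x^2 + l^2), so the constant is uniform in x. *)
Lemma coth_gain (x l : R) : 0 < l -> 0 < x <= 21 / 10 ->
  Num.min (l ^+ 2) 1 / 40 <=
  (l * sinh l + 2 * x * sin (2 * x)) / (cosh l - cos (2 * x)) - 2 * x * cos x / sin x.
Proof.
move=> l0 /andP[x0 x2].
have s0 : x / 4 <= sin x by have := @sin_ge_quarter _ x; lra.
have sp : 0 < sin x by lra.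
have sx := sin_le (ltW x0).
have ch2 := cosh_ge2 (ltW l0).
have l2 : 0 < l ^+ 2 by rewrite exprn_gt0.
have s2 : 0 < sin x ^+ 2 by rewrite exprn_gt0.
have hx := @sin_sub_mul_cos_ge _ x.
have D0 : 0 < cosh l - cos (2 * x) by rewrite cos_double; nra.
have -> : (l * sinh l + 2 * x * sin (2 * x)) / (cosh l - cos (2 * x)) - 2 * x * cos x / sin x
   = (l * sinh l - 2 * x * cos x / sin x * (cosh l - 1)) / (cosh l - cos (2 * x)).
  move: D0; rewrite sin_double cos_double => D0; field.
  by rewrite !gt_eqF.
rewrite ler_pdivlMr//.
have hk : x ^+ 2 / 6 <= 2 - 2 * x * cos x / sin x.
  have -> : 2 - 2 * x * cos x / sin x = 2 * (sin x - x * cos x) / sin x.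
    by field; rewrite gt_eqF.
  rewrite ler_pdivlMr//.
  apply: (@le_trans _ _ (x ^+ 3 / 6)); last by lra.
  by rewrite (exprSr x 2); nra.
set k := 2 * x * cos x / sin x in hk *.
have N1 := mul_sinh_ge4 (ltW l0).
have c4 := cosh_ge4 (ltW l0).
set S := l * sinh l in N1 *.
have kk : S - k * (cosh l - 1) >= x ^+ 2 / 6 * (cosh l - 1) + (S - 2 * (cosh l - 1)).
  have : 0 <= (2 - k - x ^+ 2 / 6) * (cosh l - 1) by apply: mulr_ge0; lra.
  by lra.
apply: le_trans kk.
have l4 : l ^+ 4 = l ^+ 2 * l ^+ 2 by rewrite -exprD.
rewrite l4 in c4.
have [l1|l1] := leP l 1.
  have cs := @cosh_le_sqr _ l; rewrite (ltW l0) l1 in cs.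
  have {}cs := cs isT.
  have lm : l ^+ 2 <= 1 by rewrite exprn_ile1// ltW.
  rewrite (min_idPl lm) cos_double.
  have s2x : sin x ^+ 2 <= x ^+ 2 by rewrite lerXn2r ?nnegrE//; lra.
  set L := l ^+ 2 in l2 lm cs c4 ch2 N1 *.
  set X := x ^+ 2 in s2x *.
  apply: (@le_trans _ _ (L / 40 * (5 / 4 * L + 2 * X))).
    by apply: ler_wpM2l; lra.
  have X0 : 0 <= X by rewrite sqr_ge0.
  have : 0 <= X / 6 * (cosh l - 1 - L / 2) by apply: mulr_ge0; lra.
  have : 0 <= X * L by apply: mulr_ge0; lra.
  have : 0 <= L * L by apply: mulr_ge0; lra.
  lra.
have lm : 1 <= l ^+ 2 by rewrite exprn_ege1// ltW.
rewrite (min_idPr lm).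
have cg := cos_geN1 (2 * x).
have : 0 <= x ^+ 2 / 6 * (cosh l - 1).
  by apply: mulr_ge0; [rewrite divr_ge0// sqr_ge0|lra].
set L := l ^+ 2 in l2 lm c4 ch2 N1 *.
have : L <= L * L by nra.
lra.
Qed.

(** The height h changes the value by - h S / 2 to first order. The second-order error 24 (h/2)^2 =
    6 h^2 is absorbed by [coth_gain], because h <= l / 16 and 6 / 256 < 1 / 40. *)
Lemma Re_coth_shift r l h : 0 < r < pi / 2 -> 0 < l -> 0 <= h -> h <= l / 16 -> h <= 1 / 16 ->
  2 * r * cos r / sin r - h / 2 * saddleS r <=
  (l * sinh l + (2 * r + h) * sin (2 * r + h)) / (cosh l - cos (2 * r + h)).
Proof.
move=> /andP[r0 rp] l0 h0 hl h1.
have p2 := @pihalf_lt2 R.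
have -> : 2 * r + h = 2 * (r + h / 2) by field.
have g := @coth_gain (r + h / 2) l l0.
have {}g := g ltac:(apply/andP; split; lra).
have t := @cot_tangent_ge r (h / 2) r0 ltac:(lra) ltac:(lra) ltac:(lra).
suff : 24 * (h / 2) ^+ 2 <= Num.min (l ^+ 2) 1 / 40.
  move: g t; set A := _ / (cosh l - _); set C := sin (r + _); set D := cos (r + _) => g t q.
  have -> : 2 * r * cos r / sin r = 2 * (r * cos r / sin r) by rewrite -!mulrA.
  have e1 : 2 * (r + h / 2) * D / C = 2 * ((r + h / 2) * D / C) by rewrite !mulrA.
  rewrite e1 in g; lra.
rewrite minElt; case: ifP => _; nra.
Qed.

End coth_shift.

Section tanh_numerator.
Context {R : realType}.
Implicit Types (r l h : R).

Lemma cosD_le r e : 0 <= r <= 2 -> 0 <= e <= 2 -> 0 <= cos r -> cos (r + e) <= cos r.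
Proof.
move=> r02 e02 c0; rewrite cosD.
have sr : 0 <= sin r by have := @sin_ge_third _ r r02; case/andP: r02; lra.
have se : 0 <= sin e by have := @sin_ge_third _ e e02; case/andP: e02; lra.
have ce := cos_le1 e.
have : 0 <= sin r * sin e by rewrite mulr_ge0.
nra.
Qed.

(** Counterpart of [cot_tangent] for 2 y tan y and its tangent line at r. It is multiplied by cos (r
    + e), as r + e may pass pi / 2. *)
Lemma tan_num_id r e : cos r != 0 ->
  cos (r + e) * (2 * r * sin r / cos r + e * saddleT r) - 2 * (r + e) * sin (r + e)
  = - (2 * (r * (sin e - e * cos e) / cos r + e * sin e / cos r
            + e * r * sin r * sin e / cos r ^+ 2)).
Proof.
move=> c0; rewrite /saddleT cosD sinD.
have h := cos2Dsin2 r.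
set s := sin r in h *; set c := cos r in c0 h *; set f := sin e; set d := cos e.
have hf : f * (c ^+ 2 + s ^+ 2) = f by rewrite h mulr1.
transitivity (- (2 * (r * (f * (c ^+ 2 + s ^+ 2) - e * d) / c
  + e * (f * (c ^+ 2 + s ^+ 2)) / c + e * r * s * f / c ^+ 2))); last by rewrite hf.
by field.
Qed.

(** The denominator is cleared because it degenerates when l and cos r are both small. Since cos r +
    r sin r >= 1/3 there is a gain l^2 / (3 cos r); half of it pays for the remainder of
    [tan_num_id], by h <= l / 16, and half is kept for [Re_tanh_shift_strong]. *)
Lemma tanh_num_ge r l h : 0 <= r < pi / 2 -> 0 < l -> 0 <= h -> h <= l / 16 -> h <= 1 / 16 ->
  l ^+ 2 / (6 * cos r) + (cosh l - 1) * (h / 2 * saddleT r) <=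
  (l * sinh l - (2 * r + h) * sin (2 * r + h)) +
  (cosh l + cos (2 * r + h)) * (2 * r * sin r / cos r + h / 2 * saddleT r).
Proof.
move=> /andP[r0 rp] l0 h0 hl h1.
have p2 := @pihalf_lt2 R.
pose e := h / 2; have -> : 2 * r + h = 2 * (r + e) by rewrite /e; field.
rewrite -/e; have e0 : 0 <= e by rewrite /e; lra.
have el : e <= l / 32 by rewrite /e; lra.
have e1 : e <= 1 / 32 by rewrite /e; lra.
have c0 : 0 < cos r by rewrite cos_gt0_pihalf//; apply/andP; split; lra.
rewrite sin_double cos_double'.
set B := (_ / cos r + e * _).
have id := @tan_num_id r e (lt0r_neq0 c0); rewrite -/B in id.
set C := cos (r + e) in id *; set Y := (X in _ = X) in id.
have -> : l * sinh l - 2 * (r + e) * (2 * sin (r + e) * C) + (cosh l + (2 * C ^+ 2 - 1)) * B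
  = l * sinh l + (cosh l - 1) * B + 2 * C * Y by rewrite -id; ring.
have sr := sin_le r0; have s3 : r / 3 <= sin r by have := @sin_ge_third _ r; lra.
have se := sin_le e0; have se3 : e / 4 <= sin e by have := @sin_ge_quarter _ e; lra.
have sc3 := sin_sub_mul_cos_le e0.
have sc0 : 0 <= sin e - e * cos e.
  by have := @sin_sub_mul_cos_ge _ e; have := exprn_ge0 3 e0; lra.
have ch2 := cosh_ge2 (ltW l0).
have sh := sinh_ge (ltW l0).
have s1 := sin_le1 r.
have c1 := cos_le1 r.
set s := sin r in sr s3 s1 *; set c := cos r in c0 c1 *.
have c0' := ltW c0; have s0 : 0 <= s by lra.
have se0 : 0 <= sin e by lra.
have cY : - (13 * e ^+ 2 / c) <= 2 * C * Y.
  have Y0 : 0 <= - Y.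
    by rewrite opprK -/s -/c !(sc0, mulr_ge0, divr_ge0, invr_ge0, exprn_ge0, addr_ge0).
  (* Beyond pi / 2 the factor cos (r + e) is negative and the remainder has the favourable sign. *)
  have [C0|C0] := leP 0 C; last first.
    apply: (@le_trans _ _ 0); last by nra.
    by rewrite oppr_le0 divr_ge0 ?mulr_ge0 ?sqr_ge0//; lra.
  have Cc : C <= c.
    by apply: cosD_le; [rewrite r0; lra|rewrite e0; lra|exact: ltW].
  have : - Y <= 2 * (2 * (e ^+ 3 / 3) / c + e * e / c + e * 2 * 1 * e / c ^+ 2).
    rewrite opprK ler_wpM2l// !lerD// ler_pM2r ?invr_gt0 ?exprn_gt0//.
    - by apply: ler_pM => //; lra.
    - by apply: ler_wpM2l.
    - apply: ler_pM => //; rewrite ?mulr_ge0//; try lra.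
      apply: ler_pM => //; rewrite ?mulr_ge0//; try lra.
      by apply: ler_wpM2l => //; lra.
  move=> Yb.
  have : 2 * C * - Y <= 2 * c * (2 * (2 * (e ^+ 3 / 3) / c + e * e / c + e * 2 * 1 * e / c ^+ 2)).
    by apply: ler_pM => //; lra.
  have -> : 2 * c * (2 * (2 * (e ^+ 3 / 3) / c + e * e / c + e * 2 * 1 * e / c ^+ 2)) =
    (c * (8 / 3 * e + 4) + 8) * e ^+ 2 / c by field; rewrite gt_eqF.
  have : (c * (8 / 3 * e + 4) + 8) * e ^+ 2 / c <= 13 * e ^+ 2 / c.
    rewrite ler_pM2r ?invr_gt0// ler_wpM2r ?sqr_ge0//.
    nra.
  lra.
have e2 : 13 * e ^+ 2 / c <= 1 / 6 * l ^+ 2 / c.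
  rewrite ler_pM2r ?invr_gt0//; nra.
have G : 1 / 3 * l ^+ 2 / c <= l * sinh l + (cosh l - 1) * (2 * r * s / c).
  apply: (@le_trans _ _ (l * l + l ^+ 2 / 2 * (2 * r * s / c))); last first.
    apply: lerD; first by nra.
    rewrite ler_wpM2r//; last by lra.
    by rewrite divr_ge0// ?mulr_ge0//; lra.
  have -> : l * l + l ^+ 2 / 2 * (2 * r * s / c) = (c + r * s) * l ^+ 2 / c.
    by field; rewrite gt_eqF.
  rewrite ler_pM2r ?invr_gt0// ler_wpM2r ?sqr_ge0//.
  have [r1|r1] := leP r 1; last by nra.
  have := cos_ge2 r0; rewrite -/c; nra.
rewrite /B mulrDr -/s -/c.
have -> : l ^+ 2 / (6 * c) = 1 / 6 * l ^+ 2 / c by field; rewrite gt_eqF.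
lra.
Qed.

End tanh_numerator.

Section tanh_shift.
Context {R : realType}.
Implicit Types (r l h : R).

Lemma saddleT_le r : 0 <= r < pi / 2 -> 0 <= saddleT r <= 6 / cos r ^+ 2.
Proof.
move=> /andP[r0 rp].
have p2 := @pihalf_lt2 R.
have c0 : 0 < cos r by rewrite cos_gt0_pihalf//; apply/andP; split; lra.
have s0 : 0 <= sin r by have := @sin_ge_third _ r; lra.
have s1 := sin_le1 r; have c1 := cos_le1 r.
rewrite /saddleT divr_ge0 ?sqr_ge0//=.
  by rewrite ler_pM2r ?invr_gt0 ?exprn_gt0//; nra.
by rewrite mulr_ge0// addr_ge0// mulr_ge0// ltW.
Qed.

Lemma cosh_add_cos_gt0 (l y : R) : 0 < l -> 0 < cosh l + cos y.
Proof.
move=> l0; have := cosh_ge2 (ltW l0); have := cos_geN1 y.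
have : 0 < l ^+ 2 by rewrite exprn_gt0.
lra.
Qed.

Lemma Re_tanh_shift r l h : 0 <= r < pi / 2 -> 0 < l -> 0 <= h -> h <= l / 16 -> h <= 1 / 16 ->
  - (2 * r * sin r / cos r) - h / 2 * saddleT r <=
  (l * sinh l - (2 * r + h) * sin (2 * r + h)) / (cosh l + cos (2 * r + h)).
Proof.
move=> rp l0 h0 hl h1.
have D0 := @cosh_add_cos_gt0 l (2 * r + h) l0.
have N := @tanh_num_ge R r l h rp l0 h0 hl h1.
have c0 : 0 < cos r.
  by case/andP: rp => ? ?; rewrite cos_gt0_pihalf//; apply/andP; split; have := @pi_gt0 R; lra.
rewrite ler_pdivlMr//.
have T0 : 0 <= saddleT r by case/andP: (saddleT_le rp).
have : 0 <= l ^+ 2 / (6 * cos r) + (cosh l - 1) * (h / 2 * saddleT r).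
  have c1 : 0 <= cosh l - 1 by have := cosh_ge1 l; lra.
  by rewrite !(c1, T0, sqr_ge0, mulr_ge0, invr_ge0, addr_ge0)// ltW.
lra.
Qed.

(** The denominator is at most 2 (l + cos r)^2. Of the two terms kept in [tanh_num_ge], the one with
    h >= l / 32 dominates T l^3 / 128 and the other dominates T l^2 cos r / 128, by T <= 6 /
    cos(r)^2. For l beyond cos r the resulting gain is linear in l. *)
Lemma Re_tanh_shift_strong r l h : 0 <= r < pi / 2 -> 0 < l <= 1 -> l / 32 <= h -> h <= l / 16 ->
  - (2 * r * sin r / cos r) - h / 2 * saddleT r
    + saddleT r * l ^+ 2 / (256 * (l + cos r)) <=
  (l * sinh l - (2 * r + h) * sin (2 * r + h)) / (cosh l + cos (2 * r + h)).
Proof.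
move=> rp /andP[l0 l1] h0 hl.
have D0 := @cosh_add_cos_gt0 l (2 * r + h) l0.
have N := @tanh_num_ge R r l h rp l0 ltac:(lra) hl ltac:(lra).
have c0 : 0 < cos r.
  by case/andP: rp => ? ?; rewrite cos_gt0_pihalf//; apply/andP; split; have := @pi_gt0 R; lra.
have [T0 T6] := andP (saddleT_le rp).
have cs : cosh l <= 1 + 5 / 4 * l ^+ 2 by apply: cosh_le_sqr; rewrite (ltW l0).
have ch2 := cosh_ge2 (ltW l0).
rewrite ler_pdivlMr//.
suff M : saddleT r * l ^+ 2 / (256 * (l + cos r)) * (cosh l + cos (2 * r + h)) <=
   l ^+ 2 / (6 * cos r) + (cosh l - 1) * (h / 2 * saddleT r) by lra.
have Db : cosh l + cos (2 * r + h) <= 2 * (l + cos r) ^+ 2.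
  have p2 := @pihalf_lt2 R.
  have r0 : 0 <= r <= 2 by case/andP: rp => ? ?; apply/andP; split; lra.
  pose e := h / 2; have e2 : 0 <= e <= 2 by rewrite /e; apply/andP; split; lra.
  have -> : 2 * r + h = 2 * (r + e) by rewrite /e; field.
  rewrite cos_double'.
  have := cosD_le r0 e2 (ltW c0).
  have : - l <= cos (r + e).
    rewrite cosD.
    have e0 : 0 <= e by case/andP: e2.
    have := sin_le e0; have := sin_le1 r; have := @sin_ge_third _ e e2; have := @sin_ge_third _ r r0.
    have ce : 0 <= cos e by have := cos_ge2 e0; rewrite /e; nra.
    have : 0 <= cos r * cos e by rewrite mulr_ge0 // ltW.
    rewrite /e in e0 *; case/andP: r0 => ? ?; nra.
  move=> h3 h2.
  have : cos (r + e) ^+ 2 <= cos r ^+ 2 + l ^+ 2 / 4.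
    have [?|?] := leP 0 (cos (r + e)); first by nra.
    have : - (l / 2) <= cos (r + e).
      have e0 : 0 <= e by case/andP: e2.
      have := sin_le e0; have := sin_le1 r; have := @sin_ge_third _ e e2; have := @sin_ge_third _ r r0.
      have ce : 0 <= cos e by have := cos_ge2 e0; rewrite /e; nra.
      have : 0 <= cos r * cos e by rewrite mulr_ge0 // ltW.
      rewrite cosD; rewrite /e in e0 *; case/andP: r0 => ? ?; nra.
    nra.
  nra.
set T := saddleT r in T0 T6 *; set c := cos r in c0 T6 Db *.
apply: (@le_trans _ _ (T * l ^+ 2 / (256 * (l + c)) * (2 * (l + c) ^+ 2))).
  have lc0 : 0 <= 256 * (l + c) by lra.
  by apply: ler_wpM2l => //; exact: divr_ge0 (mulr_ge0 T0 (sqr_ge0 l)) lc0.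
have -> : T * l ^+ 2 / (256 * (l + c)) * (2 * (l + c) ^+ 2) = T * l ^+ 2 * (l + c) / 128.
  by field; rewrite gt_eqF//; lra.
apply: (@le_trans _ _ (l ^+ 2 / (6 * c) + l ^+ 2 / 2 * (l / 64 * T))); last first.
  rewrite lerD2l; apply: ler_pM.
  - by rewrite divr_ge0// sqr_ge0.
  - by rewrite mulr_ge0//; lra.
  - by lra.
  - by apply: ler_wpM2r => //; lra.
have : T * l ^+ 2 * c / 128 <= l ^+ 2 / (6 * c).
  have -> : l ^+ 2 / (6 * c) = l ^+ 2 * c * (6 / c ^+ 2 / 36) by field; rewrite gt_eqF.
  have lc : 0 <= l ^+ 2 * c by apply: mulr_ge0; [exact: sqr_ge0|exact: ltW].
  have T6' : 0 <= 6 / c ^+ 2 - T by rewrite subr_ge0.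
  have := mulr_ge0 lc T6'; have := mulr_ge0 lc T0.
  lra.
lra.
Qed.

End tanh_shift.

(** * The modulus of z / sinh z on the contour *)

Section amplitude.
Context {R : realType}.
Implicit Types (r l h : R).

(** If cos x is still at least cos r / 2 at the half-angle x, the term sin(2 x)^2 suffices.
    Otherwise the slant has already consumed half of cos r, so e >= cos r / 4, hence l >= 8 cos r,
    and sinh l >= l suffices. *)
Lemma quotient_sinh_le r l h : 0 <= r < pi / 2 -> 0 < l -> 0 <= h -> h <= l / 16 -> h <= 1 / 16 ->
  l ^+ 2 + (2 * r + h) ^+ 2 <= 64 / cos r ^+ 2 * (sinh l ^+ 2 + sin (2 * r + h) ^+ 2).
Proof.
move=> rp l0 h0 hl h1.
have p2 := @pihalf_lt2 R.
have r02 : 0 <= r < 2 by case/andP: rp => ? ?; apply/andP; split; lra.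
pose e := h / 2; have -> : 2 * r + h = 2 * (r + e) by rewrite /e; field.
have e0 : 0 <= e by rewrite /e; lra.
have el : e <= l / 32 by rewrite /e; lra.
have e1 : e <= 1 / 32 by rewrite /e; lra.
have c0 : 0 < cos r.
  by case/andP: rp => ? ?; rewrite cos_gt0_pihalf//; apply/andP; split; lra.
have c1 := cos_le1 r.
have sh : l ^+ 2 <= sinh l ^+ 2.
  by have := sinh_ge (ltW l0); have := ltW l0; nra.
set x := r + e; have x0 : 0 <= x <= 21 / 10.
  by case/andP: r02; rewrite /x => ? ?; apply/andP; split; lra.
have sx := sin_ge_quarter x0.
rewrite mulrAC ler_pdivlMr ?exprn_gt0// sin_double.
set c := cos r in c0 c1 *.
have c2 : c ^+ 2 <= 1 by nra.
have xx : x ^+ 2 <= 16 * sin x ^+ 2 by nra.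
have [C0|C0] := leP (c / 2) (cos x).
  have : l ^+ 2 * c ^+ 2 <= l ^+ 2 by have := sqr_ge0 l; nra.
  have : c ^+ 2 <= 4 * cos x ^+ 2 by nra.
  have := sqr_ge0 (sin x); have := sqr_ge0 x; have := sqr_ge0 l; have := sqr_ge0 c.
  set X := x ^+ 2; set S := sin x ^+ 2 in xx *; set Cx := cos x ^+ 2; set L := l ^+ 2 in sh *.
  have -> : (2 * sin x * cos x) ^+ 2 = 4 * S * Cx by rewrite /S /Cx; ring.
  have -> : (2 * x) ^+ 2 = 4 * X by rewrite /X; ring.
  move=> a1 a2 a3 a4 a5 a6.
  have : X * c ^+ 2 <= 16 * S * (4 * Cx) by apply: ler_pM => //; lra.
  lra.
have : c / 4 <= e.
  have : cos x = c * cos e - sin r * sin e by rewrite /x cosD.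
  have := cos_ge2 e0; have := sin_le e0; have := sin_le1 r.
  have := @sin_ge_quarter _ e; have := @sin_ge_third _ r.
  have e2 : e ^+ 2 <= 1 / 32 by nra.
  move=> h2 h3 h4 h5 h6 h7.
  have s1 : 0 <= sin e by lra.
  have s2 : 0 <= sin r by lra.
  have : sin r * sin e <= e by nra.
  have : 3 / 4 * c <= c * cos e by nra.
  lra.
move=> ce.
have cl : c <= l / 8 by lra.
have : c ^+ 2 <= l ^+ 2 / 64 by nra.
have : l ^+ 2 * c ^+ 2 <= l ^+ 2 by have := sqr_ge0 l; nra.
have : x ^+ 2 <= 5 by case/andP: x0; nra.
have := sqr_ge0 (2 * sin x * cos x); have := sqr_ge0 x; have := sqr_ge0 c; nra.
Qed.

(** Here l^2 <= 4 exp(- l) sinh(l)^2 and y^2 <= 25 l^2, whence 104 = 4 * 26. *)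
Lemma quotient_sinh_le_exp (l y : R) : 1 <= l -> 0 <= y <= 5 ->
  l ^+ 2 + y ^+ 2 <= 104 * expR (- l) * (sinh l ^+ 2 + sin y ^+ 2).
Proof.
move=> l1 /andP[y0 y5].
have l0 : 0 <= l by lra.
have h := sinh_ge_exp l0.
have E : expR (- l) * (expR (l / 2)) ^+ 2 = 1.
  by rewrite expr2 -!expRD -[RHS]expR0; congr expR; field.
have e1 := expR_gt0 (- l); have e2 := expR_gt0 (l / 2).
have : (l * expR (l / 2)) ^+ 2 <= (2 * sinh l) ^+ 2.
  have a1 : 0 <= l * expR (l / 2) by rewrite mulr_ge0// ltW.
  by rewrite lerXn2r// nnegrE; lra.
rewrite [X in X <= _]exprMn [X in _ <= X]exprMn => h2.
have : expR (- l) * (l ^+ 2 * (expR (l / 2)) ^+ 2) <= expR (- l) * (2 ^+ 2 * sinh l ^+ 2).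
  by apply: ler_wpM2l; rewrite ?expR_ge0.
rewrite mulrCA E mulr1 => h3.
have : 0 <= expR (- l) * sin y ^+ 2 by rewrite mulr_ge0 ?sqr_ge0// ltW.
nra.
Qed.

End amplitude.

Section saddle_monotonicity.
Context {R : realType}.
Implicit Types (r l h : R).

Lemma saddleS_ge0 r : 0 <= r -> 0 <= saddleS r.
Proof.
move=> r0; rewrite /saddleS divr_ge0 ?sqr_ge0// mulr_ge0// subr_ge0.
exact: sin_mul_cos_le.
Qed.

Lemma is_derive_saddleS r : 0 < r <= 21 / 10 ->
  is_derive r 1 saddleS (4 * (sin r - r * cos r) / sin r ^+ 3).
Proof.
move=> /andP[r0 r2]; have s0 : 0 < sin r by have := @sin_ge_quarter _ r; lra.
rewrite /saddleS; drv_eq.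
  by rewrite expf_neq0// gt_eqF.
have h : sin r * (cos r ^+ 2 + sin r ^+ 2) = sin r by rewrite cos2Dsin2 mulr1.
transitivity ((2 * (sin r * (cos r ^+ 2 + sin r ^+ 2)) + 2 * sin r - 4 * (r * cos r)) / sin r ^+ 3).
  by field; rewrite gt_eqF.
by rewrite h; field; rewrite gt_eqF.
Qed.

(** With [saddleT_nondecr] this is the concavity of V: the inequality V' >= 0 at a critical point
    persists at every smaller angle. *)
Lemma saddleS_nondecr r r' : 0 < r -> r <= r' -> r' <= 2 -> saddleS r <= saddleS r'.
Proof.
move=> r0 rr r2.
have [] := @MVT_segment _ saddleS (fun r => 4 * (sin r - r * cos r) / sin r ^+ 3) r r' rr.
- by move=> z; rewrite in_itv/= => /andP[? ?]; apply: is_derive_saddleS; apply/andP; split; lra.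
- apply: derivable_within_continuous => z; rewrite in_itv/= => /andP[? ?].
  have zp : 0 < z <= 21 / 10 by apply/andP; split; lra.
  by have [] := is_derive_saddleS zp.
move=> z; rewrite in_itv/= => /andP[? ?] E; rewrite -subr_ge0 E mulr_ge0 ?subr_ge0//.
have s0 : 0 < sin z by have := @sin_ge_quarter _ z; lra.
rewrite divr_ge0 ?exprn_ge0 ?ltW// mulr_gt0//.
have := @sin_sub_mul_cos_ge _ z; have : 0 < z ^+ 3 by rewrite exprn_gt0//; lra.
lra.
Qed.

Lemma saddleT_nondecr r r' : 0 <= r -> r <= r' -> r' < pi / 2 -> saddleT r <= saddleT r'.
Proof.
move=> r0 rr r2.
have p2 := @pihalf_lt2 R.
have c0 : 0 < cos r' by rewrite cos_gt0_pihalf//; apply/andP; split; lra.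
have c1 : cos r' <= cos r.
  have -> : r' = r + (r' - r) by ring.
  apply: cosD_le; [apply/andP; split; lra|apply/andP; split; lra|].
  by rewrite ltW// cos_gt0_pihalf//; apply/andP; split; lra.
have s1 : sin r <= sin r'.
  by rewrite le_eqVlt; have := @ltr_sin R r r'; rewrite !in_itv/= => H; 
     move: rr; rewrite le_eqVlt => /orP[/eqP->|lt]; rewrite ?eqxx// H ?lt ?orbT//; lra.
have s0 : 0 <= sin r by have := @sin_ge_third _ r; lra.
have E (y : R) : cos y != 0 -> saddleT y = 2 * (y * ((cos y)^-1) ^+ 2 + sin y * (cos y)^-1).
  by move=> ?; rewrite /saddleT; field.
rewrite !E ?gt_eqF//; last by lra.
have i1 : (cos r)^-1 <= (cos r')^-1 by rewrite lef_pV2 ?posrE//; lra.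
have i0 : 0 < (cos r)^-1 by rewrite invr_gt0; lra.
rewrite ler_wpM2l// lerD//.
  apply: ler_pM => //; first exact: sqr_ge0.
  by rewrite lerXn2r// nnegrE; lra.
by apply: ler_pM => //; rewrite ltW.
Qed.

End saddle_monotonicity.

(** * Change of contour *)

Section homotopy.
Local Open Scope classical_set_scope.
Context {R : realType}.
Variables (P W E : R -> R -> R).
Hypothesis dP : forall s l : R, 0 < l -> is_derive s 1 (P ^~ l) (E s l).
Hypothesis dW : forall s l : R, 0 < l -> is_derive l 1 (W s) (E s l).
Hypothesis cE : forall s l : R, 0 < l -> {for (s, l), continuous (fun p : R * R => E p.1 p.2)}.
Hypothesis cP : forall s l : R, 0 < l -> {for l, continuous (P s)}.
Hypothesis cW : forall s l : R, 0 < l -> {for s, continuous (W ^~ l)}.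

Let mu := @lebesgue_measure R.

Let continuous_on_segment (f : R -> R) (a b : R) : (forall x, a <= x <= b -> {for x, continuous f}) ->
  {within `[a, b], continuous f}.
Proof.
move=> cf; apply: continuous_in_subspaceT => x.
by rewrite inE/= in_itv/=; exact: cf.
Qed.

Let integrable_segment (f : R -> R) (a b : R) : (forall x, a <= x <= b -> {for x, continuous f}) ->
  mu.-integrable `[a, b] (EFin \o f).
Proof.
move=> cf; apply: continuous_compact_integrable; first exact: segment_compact.
exact: continuous_on_segment.
Qed.

(** The range of s exceeds [0, 1] on both sides, so that 0 and 1 are interior points when
    differentiating under the integral. *)
Let E_bounded (d m : R) : 0 < d -> exists2 K, 0 <= K &
  forall s l, -1 <= s <= 2 -> d <= l <= m -> `|E s l| <= K.
Proof.
move=> d0.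
have cA : compact (`[-1, 2] `*` `[d, m] : set (R * R)).
  by apply: compact_setX; exact: segment_compact.
have : compact ((fun p : R * R => E p.1 p.2) @` (`[-1, 2] `*` `[d, m])).
  apply: continuous_compact => //; apply: continuous_in_subspaceT => -[s l].
  rewrite inE /= !in_itv/= => -[_ /andP[dl _]]; apply: cE; exact: lt_le_trans dl.
move=> /compact_bounded[K0 [_ /(_ (`|K0| + 1))]].
rewrite (le_lt_trans (ler_norm _)) ?ltrDl// => /(_ isT) H.
exists (`|K0| + 1); first by rewrite addr_ge0.
move=> s l sI lI; apply: H => /=; exists (s, l) => //=.
Qed.

(* Green's formula for the closed form [P dl + W ds] on a rectangle. *)
Lemma homotopy_invariance (d m : R) : 0 < d -> d < m ->
  \int[mu]_(l in `[d, m]) P 1 l - \int[mu]_(l in `[d, m]) P 0 l =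
  \int[mu]_(s in `[0%R, 1%R]) (W s m - W s d).
Proof.
move=> d0 dm.
have l0 l : d <= l <= m -> 0 < l by move=> /andP[/(lt_le_trans d0)].
have [K K0 EK] := @E_bounded d m d0.
(* I'(s) is the integral of [E s], that is of the l-derivative of [W s], hence a difference of
   boundary values; integrating it over [0, 1] gives the claim. *)
pose I s := \int[mu]_(l in `[d, m]) P s l.
have mD : measurable (`[d, m] : set R) by exact: measurable_itv.
have intP s : mu.-integrable `[d, m] (EFin \o P s).
  by apply: integrable_segment => l /l0; exact: cP.
have d1 s l : 0 < l -> (P ^~ l)^`() s = E s l.
  by move=> lp; have [_ <-] := dP s lp; rewrite derive1E.
have intK : mu.-integrable `[d, m] (EFin \o cst K).
  by apply: integrable_segment => l _; exact: cvg_cst.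
have FTCl s : \int[mu]_(l in `[d, m]) E s l = W s m - W s d.
  rewrite /Rintegral (@continuous_FTC2 _ (E s) (W s))//.
  - apply: continuous_on_segment => l /l0 lp.
    have := @cE s l lp.
    move=> c; apply: (@continuous_comp _ _ _ (fun l => (s, l)) (fun p : R * R => E p.1 p.2)) => //.
    exact: (@cvg_pair _ _ _ (nbhs l) (nbhs s) (nbhs l) _ _ _ (cst s) id (cvg_cst s) cvg_id).
  - have cWs l : 0 < l -> {for l, continuous (W s)}.
      by move=> lp; apply: differentiable_continuous; apply/derivable1_diffP; case: (dW s lp).
    split.
    + move=> l; rewrite in_itv/= => /andP[dl _]; by case: (dW s (lt_trans d0 dl)).
    + by apply: cvg_at_right_filter; exact: cWs.
    + by apply: cvg_at_left_filter; apply: cWs; exact: lt_trans dm.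
  - move=> l; rewrite in_itv/= => /andP[dl _].
    have lp : 0 < l by exact: lt_trans dl.
    by have [_ <-] := dW s lp; rewrite derive1E.
have hyp s : s \in `](-1), 2[%R -> I^`() s = W s m - W s d /\ derivable I s 1.
  move=> sI; split.
    rewrite (@differentiation_under_integral _ _ _ mu P `[d, m] mD s (-1) 2 _ _ _ (cst K)) //.
    - rewrite -FTCl; apply: eq_Rintegral => l; rewrite inE/= in_itv/= => /l0 lp.
      by rewrite /partial1of2 d1.
    - by move=> x y _ /=; rewrite in_itv/= => /l0 lp; case: (dP x lp).
    - move=> x y /=; rewrite !in_itv/= => /andP[x1 x2] yI.
      by rewrite /partial1of2 d1 ?(l0 _ yI)//; apply: EK => //; rewrite !ltW.
  apply: (@derivable_under_integral _ _ _ mu P `[d, m] mD s (-1) 2 _ _ _ (cst K)) => //.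
  - by move=> x y _ /=; rewrite in_itv/= => /l0 lp; case: (dP x lp).
  - move=> x y /=; rewrite !in_itv/= => /andP[x1 x2] yI.
    by rewrite /partial1of2 d1 ?(l0 _ yI)//; apply: EK => //; rewrite !ltW.
rewrite [RHS]/Rintegral (@continuous_FTC2 _ _ I)//.
- by apply: continuous_on_segment => s _; apply: cvgB; apply: cW => //; exact: lt_trans dm.
- have cI s : s \in `](-1), 2[%R -> {for s, continuous I}.
    by move=> /hyp[_ ds]; apply: differentiable_continuous; apply/derivable1_diffP.
  split.
  + move=> s; rewrite in_itv/= => /andP[s0 s1]; apply: (hyp _ _).2.
    by rewrite in_itv/=; apply/andP; split; lra.
  + by apply: cvg_at_right_filter; apply: cI; rewrite in_itv/=; apply/andP; split; lra.
  + by apply: cvg_at_left_filter; apply: cI; rewrite in_itv/=; apply/andP; split; lra.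
- move=> s; rewrite in_itv/= => /andP[s0 s1]; apply: (hyp _ _).1.
  by rewrite in_itv/=; apply/andP; split; lra.
Qed.

End homotopy.

(** * Calculus of complex-valued functions through real and imaginary parts *)

Section complex_calculus.
Local Open Scope classical_set_scope.
Local Open Scope complex_scope.
Context {R : realType}.
Implicit Types (z w : R[i]).
Local Notation Re := (@complex.Re R).
Local Notation Im := (@complex.Im R).

Lemma Re_add z w : Re (z + w) = Re z + Re w. Proof. by case: z w => ? ? []. Qed.
Lemma Im_add z w : Im (z + w) = Im z + Im w. Proof. by case: z w => ? ? []. Qed.
Lemma Re_opp z : Re (- z) = - Re z. Proof. by case: z. Qed.
Lemma Im_opp z : Im (- z) = - Im z. Proof. by case: z. Qed.
Lemma Re_mul z w : Re (z * w) = Re z * Re w - Im z * Im w.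
Proof. by case: z w => ? ? []. Qed.
Lemma Im_mul z w : Im (z * w) = Re z * Im w + Im z * Re w.
Proof. by case: z w => ? ? []. Qed.
Lemma Re_inv z : Re z^-1 = Re z / (Re z ^+ 2 + Im z ^+ 2). Proof. by case: z. Qed.
Lemma Im_inv z : Im z^-1 = - (Im z / (Re z ^+ 2 + Im z ^+ 2)).
Proof. by case: z. Qed.
Lemma Re_cexp z : Re (cexp z) = expR (Re z) * cos (Im z).
Proof. by case: z => a b; rewrite /cexp Re_mul /= mul0r subr0. Qed.
Lemma Im_cexp z : Im (cexp z) = expR (Re z) * sin (Im z).
Proof. by case: z => a b; rewrite /cexp Im_mul /= mul0r addr0. Qed.

Lemma eq_complexP z w : Re z = Re w -> Im z = Im w -> z = w.
Proof. by case: z w => ? ? [? ?] /= -> ->. Qed.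

Lemma sqr_neq0 z : z != 0 -> Re z ^+ 2 + Im z ^+ 2 != 0.
Proof.
apply: contra => /eqP h; apply/eqP; have := sqr_ge0 (Re z); have := sqr_ge0 (Im z) => h1 h2.
have {}h2 : Re z ^+ 2 == 0 by apply/eqP; lra.
have {}h1 : Im z ^+ 2 == 0 by apply/eqP; lra.
by apply: eq_complexP; apply/eqP; [move: h2|move: h1]; rewrite expf_eq0.
Qed.

(* A logarithm on the right half-plane only. *)
Definition clog z : R[i] := (ln (Re z ^+ 2 + Im z ^+ 2) / 2) +i* atan (Im z / Re z).

(** Differentiation along a real parameter: holomorphic functions occur only composed with paths. *)
Definition cderiv (f : R -> R[i]) (r : R) (d : R[i]) :=
  is_derive r 1 (fun y => Re (f y)) (Re d) /\ is_derive r 1 (fun y => Im (f y)) (Im d).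

Lemma cderiv_eq f r d d' : cderiv f r d -> d = d' -> cderiv f r d'.
Proof. by move=> ? <-. Qed.

Lemma cderiv_cst r z : cderiv (fun=> z) r 0.
Proof. by split; exact: drv_cst. Qed.

Lemma cderivD f g r d e : cderiv f r d -> cderiv g r e ->
  cderiv (fun y => f y + g y) r (d + e).
Proof.
move=> [f1 f2] [g1 g2]; split.
  by under eq_fun do rewrite Re_add; rewrite Re_add; exact: drvD.
by under eq_fun do rewrite Im_add; rewrite Im_add; exact: drvD.
Qed.

Lemma cderivN f r d : cderiv f r d -> cderiv (fun y => - f y) r (- d).
Proof.
move=> [f1 f2]; split.
  by under eq_fun do rewrite Re_opp; rewrite Re_opp; exact: drvN.
by under eq_fun do rewrite Im_opp; rewrite Im_opp; exact: drvN.
Qed.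

Lemma cderivM f g r d e : cderiv f r d -> cderiv g r e ->
  cderiv (fun y => f y * g y) r (f r * e + g r * d).
Proof.
move=> [f1 f2] [g1 g2]; split.
  under eq_fun do rewrite Re_mul; notypeclasses refine (is_derive_eq _ _).
    exact: (drvD (drvM f1 g1) (drvN (drvM f2 g2))).
  by rewrite Re_add !Re_mul; ring.
under eq_fun do rewrite Im_mul; notypeclasses refine (is_derive_eq _ _).
  exact: (drvD (drvM f1 g2) (drvM f2 g1)).
by rewrite Im_add !Im_mul; ring.
Qed.

Lemma cderivV f r d : f r != 0 -> cderiv f r d ->
  cderiv (fun y => (f y)^-1) r (- (f r) ^- 2 * d).
Proof.
move=> f0 [f1 f2]; have n0 := sqr_neq0 f0.
have e1 : Re ((f r) ^- 2) = (Re (f r) ^+ 2 - Im (f r) ^+ 2) / (Re (f r) ^+ 2 + Im (f r) ^+ 2) ^+ 2.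
  by rewrite -exprVn expr2 Re_mul Re_inv Im_inv; field.
have e2 : Im ((f r) ^- 2) = - (2 * Re (f r) * Im (f r) / (Re (f r) ^+ 2 + Im (f r) ^+ 2) ^+ 2).
  by rewrite -exprVn expr2 Im_mul Re_inv Im_inv; field.
have fD := drvD (drvX 2 f1) (drvX 2 f2).
have fV := @drvV _ (fun y => Re (f y) ^+ 2 + Im (f y) ^+ 2) r _ n0 fD.
split.
  under eq_fun do rewrite Re_inv; notypeclasses refine (is_derive_eq _ _).
    exact: (drvM f1 fV).
  by rewrite Re_mul Re_opp Im_opp e1 e2 /=; field.
under eq_fun do rewrite Im_inv; notypeclasses refine (is_derive_eq _ _).
  exact: (drvN (drvM f2 fV)).
by rewrite Im_mul Re_opp Im_opp e1 e2 /=; field.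
Qed.

Lemma cderiv_cexp f r d : cderiv f r d ->
  cderiv (fun y => cexp (f y)) r (cexp (f r) * d).
Proof.
move=> [f1 f2]; split.
  under eq_fun do rewrite Re_cexp; notypeclasses refine (is_derive_eq _ _).
    exact: (drvM (drv_expR f1) (drv_cos f2)).
  by rewrite Re_mul Re_cexp Im_cexp; ring.
under eq_fun do rewrite Im_cexp; notypeclasses refine (is_derive_eq _ _).
  exact: (drvM (drv_expR f1) (drv_sin f2)).
by rewrite Im_mul Re_cexp Im_cexp; ring.
Qed.

Lemma cderiv_clog f r d : 0 < Re (f r) -> cderiv f r d ->
  cderiv (fun y => clog (f y)) r (d / f r).
Proof.
move=> f0 [f1 f2].
have n0 : 0 < Re (f r) ^+ 2 + Im (f r) ^+ 2 by rewrite ltr_pwDl ?exprn_gt0 ?sqr_ge0.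
split.
  rewrite /clog /=; notypeclasses refine (is_derive_eq _ _).
    exact: (drvM (@drv_ln _ (fun y => Re (f y) ^+ 2 + Im (f y) ^+ 2) r _ n0
      (drvD (drvX 2 f1) (drvX 2 f2))) (drv_cst r 2^-1)).
  by rewrite Re_mul Re_inv Im_inv /=; field; rewrite gt_eqF.
rewrite /clog /=; notypeclasses refine (is_derive_eq _ _).
  exact: (drv_atan (drvM f2 (@drvV _ (fun y => Re (f y)) r _ (lt0r_neq0 f0) f1))).
by rewrite Im_mul Re_inv Im_inv /=; field; rewrite !gt_eqF.
Qed.

Section continuity.
Context {T : topologicalType}.
Implicit Types (f g : T -> R[i]) (x : T).

Definition ccont f x := {for x, continuous (fun y => Re (f y))} /\
  {for x, continuous (fun y => Im (f y))}.

Lemma ccont_cst x z : ccont (fun=> z) x.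
Proof. by split; exact: cvg_cst. Qed.

Lemma ccontD f g x : ccont f x -> ccont g x -> ccont (fun y => f y + g y) x.
Proof.
move=> [f1 f2] [g1 g2]; split; rewrite /prop_for /continuous_at.
  by rewrite Re_add; under eq_fun do rewrite Re_add; exact: cvgD.
by rewrite Im_add; under eq_fun do rewrite Im_add; exact: cvgD.
Qed.

Lemma ccontN f x : ccont f x -> ccont (fun y => - f y) x.
Proof.
move=> [f1 f2]; split; rewrite /prop_for /continuous_at.
  by rewrite Re_opp; under eq_fun do rewrite Re_opp; exact: cvgN.
by rewrite Im_opp; under eq_fun do rewrite Im_opp; exact: cvgN.
Qed.

Lemma ccontM f g x : ccont f x -> ccont g x -> ccont (fun y => f y * g y) x.
Proof.
move=> [f1 f2] [g1 g2]; split; rewrite /prop_for /continuous_at.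
  by rewrite Re_mul; under eq_fun do rewrite Re_mul; apply: cvgB; exact: cvgM.
by rewrite Im_mul; under eq_fun do rewrite Im_mul; apply: cvgD; exact: cvgM.
Qed.

Lemma ccontV f x : f x != 0 -> ccont f x -> ccont (fun y => (f y)^-1) x.
Proof.
move=> f0 [f1 f2]; have n0 := sqr_neq0 f0.
have fD : (fun y => (Re (f y) ^+ 2 + Im (f y) ^+ 2)^-1) y @[y --> x] -->
   (Re (f x) ^+ 2 + Im (f x) ^+ 2)^-1.
  by apply: cvgV => //; apply: cvgD; apply: cvgM.
split; rewrite /prop_for /continuous_at.
  by rewrite Re_inv; under eq_fun do rewrite Re_inv; exact: cvgM.
by rewrite Im_inv; under eq_fun do rewrite Im_inv; apply: cvgN; exact: cvgM.
Qed.

Lemma ccont_cexp f x : ccont f x -> ccont (fun y => cexp (f y)) x.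
Proof.
move=> [f1 f2].
have e := continuous_comp f1 (@continuous_expR R _).
have c := continuous_comp f2 (@continuous_cos R _).
have s := continuous_comp f2 (@continuous_sin R _).
split; rewrite /prop_for /continuous_at.
  by rewrite Re_cexp; under eq_fun do rewrite Re_cexp; exact: cvgM.
by rewrite Im_cexp; under eq_fun do rewrite Im_cexp; exact: cvgM.
Qed.

Lemma ccont_clog f x : 0 < Re (f x) -> ccont f x -> ccont (fun y => clog (f y)) x.
Proof.
move=> f0 [f1 f2].
have n0 : 0 < Re (f x) ^+ 2 + Im (f x) ^+ 2 by rewrite ltr_pwDl ?exprn_gt0 ?sqr_ge0.
have fD : {for x, continuous (fun y => Re (f y) ^+ 2 + Im (f y) ^+ 2)}.
  by apply: cvgD; apply: cvgM.
split; rewrite /prop_for /continuous_at /clog /=.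
  apply: cvgM; last exact: cvg_cst.
  exact: (continuous_comp fD (@continuous_ln R _ n0)).
have fV : {for x, continuous (fun y => Im (f y) / Re (f y))}.
  by apply: cvgM => //; apply: cvgV => //; rewrite gt_eqF.
exact: (continuous_comp fV (@continuous_atan R _)).
Qed.

End continuity.

End complex_calculus.

Ltac cdrv := repeat lazymatch goal with
  | |- cderiv (fun _ => ?k) _ _ => exact: cderiv_cst
  | |- cderiv (fun y => @?f y + @?g y) _ _ => apply: (@cderivD _ f g)
  | |- cderiv (fun y => - @?f y) _ _ => apply: (@cderivN _ f)
  | |- cderiv (fun y => @?f y * @?g y) _ _ => apply: (@cderivM _ f g)
  | |- cderiv (fun y => (@?f y)^-1) _ _ => apply: (@cderivV _ f)
  | |- cderiv (fun y => cexp (@?f y)) _ _ => apply: (@cderiv_cexp _ f)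
  | |- cderiv (fun y => clog (@?f y)) _ _ => apply: (@cderiv_clog _ f)
  end.

Ltac ccnt := repeat lazymatch goal with
  | |- ccont (fun _ => ?k) _ => exact: ccont_cst
  | |- ccont (fun y => @?f y + @?g y) _ => apply: (@ccontD _ _ f g)
  | |- ccont (fun y => - @?f y) _ => apply: (@ccontN _ _ f)
  | |- ccont (fun y => @?f y * @?g y) _ => apply: (@ccontM _ _ f g)
  | |- ccont (fun y => (@?f y)^-1) _ => apply: (@ccontV _ _ f)
  | |- ccont (fun y => cexp (@?f y)) _ => apply: (@ccont_cexp _ _ f)
  | |- ccont (fun y => clog (@?f y)) _ => apply: (@ccont_clog _ _ f)
  end.

(** * The exponent of the integrand on the right half-plane *)

Section kernel_exponent.
Local Open Scope classical_set_scope.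
Local Open Scope complex_scope.
Context {R : realType}.
Variables (nu k A B u : R).
Implicit Types z : R[i].
Local Notation Re := (@complex.Re R).
Local Notation Im := (@complex.Im R).

(* Only meant for [0 < Re z], where every argument of [clog] has positive real
   part: [log (z / sinh z)] is [log z - z - log (1 - exp (- 2 z)) + log 2], and
   [tanh (z/2)], [coth (z/2)] are written in terms of [exp (- z)].
   Subtractions are spelled [+ -] for the tactics [cdrv] and [ccnt]. *)
Definition kernel_exponent z : R[i] :=
  nu%:C * (clog z + - z + - clog (1 + - cexp (- (z + z))) + (ln 2)%:C) +
  - (k%:C * (A%:C * (z * ((1 + - cexp (- z)) * (1 + cexp (- z))^-1)) +
             B%:C * (z * ((1 + cexp (- z)) * (1 + - cexp (- z))^-1)) +
             - ((0 +i* (2 * u)) * z))).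

Definition kernel_exponent' z : R[i] :=
  nu%:C * (z^-1 + - 1 + - (2 * cexp (- (z + z)) * (1 + - cexp (- (z + z)))^-1)) +
  - (k%:C * (A%:C * ((1 + - cexp (- z)) * (1 + cexp (- z))^-1 +
       z * (2 * cexp (- z) * ((1 + cexp (- z))^-1 * (1 + cexp (- z))^-1))) +
     B%:C * ((1 + cexp (- z)) * (1 + - cexp (- z))^-1 +
        - (z * (2 * cexp (- z) * ((1 + - cexp (- z))^-1 * (1 + - cexp (- z))^-1)))) +
     - (0 +i* (2 * u)))).

Lemma Re_expN_lt1 z (y : R) : 0 < Re z -> `|expR (- Re z) * cos y| < 1.
Proof.
move=> z0; rewrite normrM ger0_norm ?expR_ge0//.
have e1 : expR (- Re z) < 1 by rewrite -expR0 ltr_expR oppr_lt0.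
have := expR_gt0 (- Re z); have := cos_max y; have := normr_ge0 (cos y); nra.
Qed.

Lemma Re_gt0_neq0 z : 0 < Re z -> z != 0.
Proof. by apply: contraL => /eqP ->; rewrite ltxx. Qed.

Lemma Re_1D z : 0 < Re z -> 0 < Re (1 + cexp (- z)).
Proof.
move=> z0; rewrite Re_add Re_cexp Re_opp /=.
by have := Re_expN_lt1 (Im (- z)) z0; rewrite ltr_norml => /andP[? ?]; lra.
Qed.

Lemma Re_1B z : 0 < Re z -> 0 < Re (1 + - cexp (- z)).
Proof.
move=> z0; rewrite Re_add Re_opp Re_cexp Re_opp /=.
by have := Re_expN_lt1 (Im (- z)) z0; rewrite ltr_norml => /andP[? ?]; lra.
Qed.

Lemma Re_1B2 z : 0 < Re z -> 0 < Re (1 + - cexp (- (z + z))).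
Proof. by move=> z0; apply: Re_1B; rewrite Re_add addr_gt0. Qed.

Lemma cderiv_kernel_exponent (f : R -> R[i]) r d : 0 < Re (f r) -> cderiv f r d ->
  cderiv (fun y => kernel_exponent (f y)) r (kernel_exponent' (f r) * d).
Proof.
move=> f0 df; rewrite /kernel_exponent.
have n0 := Re_gt0_neq0 f0.
have n1 := Re_gt0_neq0 (Re_1D f0).
have n2 := Re_gt0_neq0 (Re_1B f0).
have p3 := Re_1B2 f0.
have n3 := Re_gt0_neq0 p3.
apply: cderiv_eq.
  by cdrv; (exact: df || exact: f0 || exact: n1 || exact: n2 || exact: p3).
rewrite /kernel_exponent' /=.
by field; rewrite n0 n1 n2 n3.
Qed.

Lemma ccont_kernel_exponent (T : topologicalType) (f : T -> R[i]) x : 0 < Re (f x) ->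
  ccont f x -> ccont (fun y => kernel_exponent (f y)) x.
Proof.
move=> f0 cf; rewrite /kernel_exponent.
have n0 := Re_gt0_neq0 f0.
have n1 := Re_gt0_neq0 (Re_1D f0).
have n2 := Re_gt0_neq0 (Re_1B f0).
have p3 := Re_1B2 f0.
by ccnt; (exact: cf || exact: f0 || exact: n1 || exact: n2 || exact: p3).
Qed.

Lemma ccont_kernel_exponent' (T : topologicalType) (f : T -> R[i]) x : 0 < Re (f x) ->
  ccont f x -> ccont (fun y => kernel_exponent' (f y)) x.
Proof.
move=> f0 cf; rewrite /kernel_exponent'.
have n0 := Re_gt0_neq0 f0.
have n1 := Re_gt0_neq0 (Re_1D f0).
have n2 := Re_gt0_neq0 (Re_1B f0).
have n3 := Re_gt0_neq0 (Re_1B2 f0).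
by ccnt; (exact: cf || exact: f0 || exact: n0 || exact: n1 || exact: n2 || exact: n3).
Qed.

Lemma tanh_halfE (x y : R) : 0 < x ->
  (1 + - cexp (- (x +i* y))) * (1 + cexp (- (x +i* y)))^-1 =
  (sinh x / (cosh x + cos y)) +i* (sin y / (cosh x + cos y)).
Proof.
move=> x0.
have D0 : cosh x + cos y != 0.
  have := cosh_ge2 (ltW x0); have := cos_geN1 y => ? ?.
  have : 0 < x ^+ 2 by rewrite exprn_gt0.
  by move=> ?; rewrite gt_eqF//; lra.
have n1 := sqr_neq0 (Re_gt0_neq0 (@Re_1D (x +i* y) x0)).
have cs := cos2Dsin2 y.
have e0 := expR_gt0 (- x).
have ex : expR x = (expR (- x))^-1 by rewrite expRN invrK.
have E1 : complex.Re (cexp (- (x +i* y))) = expR (- x) * cos y.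
  by rewrite Re_cexp /= cosN.
have E2 : complex.Im (cexp (- (x +i* y))) = - (expR (- x) * sin y).
  by rewrite Im_cexp /= sinN mulrN.
move: (cexp _) E1 E2 n1 => w E1 E2.
move: D0; rewrite /cosh /sinh ex Re_add Im_add E1 E2 /= add0r.
set q := expR (- x) in e0 E1 E2 *; set c := cos y in cs E1 *; set s := sin y in cs E2 * => D0 n1.
have qq : q ^+ 2 * (c ^+ 2 + s ^+ 2) = q ^+ 2 by rewrite cs mulr1.
have N : (1 + q * c) ^+ 2 + (- (q * s)) ^+ 2 = 1 + 2 * q * c + q ^+ 2.
  by rewrite -[in RHS]qq; ring.
rewrite N in n1.
have D1 : (q^-1 + q) / 2 + c = (1 + 2 * q * c + q ^+ 2) / (2 * q).
  by field; rewrite gt_eqF.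
apply: eq_complexP.
  rewrite Re_mul Re_inv Im_inv !(Re_add, Re_opp, Im_add, Im_opp) E1 E2 /= add0r N D1.
  transitivity ((1 - q ^+ 2 * (c ^+ 2 + s ^+ 2)) / (1 + 2 * q * c + q ^+ 2)).
    by field.
  by rewrite qq; field; rewrite n1 gt_eqF.
rewrite Im_mul Re_inv Im_inv !(Re_add, Re_opp, Im_add, Im_opp) E1 E2 /= add0r N D1.
by field; rewrite n1 gt_eqF.
Qed.

(** The translation by i pi exchanges tanh (z/2) and coth (z/2). *)
Lemma coth_halfE (x y : R) : 0 < x ->
  (1 + cexp (- (x +i* y))) * (1 + - cexp (- (x +i* y)))^-1 =
  (sinh x / (cosh x - cos y)) +i* (- (sin y / (cosh x - cos y))).
Proof.
move=> x0; have := @tanh_halfE x (y + pi) x0.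
rewrite cosDpi sinDpi.
have -> : cexp (- (x +i* (y + pi))) = - cexp (- (x +i* y)).
  apply: eq_complexP; rewrite ?Re_opp ?Im_opp ?Re_cexp ?Im_cexp /= !(sinN, cosN) ?sinDpi ?cosDpi; ring.
by rewrite opprK mulNr.
Qed.

(** The key identity is |1 - exp(- 2 z)|^2 = 4 exp(- 2 x) (sinh(x)^2 + sin(y)^2); its factor 4 exp(-
    2 x) cancels the terms - z and ln 2 of the exponent. *)
Lemma Re_kernel_exponent (x y : R) : 0 < x ->
  Re (kernel_exponent (x +i* y)) =
  nu / 2 * ln ((x ^+ 2 + y ^+ 2) / (sinh x ^+ 2 + sin y ^+ 2)) -
  k * (A * ((x * sinh x - y * sin y) / (cosh x + cos y)) +
       B * ((x * sinh x + y * sin y) / (cosh x - cos y)) + 2 * u * y).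
Proof.
move=> x0; rewrite /kernel_exponent tanh_halfE// coth_halfE//.
have n1 : 0 < x ^+ 2 + y ^+ 2 by rewrite ltr_pwDl ?exprn_gt0 ?sqr_ge0.
have s0 : 0 < sinh x by exact: lt_le_trans (sinh_ge (ltW x0)).
have n2 : 0 < sinh x ^+ 2 + sin y ^+ 2 by rewrite ltr_pwDl ?exprn_gt0 ?sqr_ge0.
have e0 := expR_gt0 (- x).
have E1 : Re (cexp (- ((x +i* y) + (x +i* y)))) = expR (- x) ^+ 2 * cos (2 * y).
  by rewrite Re_cexp /= cosN opprD expRD expr2; congr (_ * cos _); ring.
have E2 : Im (cexp (- ((x +i* y) + (x +i* y)))) = - (expR (- x) ^+ 2 * sin (2 * y)).
  by rewrite Im_cexp /= sinN opprD expRD expr2 -mulrN; congr (_ * - sin _); ring.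
move: (cexp _) E1 E2 => w E1 E2.
rewrite !(Re_mul, Re_add, Re_opp, Im_mul, Im_add, Im_opp) /= !(Re_add, Re_opp, Im_add, Im_opp) E1 E2 /= .
have -> : (1 - expR (- x) ^+ 2 * cos (2 * y)) ^+ 2 +
  (0 - - (expR (- x) ^+ 2 * sin (2 * y))) ^+ 2 =
  4 * expR (- x) ^+ 2 * (sinh x ^+ 2 + sin y ^+ 2).
  rewrite sin_double cos_double /sinh.
  have -> : expR x = (expR (- x))^-1 by rewrite expRN invrK.
  have cs := cos2Dsin2 y.
  set q := expR (- x) in e0 *; set c := cos y in cs *; set s := sin y in cs *.
  have ss : s ^+ 2 * (c ^+ 2 + s ^+ 2) = s ^+ 2 by rewrite cs mulr1.
  transitivity ((1 - q ^+ 2) ^+ 2 + 4 * q ^+ 2 * (s ^+ 2 + q ^+ 2 * (s ^+ 2 * (c ^+ 2 + s ^+ 2) - s ^+ 2))).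
    by ring.
  by rewrite ss; field; rewrite gt_eqF.
rewrite lnM ?posrE ?mulr_gt0 ?exprn_gt0 ?expR_gt0//.
rewrite lnM ?posrE ?mulr_gt0 ?exprn_gt0 ?expR_gt0//.
rewrite lnXn ?expR_gt0// expRK.
rewrite ln_div ?posrE//.
have -> : ln 4 = 2 * ln 2 :> R.
  by rewrite (_ : 4 = 2 ^+ 2) ?lnXn//; [rewrite mulr_natl|ring].
move: (atan (y / x) - y - _ + 0) => at_.
have [? ?] : cosh x + cos y != 0 /\ cosh x - cos y != 0.
  have := cosh_ge2 (ltW x0); have := cos_geN1 y; have := cos_le1 y => ? ? ?.
  have : 0 < x ^+ 2 by rewrite exprn_gt0.
  by move=> ?; rewrite !gt_eqF//; lra.
by rewrite mul0r -(mulr_natr (- x)); field; apply/andP.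
Qed.

End kernel_exponent.

(** * Homotopy from the real half-line to the slanted contour *)

Section contour.
Local Open Scope classical_set_scope.
Local Open Scope complex_scope.
Context {R : realType}.
Variables (nu k A B u : R) (th thd : R -> R).
Hypothesis dth : forall l : R, 0 < l -> is_derive l 1 th (thd l).
Hypothesis cthd : forall l : R, 0 < l -> {for l, continuous thd}.
Local Notation Re := (@complex.Re R).
Local Notation Im := (@complex.Im R).
Local Notation Psi := (kernel_exponent nu k A B u).
Local Notation Psi' := (kernel_exponent' nu k A B u).

Let mu := @lebesgue_measure R.

(** From the half-line at s = 0 to the contour of interest at s = 1. Only the imaginary part moves,
    so cutting l at both ends produces vertical segments. *)
Definition contour (s l : R) : R[i] := l +i* (s * th l).

(* The [dl] and [ds] components of [Re (exp (Psi z) dz)] at [z = contour s l]. *)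
Definition contour_integrand (s l : R) : R :=
  Re (cexp (Psi (contour s l)) * (1 +i* (s * thd l))).

Definition contour_flux (s l : R) : R :=
  Re (cexp (Psi (contour s l)) * (0 +i* th l)).

(** The common value of the s-derivative of [contour_integrand] and the l-derivative of
    [contour_flux]. That they agree is the closedness of exp(Psi z) dz, that is, Cauchy's
    theorem. *)
Let E (s l : R) : R :=
  Re (cexp (Psi (contour s l)) * Psi' (contour s l) * (0 +i* th l) * (1 +i* (s * thd l)) +
      cexp (Psi (contour s l)) * (0 +i* thd l)).

Let cth l : 0 < l -> {for l, continuous th}.
Proof.
by move=> l0; apply: differentiable_continuous; apply/derivable1_diffP; case: (dth l0).
Qed.

Lemma cderiv_contour_l s l : 0 < l -> cderiv (contour s) l (1 +i* (s * thd l)).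
Proof.
move=> l0; split; rewrite /contour /=; first exact: drv_id.
notypeclasses refine (is_derive_eq _ _).
  exact: (drvM (drv_cst l s) (dth l0)).
by rewrite mulr0 addr0.
Qed.

Lemma cderiv_contour_s s l : cderiv (contour ^~ l) s (0 +i* th l).
Proof.
split; rewrite /contour /=; first exact: drv_cst.
notypeclasses refine (is_derive_eq _ _).
  exact: (drvM (drv_id s) (drv_cst s (th l))).
by rewrite mulr0 add0r mulr1.
Qed.

Lemma ccont_contour s l : 0 < l -> ccont (fun p : R * R => contour p.1 p.2) (s, l).
Proof.
move=> l0; split; rewrite /prop_for /continuous_at /contour /=; first exact: cvg_snd.
apply: cvgM; first exact: cvg_fst.
have c2 : {for (s, l), continuous (fun p : R * R => p.2)} by exact: cvg_snd.
exact: (continuous_comp c2 (cth l0)).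
Qed.

Let dP (s l : R) : 0 < l -> is_derive s 1 (contour_integrand ^~ l) (E s l).
Proof.
move=> l0; rewrite /contour_integrand.
have c1 : cderiv (fun s => 1 +i* (s * thd l)) s (0 +i* thd l).
  split => /=; first exact: drv_cst.
  notypeclasses refine (is_derive_eq _ _); first exact: (drvM (drv_id s) (drv_cst s (thd l))).
  by rewrite mulr0 add0r mulr1.
have [H _] := cderivM (cderiv_cexp (@cderiv_kernel_exponent R nu k A B u (contour^~ l) s _ l0 (cderiv_contour_s s l))) c1.
notypeclasses refine (is_derive_eq H _).
by congr (complex.Re _); ring.
Qed.

Let dW (s l : R) : 0 < l -> is_derive l 1 (contour_flux s) (E s l).
Proof.
move=> l0; rewrite /contour_flux.
have c1 : cderiv (fun l => 0 +i* th l) l (0 +i* thd l).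
  by split => /=; [exact: drv_cst|exact: dth].
have [H _] := cderivM (cderiv_cexp (@cderiv_kernel_exponent R nu k A B u (contour s) l _ l0 (cderiv_contour_l s l0))) c1.
notypeclasses refine (is_derive_eq H _).
by congr (complex.Re _); ring.
Qed.

Let cE (s l : R) : 0 < l -> {for (s, l), continuous (fun p : R * R => E p.1 p.2)}.
Proof.
move=> l0; rewrite /E.
have cc := ccont_contour s l0.
have l0' : 0 < Re (contour (s, l).1 (s, l).2) by [].
have c2 : {for (s, l), continuous (fun p : R * R => p.2)} by exact: cvg_snd.
have c1 : {for (s, l), continuous (fun p : R * R => p.1)} by exact: cvg_fst.
have t2 : {for (s, l), continuous (fun p : R * R => th p.2)} by exact: (continuous_comp c2 (cth l0)).
have t3 : {for (s, l), continuous (fun p : R * R => thd p.2)} by exact: (continuous_comp c2 (cthd l0)).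
suff [] : ccont (fun p : R * R =>
   cexp (Psi (contour p.1 p.2)) * Psi' (contour p.1 p.2) * (0 +i* th p.2) * (1 +i* (p.1 * thd p.2)) +
      cexp (Psi (contour p.1 p.2)) * (0 +i* thd p.2)) (s, l) by [].
have cF : ccont (fun p : R * R => cexp (Psi (contour p.1 p.2))) (s, l).
  apply: ccont_cexp.
  exact: (@ccont_kernel_exponent _ nu k A B u _ (fun p : R * R => contour p.1 p.2) (s, l)).
apply: ccontD; last by apply: (ccontM cF); split => //; exact: cvg_cst.
apply: ccontM; last by split => /=; [exact: cvg_cst|exact: cvgM].
apply: ccontM; last by split => //; exact: cvg_cst.
apply: ccontM; first exact: cF.
exact: (@ccont_kernel_exponent' _ nu k A B u _ (fun p : R * R => contour p.1 p.2) (s, l)).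
Qed.

Lemma continuous_contour_integrand (s l : R) : 0 < l -> {for l, continuous (contour_integrand s)}.
Proof.
move=> l0; rewrite /contour_integrand.
suff [] : ccont (fun l => cexp (Psi (contour s l)) * (1 +i* (s * thd l))) l by [].
have c1 : ccont (contour s) l.
  split => /=; first exact: cvg_id.
  by apply: cvgM; [exact: cvg_cst|exact: cth].
apply: ccontM; last by split => /=; [exact: cvg_cst|apply: cvgM; [exact: cvg_cst|exact: cthd]].
apply: ccont_cexp; exact: (@ccont_kernel_exponent _ nu k A B u _ (contour s) l).
Qed.

Lemma continuous_contour_flux (s l : R) : 0 < l -> {for s, continuous (contour_flux ^~ l)}.
Proof.
move=> l0; rewrite /contour_flux.
suff [] : ccont (fun s => cexp (Psi (contour s l)) * (0 +i* th l)) s by [].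
have c1 : ccont (contour^~ l) s.
  split => /=; first exact: cvg_cst.
  by apply: cvgM; [exact: cvg_id|exact: cvg_cst].
apply: ccontM; last by split => /=; exact: cvg_cst.
apply: ccont_cexp; exact: (@ccont_kernel_exponent _ nu k A B u _ (contour^~ l) s).
Qed.

Lemma contour_rectangle (d m : R) : 0 < d -> d < m ->
  \int[mu]_(l in `[d, m]) contour_integrand 1 l - \int[mu]_(l in `[d, m]) contour_integrand 0 l =
  \int[mu]_(s in `[0%R, 1%R]) (contour_flux s m - contour_flux s d).
Proof.
exact: (homotopy_invariance dP dW cE continuous_contour_integrand continuous_contour_flux).
Qed.

End contour.

(** * Limits of integrals over the half-line *)

Section integration_facts.
Local Open Scope classical_set_scope.
Context {R : realType}.
Let mu := @lebesgue_measure R.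

Lemma Rdominated_cvg d (T : measurableType d) (nu : {measure set T -> \bar R}) (D : set T)
    (f_ : nat -> T -> R) (f g : T -> R) : measurable D ->
  (forall n, measurable_fun D (f_ n)) ->
  (forall x, D x -> f_ n x @[n --> \oo] --> f x) ->
  nu.-integrable D (EFin \o g) ->
  (forall n x, D x -> `|f_ n x| <= g x) ->
  \int[nu]_(x in D) f_ n x @[n --> \oo] --> \int[nu]_(x in D) f x.
Proof.
move=> mD mf ff ig fg.
have mf' n : measurable_fun D (EFin \o f_ n) by exact/measurable_EFinP.
have ff' x : D x -> (EFin \o f_ n) x @[n --> \oo] --> (EFin \o f) x.
  by move=> Dx; apply: cvg_EFin; [exact: nearW|exact: ff].
have fg' n x : D x -> (`|(EFin \o f_ n) x| <= (EFin \o g) x)%E.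
  by move=> Dx; rewrite /= lee_fin; exact: fg.
have fing x : D x -> (EFin \o g) x \is a fin_num by [].
have H := dominated_cvg mD mf' ff' fing ig fg'.
have fi : nu.-integrable D (EFin \o f).
  apply: (le_integrable mD _ _ ig).
    exact: (emeasurable_fun_cvg _ _ mf' ff').
  move=> x Dx /=; rewrite lee_fin [leRHS]ger0_norm; last by rewrite (le_trans _ (fg 0 x Dx)).
  apply: (ler_cvg_to (cvg_norm (ff x Dx)) (cvg_cst (g x))).
  by apply: nearW => n; exact: fg.
by apply: fine_cvg; rewrite fineK//; exact: integrable_fin_num.
Qed.

Lemma integral_expN (c : R) : 0 < c ->
  (\int[mu]_(x in `]0%R, +oo[) (expR (- (c * x)))%:E)%E = (c^-1)%:E.
Proof.
move=> c0.
have df (x : R) : is_derive x 1 (fun y => - expR (- (c * y)) / c) (expR (- (c * x))).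
  by drv_eq; field; rewrite gt_eqF.
have cf : continuous (fun x => expR (- (c * x))).
  move=> x; apply: differentiable_continuous; apply/derivable1_diffP.
  have : is_derive x 1 (fun x => expR (- (c * x))) (expR (- (c * x)) * - c) by drv_eq; ring.
  by case.
rewrite integral_itv_obnd_cbnd; last first.
  apply/measurable_EFinP; apply: measurable_funTS; exact: continuous_measurable_fun.
rewrite (@ge0_continuous_FTC2y _ _ (fun y => - expR (- (c * y)) / c) 0 0).
- by rewrite mulr0 oppr0 expR0 sub0e -EFinN; congr EFin; field; rewrite gt_eqF.
- by move=> x _; exact: expR_ge0.
- by apply: continuous_subspaceT.
- have -> : 0 = - 0 / c :> R by rewrite oppr0 mul0r.
  apply: cvgM; last exact: cvg_cst.
  apply: cvgN.
  apply: (@cvg_comp _ _ _ (fun x => c * x) (fun y => expR (- y)) _ _ _ _ (@cvgr_expR R)).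
  by apply: gt0_cvgMry => //; exact: cvg_id.
- by move=> x _; case: (df x).
- apply: cvg_at_right_filter.
  have cF : {for 0, continuous (fun y => - expR (- (c * y)) / c)}.
    by apply: differentiable_continuous; apply/derivable1_diffP; case: (df 0).
  exact: cF.
- by move=> x _; rewrite derive1E; case: (df x).
Qed.

Lemma integrable_expN (c : R) : 0 < c ->
  mu.-integrable `]0%R, +oo[ (EFin \o (fun x => expR (- (c * x)))).
Proof.
move=> c0; apply/integrableP; split.
  apply/measurable_EFinP; apply: measurable_funTS; apply: continuous_measurable_fun => x.
  apply: differentiable_continuous; apply/derivable1_diffP.
  have : is_derive x 1 (fun x => expR (- (c * x))) (expR (- (c * x)) * - c) by drv_eq; ring.
  by case.
under eq_integral do rewrite /= ger0_norm ?expR_ge0//.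
by rewrite integral_expN// ltry.
Qed.

(** The right end is n + 2 so that the segment is nondegenerate already at n = 0, as the rectangle
    formula requires. *)
Lemma cvg_Rintegral_exhaustion (f : R -> R) : mu.-integrable `]0%R, +oo[ (EFin \o f) ->
  \int[mu]_(x in `[n.+1%:R^-1, n.+2%:R]) f x @[n --> \oo] --> \int[mu]_(x in `]0%R, +oo[) f x.
Proof.
move=> fi.
have sub n : (`[n.+1%:R^-1, n.+2%:R] : set R) `<=` `]0%R, +oo[.
  by move=> x /=; rewrite !in_itv/= andbT => /andP[+ _]; apply: lt_le_trans; rewrite invr_gt0 ltr0n.
have E n : \int[mu]_(x in `[n.+1%:R^-1, n.+2%:R]) f x =
   \int[mu]_(x in `]0%R, +oo[) (f \_ `[n.+1%:R^-1, n.+2%:R]) x.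
  by rewrite -Rintegral_mkcondr; congr Rintegral; apply/esym/setIidPr; exact: sub.
under eq_fun do rewrite E.
have mf : measurable_fun (`]0%R, +oo[ : set R) f.
  by apply/measurable_EFinP; case/integrableP: fi.
apply: (@Rdominated_cvg _ _ mu _ _ f (fun x => `|f x|)) => //.
- move=> n; apply/measurable_restrict => //; apply: measurable_funS mf => //.
- move=> x /=; rewrite in_itv/= andbT => x0.
  apply: cvg_near_cst; near=> n; rewrite patchE mem_set//= in_itv/=.
  apply/andP; split.
    rewrite -[leRHS]invrK lef_pV2 ?posrE ?invr_gt0 ?ltr0n//.
    rewrite (le_trans _ (_ : n%:R <= _))// ?ler_nat//; near: n; exact: nbhs_infty_ger.
  rewrite (le_trans _ (_ : n%:R <= _))// ?ler_nat//; last by rewrite ltnW.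
  near: n; exact: nbhs_infty_ger.
- exact: integrable_norm.
- by move=> n x _ /=; rewrite patchE; case: ifP => // _; rewrite normr0.
Unshelve. all: by end_near. Qed.

End integration_facts.

(** * The slant of the contour *)

Section ramp.
Local Open Scope classical_set_scope.
Context {R : realType}.
Implicit Types l : R.

(** Comparable to l on (0, 1], with ratio between 1/32 and 1/16, and bounded by 1/16 everywhere. A
    truncated line would do for the estimates, but the rectangle formula uses a continuous
    derivative. *)
Definition ramp l : R := l / (16 * (1 + l)).
Definition ramp' l : R := (16 * (1 + l) ^+ 2)^-1.

Lemma ramp_ge0 l : 0 < l -> 0 <= ramp l.
Proof. by move=> l0; rewrite /ramp divr_ge0 ?mulr_ge0//; lra. Qed.

Lemma ramp_le l : 0 < l -> ramp l <= l / 16.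
Proof. by move=> l0; rewrite /ramp ler_pdivrMr; nra. Qed.

Lemma ramp_le1 l : 0 < l -> ramp l <= 1 / 16.
Proof. by move=> l0; rewrite /ramp ler_pdivrMr; lra. Qed.

Lemma ramp_ge l : 0 < l <= 1 -> l / 32 <= ramp l.
Proof. by move=> /andP[l0 l1]; rewrite /ramp ler_pdivlMr; nra. Qed.

Lemma ramp'_ge0 l : 0 <= ramp' l.
Proof. by rewrite /ramp' invr_ge0 mulr_ge0// sqr_ge0. Qed.

Lemma ramp'_le1 l : 0 < l -> ramp' l <= 1.
Proof. by move=> l0; rewrite /ramp' invf_le1; nra. Qed.

Lemma is_derive_ramp l : 0 < l -> is_derive l 1 ramp (ramp' l).
Proof.
move=> l0; rewrite /ramp /ramp'.
have ? : 16 * (1 + l) != 0 by rewrite gt_eqF//; lra.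
by drv_eq => //; field; rewrite gt_eqF//; lra.
Qed.

Lemma continuous_ramp' l : 0 < l -> {for l, continuous ramp'}.
Proof.
move=> l0; rewrite /ramp'; apply: cvgV; first by rewrite gt_eqF//; nra.
apply: cvgM; first exact: cvg_cst.
by apply: cvgM; apply: cvgD; (exact: cvg_cst || exact: cvg_id).
Qed.

End ramp.

(** * Decay of the integrand, uniform over the homotopy *)

Section contour_shift.
Local Open Scope classical_set_scope.
Local Open Scope complex_scope.
Context {R : realType}.
Variables (nu k A B u r : R).
Hypotheses (nu_ge : 1 / 2 <= nu) (k0 : 0 <= k) (A0 : 0 <= A) (B0 : 0 <= B) (u0 : 0 <= u).
Hypothesis r_itv : 0 < r < pi / 2.
Local Notation Re := (@complex.Re R).
Local Notation Im := (@complex.Im R).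
Local Notation Psi := (kernel_exponent nu k A B u).

Let th l := 2 * r + ramp l.
Local Notation z := (contour th).
Local Notation P := (contour_integrand nu k A B u th ramp').
Local Notation W := (contour_flux nu k A B u th).

Let r2 : r < 2. Proof. by have := @pihalf_lt2 R; case/andP: r_itv; lra. Qed.

Let rpi (s : R) : 0 <= s <= 1 -> 0 <= s * r < pi / 2.
Proof.
case/andP: r_itv => a1 a2 /andP[s0 s1]; rewrite mulr_ge0//=; last by lra.
nra.
Qed.

Let cr : 0 < cos r.
Proof. exact: cos_gt0_acute. Qed.

Let cos_sr (s : R) : 0 <= s <= 1 -> cos r <= cos (s * r).
Proof.
move=> s01; case/andP: (s01) => s0 s1; case/andP: r_itv => ? ?.
rewrite {1}(_ : r = s * r + (1 - s) * r); last by ring.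
have r2' := r2; have sr : s * r <= r by rewrite ler_piMl// ltW.
apply: cosD_le.
- by case/andP: (rpi s01) => -> _ /=; lra.
- rewrite mulrBl mul1r; case/andP: (rpi s01) => ? ?.
  by apply/andP; split; lra.
- case/andP: (rpi s01) => ? ?.
  by rewrite ltW// cos_gt0_pihalf//; apply/andP; split; lra.
Qed.

Let quotient (s l : R) : 0 <= s <= 1 -> 0 < l ->
  (l ^+ 2 + (s * th l) ^+ 2) / (sinh l ^+ 2 + sin (s * th l) ^+ 2) <= 64 / cos r ^+ 2 /\
  (1 <= l -> (l ^+ 2 + (s * th l) ^+ 2) / (sinh l ^+ 2 + sin (s * th l) ^+ 2) <= 104 * expR (- l)).
Proof.
move=> s01 l0; case/andP: (s01) => s0 s1; case/andP: r_itv => ? ?.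
have sp : 0 < sinh l by exact: lt_le_trans (sinh_ge (ltW l0)).
have D0 : 0 < sinh l ^+ 2 + sin (s * th l) ^+ 2 by rewrite ltr_pwDl ?exprn_gt0 ?sqr_ge0.
have b0 := ramp_ge0 l0; have b1 := ramp_le l0; have b2 := ramp_le1 l0.
have h0 : 0 <= s * ramp l by rewrite mulr_ge0.
have h1 : s * ramp l <= ramp l by nra.
have r2' := r2.
split; last first.
  move=> l1; rewrite ler_pdivrMr//; apply: quotient_sinh_le_exp => //.
  rewrite /th; apply/andP; split; first by rewrite mulr_ge0//; lra.
  nra.
have E : s * th l = 2 * (s * r) + s * ramp l by rewrite /th; ring.
rewrite ler_pdivrMr// E.
have := @quotient_sinh_le R (s * r) l (s * ramp l) (rpi s01) l0 h0 ltac:(lra) ltac:(lra).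
move/le_trans; apply; rewrite ler_wpM2r ?addr_ge0 ?sqr_ge0//.
rewrite ler_wpM2l// lef_pV2 ?posrE ?exprn_gt0//; last exact: lt_le_trans (cos_sr s01).
by rewrite lerXn2r ?nnegrE ?cos_sr// ltW//; exact: lt_le_trans (cos_sr s01).
Qed.

Let phase (s l : R) : 0 <= s <= 1 -> 0 < l ->
  - (A * (4 / cos r + saddleT r) + B * saddleS r) <=
  A * ((l * sinh l - s * th l * sin (s * th l)) / (cosh l + cos (s * th l))) +
       B * ((l * sinh l + s * th l * sin (s * th l)) / (cosh l - cos (s * th l))) + 2 * u * (s * th l).
Proof.
move=> s01 l0; case/andP: (s01) => s0 s1; case/andP: r_itv => r0 rp.
have b0 := ramp_ge0 l0; have b1 := ramp_le l0; have b2 := ramp_le1 l0.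
have h0 : 0 <= s * ramp l by rewrite mulr_ge0.
have h1 : s * ramp l <= ramp l by nra.
have E : s * th l = 2 * (s * r) + s * ramp l by rewrite /th; ring.
have S0 := saddleS_ge0 (ltW r0); have r2' := r2; have c0 := cr.
have U0 : 0 <= 2 * u * (s * th l).
  by rewrite !mulr_ge0// /th; lra.
have [Tr0 _] := andP (@saddleT_le R (s * r) (rpi s01)).
have sr : s * r <= r by nra.
have Tr1 : saddleT (s * r) <= saddleT r.
  by apply: saddleT_nondecr => //; rewrite mulr_ge0// ltW.
have cs := cos_sr s01.
have HA : - (4 / cos r + saddleT r) <=
  (l * sinh l - s * th l * sin (s * th l)) / (cosh l + cos (s * th l)).
  rewrite E; apply: le_trans (@Re_tanh_shift R (s * r) l (s * ramp l) (rpi s01) l0 h0 ltac:(lra) ltac:(lra)).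
  rewrite opprD lerD// lerN2; last by nra.
  apply: ler_pM.
  - rewrite !mulr_ge0//; first exact: ltW.
    by have := @sin_ge_third R (s * r); case/andP: (rpi s01) => ? ?; lra.
  - by rewrite invr_ge0; lra.
  - have := sin_le1 (s * r); have := @sin_ge_third R (s * r); case/andP: (rpi s01) => ? ? g1 g2.
    have : 0 <= sin (s * r) by lra.
    nra.
  - by rewrite lef_pV2 ?posrE//; lra.
have HB : - saddleS r <=
  (l * sinh l + s * th l * sin (s * th l)) / (cosh l - cos (s * th l)).
  (* [Re_coth_shift] requires a positive angle, so the real axis is treated by itself. *)
  have [/eqP ->|sn0] := boolP (s == 0).
    rewrite mul0r mul0r addr0 cos0.
    apply: (@le_trans _ _ 0); first by rewrite oppr_le0.
    apply: divr_ge0; last by rewrite subr_ge0 cosh_ge1.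
    exact: mulr_ge0 (ltW l0) (le_trans (ltW l0) (sinh_ge (ltW l0))).
  have sp : 0 < s by rewrite lt_neqAle eq_sym sn0.
  have srp : 0 < s * r < pi / 2.
    by case/andP: (rpi s01) => _ ->; rewrite mulr_gt0.
  rewrite E; apply: le_trans (@Re_coth_shift R (s * r) l (s * ramp l) srp l0 h0 ltac:(lra) ltac:(lra)).
  have S1 : saddleS (s * r) <= saddleS r.
    by apply: saddleS_nondecr => //; [rewrite mulr_gt0|exact: ltW].
  have S2 : 0 <= saddleS (s * r) by apply: saddleS_ge0; rewrite mulr_ge0// ltW.
  have : 0 <= 2 * (s * r) * cos (s * r) / sin (s * r).
    apply: divr_ge0.
      rewrite !mulr_ge0//; first exact: ltW.
      by lra.
    by have := @sin_ge_third R (s * r); case/andP: (rpi s01) => ? ?; lra.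
  nra.
have := ler_wpM2l A0 HA; have := ler_wpM2l B0 HB; lra.
Qed.

(** [K] may depend on all parameters: what counts is a decay independent of s, which makes the
    integrals converge and the far end of the rectangle negligible. The rate 1/4 comes from |z /
    sinh z|^nu with nu / 2 >= 1/4. *)
Lemma contour_envelope : exists2 K, 0 <= K & forall s l, 0 <= s <= 1 -> 0 < l ->
  expR (Re (Psi (z s l))) <= K * expR (- (4^-1 * l)).
Proof.
set c := k * (A * (4 / cos r + saddleT r) + B * saddleS r).
set q := ln (64 / cos r ^+ 2).
have c1 := cos_le1 r; have c0 := cr.
have q0 : 0 <= q.
  apply: ln_ge0; rewrite ler_pdivlMr ?exprn_gt0//.
  by nra.
have l104 : 0 <= ln (104 : R) by apply: ln_ge0; lra.
exists (expR (nu / 2 * (ln 104 + q) + c + 1 / 4)); first exact: expR_ge0.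
move=> s l s01 l0.
have [Q1 Q2] := quotient s01 l0.
rewrite -expRD ler_expR Re_kernel_exponent//.
have ph := ler_wpM2l k0 (phase s01 l0); rewrite mulrN -/c in ph.
move: ph; set X := (X in k * X) => ph.
have sp : 0 < sinh l by exact: lt_le_trans (sinh_ge (ltW l0)).
set Q := (_ + _) / (_ + _) in Q1 Q2 *.
have D0 : 0 < Q by rewrite divr_gt0// ltr_pwDl ?exprn_gt0 ?sqr_ge0.
have [l1|l1] := leP 1 l.
  have : ln Q <= ln 104 - l.
    rewrite (_ : ln 104 - l = ln (104 * expR (- l))).
      by rewrite ler_ln ?posrE// ?Q2// mulr_gt0// expR_gt0.
    by rewrite lnM ?posrE ?expR_gt0// expRK.
  have nu1 := nu_ge; have nu0 : 0 <= nu / 2 by lra.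
  move=> /(ler_wpM2l nu0).
  have := mulr_ge0 nu0 q0.
  have : 1 / 4 * l <= nu / 2 * l by rewrite ler_wpM2r ?(ltW l0)//; lra.
  by lra.
have : ln Q <= q.
  by rewrite ler_ln ?posrE// divr_gt0// exprn_gt0.
have nu1 := nu_ge; have nu0 : 0 <= nu / 2 by lra.
move=> /(ler_wpM2l nu0).
have := mulr_ge0 nu0 l104.
by lra.
Qed.

Lemma contour_integrand_le (s l : R) : 0 <= s <= 1 -> 0 < l ->
  `|P s l| <= 2 * expR (Re (Psi (z s l))).
Proof.
move=> s01 l0; rewrite /contour_integrand Re_mul Re_cexp Im_cexp [Re (_ +i* _)]/= [Im (_ +i* _)]/= mulr1.
case/andP: s01 => s0 s1.
have b0 := ramp'_ge0 l; have b1 := ramp'_le1 l0.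
have e0 := expR_ge0 (Re (Psi (z s l))).
have cm := cos_max (Im (Psi (z s l))).
have sm := sin_max (Im (Psi (z s l))).
have sn := normr_ge0 (sin (Im (Psi (z s l)))).
set e := expR _ in e0 *.
apply: (le_trans (ler_normB _ _)); rewrite (_ : 2 * e = e + e); last by ring.
rewrite !normrM !(ger0_norm e0) (ger0_norm s0) (ger0_norm b0).
apply: lerD; first by rewrite ler_piMr.
rewrite -mulrA ler_piMr//.
have : s * ramp' l <= 1 by nra.
have : 0 <= s * ramp' l by rewrite mulr_ge0.
nra.
Qed.

(** The sine is kept because it makes the flux vanish at the imaginary axis, where the exponential
    is not small; 5 bounds the height 2 r + 1/16 of the contour. *)
Lemma contour_flux_le (s l : R) : 0 < l ->
  `|W s l| <= 5 * expR (Re (Psi (z s l))) * `|sin (Im (Psi (z s l)))|.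
Proof.
move=> l0; rewrite /contour_flux Re_mul Re_cexp Im_cexp [Re (_ +i* _)]/= [Im (_ +i* _)]/= mulr0 sub0r normrN.
have b0 := ramp_ge0 l0; have b2 := ramp_le1 l0; case/andP: r_itv => ? ?.
have r2' := r2; have t0 : 0 <= th l by rewrite /th; lra.
have t5 : th l <= 5 by rewrite /th; lra.
rewrite !normrM !(ger0_norm (expR_ge0 _)) (ger0_norm t0) mulrC mulrA.
by rewrite ler_wpM2r// ler_wpM2r// expR_ge0.
Qed.

End contour_shift.

(** * Vanishing of the boundary fluxes and the shift of contour *)

Section contour_shift_limit.
Local Open Scope classical_set_scope.
Local Open Scope complex_scope.
Context {R : realType}.
Variables (nu k A B u r : R).
Hypotheses (nu_ge : 1 / 2 <= nu) (k0 : 0 <= k) (A0 : 0 <= A) (B0 : 0 <= B) (u0 : 0 <= u).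
Hypothesis r_itv : 0 < r < pi / 2.
Local Notation Re := (@complex.Re R).
Local Notation Im := (@complex.Im R).
Local Notation Psi := (kernel_exponent nu k A B u).
Let mu := @lebesgue_measure R.

Lemma Im_kernel_exponent (x y : R) : 0 < x ->
  Im (Psi (x +i* y)) =
  nu * (atan (y / x) - y - atan (expR (- (2 * x)) * sin (2 * y) / (1 - expR (- (2 * x)) * cos (2 * y)))) -
  k * (A * ((x * sin y + y * sinh x) / (cosh x + cos y)) +
       B * ((y * sinh x - x * sin y) / (cosh x - cos y)) - 2 * u * x).
Proof.
move=> x0; rewrite /kernel_exponent tanh_halfE// coth_halfE//.
have E1 : Re (cexp (- ((x +i* y) + (x +i* y)))) = expR (- (2 * x)) * cos (2 * y).
  by rewrite Re_cexp /= cosN; congr (expR _ * cos _); ring.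
have E2 : Im (cexp (- ((x +i* y) + (x +i* y)))) = - (expR (- (2 * x)) * sin (2 * y)).
  by rewrite Im_cexp /= sinN mulrN; congr (- (expR _ * sin _)); ring.
move: (cexp _) E1 E2 => w E1 E2.
rewrite !(Re_mul, Re_add, Re_opp, Im_mul, Im_add, Im_opp) /= !(Re_add, Re_opp, Im_add, Im_opp) E1 E2 /=.
rewrite sub0r opprK !mul0r !addr0.
have [? ?] : cosh x + cos y != 0 /\ cosh x - cos y != 0.
  have := cosh_ge2 (ltW x0); have := cos_geN1 y; have := cos_le1 y => ? ? ?.
  have : 0 < x ^+ 2 by rewrite exprn_gt0.
  by move=> ?; rewrite !gt_eqF//; lra.
by field; apply/andP.
Qed.

Let th (l : R) := 2 * r + ramp l.
Local Notation z := (contour th).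
Local Notation P := (contour_integrand nu k A B u th ramp').
Local Notation W := (contour_flux nu k A B u th).

(** z / sinh z is positive on the segment from 0 to i pi. In terms of arguments, with y0 = 2 s r:
    arg z tends to pi/2 and arg (1 - exp(- 2 z)) to pi/2 - y0, and the term - z of the exponent
    contributes the missing - y0. *)
Lemma Im_contour_cvg0 (s : R) : 0 < s <= 1 -> Im (Psi (z s l)) @[l --> 0^'+] --> 0.
Proof.
case/andP=> s0 s1; case/andP: r_itv => r0 rp.
have sr0 : 0 < s * r by rewrite mulr_gt0.
have srp : s * r < pi / 2 by rewrite (le_lt_trans _ rp)// ler_piMl// ltW.
set y0 := 2 * (s * r).
have sy0 : 0 < sin y0 by rewrite sin_gt0_pi// /y0; apply/andP; split; lra.
have cy1 := cos2Dsin2 y0.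
have sy2 : 0 < sin y0 ^+ 2 by rewrite exprn_gt0.
have cy0 : -1 < cos y0 < 1 by apply/andP; split; nra.
pose y l := s * (2 * r + ramp l).
(* Everything except nu arg z: these terms extend differentiably to l = 0, whereas y / l blows
   up. *)
pose G l := nu * (- y l - atan (expR (- (2 * l)) * sin (2 * y l) / (1 - expR (- (2 * l)) * cos (2 * y l)))) -
  k * (A * ((l * sin (y l) + y l * sinh l) / (cosh l + cos (y l))) +
       B * ((y l * sinh l - l * sin (y l)) / (cosh l - cos (y l))) - 2 * u * l).
have b0 : ramp (0 : R) = 0 by rewrite /ramp mul0r.
have yE : y 0 = y0 by rewrite /y b0 /y0; ring.
have cG : {for 0, continuous G}.
  apply: differentiable_continuous; apply/derivable1_diffP.
  suff [d [Gd _]] : exists d, is_derive (0 : R) 1 G d by exact: Gd.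
  have db : is_derive (0 : R) 1 ramp (ramp' 0).
    rewrite /ramp /ramp'; drv_eq; first by rewrite addr0 mulr1.
    by rewrite addr0 !mulr1; field.
  have dy := drvM (drv_cst 0 s) (drvD (drv_cst 0 (2 * r)) db).
  eexists; rewrite /G.
  drv; try exact: dy.
  - rewrite -/(y 0) yE mulr0 oppr0 expR0 mul1r cos_double.
    by rewrite opprB addrC subrK gt_eqF// mulr_gt0.
  - by rewrite -/(y 0) yE cosh0 gt_eqF//; case/andP: cy0; lra.
  - by rewrite -/(y 0) yE cosh0 gt_eqF//; case/andP: cy0; lra.
have G0 : G 0 = - (nu * (pi / 2)).
  rewrite /G yE mulr0 oppr0 expR0 !mul1r sinh0 !(mul0r, mulr0, addr0, subr0).
  have -> : sin (2 * y0) / (1 - cos (2 * y0)) = tan (pi / 2 - y0).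
    rewrite /tan sinB cosB sin_pihalf cos_pihalf sin_double cos_double.
    by field; rewrite gt_eqF//= ?mul0r ?add0r ?gt_eqF//; lra.
  rewrite tanK; last by rewrite in_itv/= /y0; apply/andP; split; lra.
  by ring.
have aT : atan (y l / l) @[l --> 0^'+] --> pi / 2.
  suff yl : (y l / l) @[l --> 0^'+] --> +oo by exact: (cvg_comp _ _ yl (@cvgy_atan R)).
  apply: (@ger_cvgy _ _ _ R (fun l => y0 * l^-1)).
    near=> l.
    have l0 : 0 < l by near: l; exact: nbhs_right_gt.
    rewrite ler_pM2r ?invr_gt0// /y0 /y mulrDr.
    have := mulr_ge0 (ltW s0) (ramp_ge0 l0); lra.
  apply: gt0_cvgMry; first by rewrite /y0 mulr_gt0.
  apply/gtr0_cvgV0.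
    by near=> l; rewrite invr_gt0; near: l; exact: nbhs_right_gt.
  rewrite (_ : unstable.inv_fun _ = id); last by apply/funext => l; rewrite /unstable.inv_fun invrK.
  by apply: cvg_at_right_filter; exact: cvg_id.
have : (nu * atan (y l / l) + G l) @[l --> 0^'+] --> nu * (pi / 2) + G 0.
  apply: cvgD; last exact: (cvg_at_right_filter cG).
  by apply: cvgM => //; exact: cvg_cst.
rewrite G0 subrr; apply: cvg_trans; apply: near_eq_cvg; near=> l.
have l0 : 0 < l by near: l; exact: nbhs_right_gt.
rewrite Im_kernel_exponent// /G -/(y l); ring.
Unshelve. all: by end_near. Qed.

Lemma Im_contour0_cvg0 : Im (Psi (z 0 l)) @[l --> 0^'+] --> 0.
Proof.
have : (k * (2 * u) * l) @[l --> 0^'+] --> k * (2 * u) * 0.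
  by apply: cvgM; [exact: cvg_cst|apply: cvg_at_right_filter; exact: cvg_id].
rewrite mulr0; apply: cvg_trans; apply: near_eq_cvg; near=> l.
have l0 : 0 < l by near: l; exact: nbhs_right_gt.
rewrite /contour Im_kernel_exponent// mul0r mulr0 sin0 !(mul0r, mulr0, atan0, addr0, subr0).
by ring.
Unshelve. all: by end_near. Qed.

Let dth (l : R) : 0 < l -> is_derive l 1 th (ramp' l).
Proof.
move=> l0; notypeclasses refine (is_derive_eq _ _).
  exact: (drvD (drv_cst l (2 * r)) (is_derive_ramp l0)).
by rewrite add0r.
Qed.

(* [Psi] is real on the imaginary axis, so the real part of [exp Psi * i th] tends
   to 0 there. *)
Lemma contour_flux_cvg0 (s : R) : 0 <= s <= 1 -> W s l @[l --> 0^'+] --> 0.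
Proof.
move=> s01.
have [K K0 HK] := contour_envelope nu_ge k0 A0 B0 u0 r_itv.
have Im0 : Im (Psi (z s l)) @[l --> 0^'+] --> 0.
  have [->|sn0] := eqVneq s 0; first exact: Im_contour0_cvg0.
  by apply: Im_contour_cvg0; case/andP: s01 => s0 ->; rewrite lt_neqAle eq_sym sn0 s0.
have S0 : `|sin (Im (Psi (z s l)))| @[l --> 0^'+] --> 0.
  have : `|sin (Im (Psi (z s l)))| @[l --> 0^'+] --> `|sin (0 : R)|.
    apply: cvg_norm; exact: (cvg_comp _ _ Im0 (@continuous_sin R 0)).
  by rewrite sin0 normr0.
apply/cvgr0Pnorm_le => e e0.
have near_sin : \forall l \near 0^'+, `| `|sin (Im (Psi (z s l)))| | <= e / (5 * K + 1).
  by move/cvgr0Pnorm_le : S0; apply; rewrite divr_gt0//; lra.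
near=> l.
have l0 : 0 < l by near: l; exact: nbhs_right_gt.
apply: (le_trans (contour_flux_le nu k A B u r_itv s l0)).
have : `| `|sin (Im (Psi (z s l)))| | <= e / (5 * K + 1) by near: l.
rewrite normr_id ler_pdivlMr; last by lra.
have := HK s l s01 l0; rewrite -/(z s l).
have : expR (- (4^-1 * l)) <= 1 by rewrite -expR0 ler_expR oppr_le0 mulr_ge0// ltW.
have := expR_ge0 (- (4^-1 * l)); have := expR_ge0 (Re (Psi (z s l))).
have := normr_ge0 (sin (Im (Psi (z s l)))).
set q := `|_|; set m := expR _; set w := expR _ => q0 m0 w0 w1 mk qe.
have : m <= K by apply: (le_trans mk); rewrite ler_piMr.
have := e0; nra.
Unshelve. all: by end_near. Qed.

Lemma contour_flux_bound : exists2 K, 0 <= K & forall s l, 0 <= s <= 1 -> 0 < l ->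
  `|W s l| <= K * expR (- (4^-1 * l)).
Proof.
have [K K0 HK] := contour_envelope nu_ge k0 A0 B0 u0 r_itv.
exists (5 * K); first by rewrite mulr_ge0.
move=> s l s01 l0; apply: (le_trans (contour_flux_le nu k A B u r_itv s l0)).
have := HK s l s01 l0; rewrite -/(z s l).
have := expR_ge0 (Re (Psi (z s l))).
have := normr_ge0 (sin (Im (Psi (z s l)))); have := sin_max (Im (Psi (z s l))).
set q := `|_|; set m := expR _; nra.
Qed.

Lemma integrable_contour_integrand s : 0 <= s <= 1 ->
  mu.-integrable `]0%R, +oo[ (EFin \o P s).
Proof.
move=> s01.
have [K K0 HK] := contour_envelope nu_ge k0 A0 B0 u0 r_itv.
have ig : mu.-integrable `]0%R, +oo[ (fun x => (2 * K)%:E * (expR (- (4^-1 * x)))%:E)%E.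
  by apply: integrableZl => //; apply: integrable_expN; rewrite invr_gt0.
apply: (le_integrable _ _ _ ig) => //.
  apply/measurable_EFinP; apply: open_continuous_measurable_fun => //.
  move=> l; rewrite inE/= in_itv/= andbT => l0.
  exact: (continuous_contour_integrand dth (@continuous_ramp' R) l0).
move=> l /=; rewrite in_itv/= andbT => l0; rewrite lee_fin.
apply: (le_trans (contour_integrand_le nu k A B u r s01 l0)).
rewrite [leRHS]ger0_norm; last by rewrite !mulr_ge0 ?expR_ge0.
by rewrite -mulrA ler_wpM2l// HK.
Qed.

(** In the rectangle formula on [1/(n+1), n+2], the flux at the left end tends to 0 by
    [contour_flux_cvg0] and the one at the right end by exponential decay, both dominated uniformly
    in s. *)
Lemma contour_shift :
  \int[mu]_(l in `]0%R, +oo[) P 1 l = \int[mu]_(l in `]0%R, +oo[) P 0 l.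
Proof.
have h1 := cvg_Rintegral_exhaustion (@integrable_contour_integrand 1 ltac:(by rewrite ler01 lexx)).
have h0 := cvg_Rintegral_exhaustion (@integrable_contour_integrand 0 ltac:(by rewrite ler01 lexx)).
have h : (\int[mu]_(x in `[n.+1%:R^-1, n.+2%:R]) P 1 x -
  \int[mu]_(x in `[n.+1%:R^-1, n.+2%:R]) P 0 x) @[n --> \oo] -->
  \int[mu]_(x in `]0%R, +oo[) P 1 x - \int[mu]_(x in `]0%R, +oo[) P 0 x.
  exact: cvgB h1 h0.
have [K K0 HK] := contour_flux_bound.
have d0 n : 0 < n.+1%:R^-1 :> R by rewrite invr_gt0 ltr0n.
have m0 n : 0 < n.+2%:R :> R by rewrite ltr0n.
have dm n : n.+1%:R^-1 < n.+2%:R :> R.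
  by rewrite (@le_lt_trans _ _ 1)// ?invf_le1 ?ltr0n// ?ler1n ?ltr1n.
have E n : \int[mu]_(x in `[n.+1%:R^-1, n.+2%:R]) P 1 x - \int[mu]_(x in `[n.+1%:R^-1, n.+2%:R]) P 0 x
  = \int[mu]_(s in `[0%R, 1%R]) (W s n.+2%:R - W s n.+1%:R^-1).
  exact: (contour_rectangle nu k A B u dth (@continuous_ramp' R) (d0 n) (dm n)).
have cW l : 0 < l -> continuous (W ^~ l).
  by move=> l0 s; exact: (@continuous_contour_flux R nu k A B u th s l l0).
have eK : (K * expR (- (4^-1 * l))) @[l --> +oo] --> (0 : R).
  rewrite -[X in _ --> X](mulr0 K); apply: cvgM; first exact: cvg_cst.
  have q : (4^-1 * l : R) @[l --> +oo] --> +oo.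
    by apply: gt0_cvgMry; [rewrite invr_gt0|exact: cvg_id].
  exact: (cvg_comp _ _ q (@cvgr_expR R)).
have fl : \int[mu]_(s in `[0%R, 1%R]) (W s n.+2%:R - W s n.+1%:R^-1) @[n --> \oo] --> 
   \int[mu]_(s in `[0%R, 1%R]) 0.
  apply: (@Rdominated_cvg R _ _ mu `[0%R, 1%R]%classic (fun n s => W s n.+2%:R - W s n.+1%:R^-1) (fun=> 0) (fun=> 2 * K)) => //.
  - move=> n; apply: measurable_funTS; apply: continuous_measurable_fun => s.
    by apply: cvgB; exact: cW.
  - move=> s /=; rewrite in_itv/= => s01.
    rewrite -[X in _ --> X]subr0; apply: cvgB.
      have ny : (n.+2%:R : R) @[n --> \oo] --> +oo.
        apply: ger_cvgy (@cvgr_idn R); apply: nearW => n.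
        by rewrite ler_nat ltnW.
      apply: (cvg_comp _ _ ny).
      apply: (@squeeze_cvgr _ _ _ _ (fun l => - (K * expR (- (4^-1 * l)))) (fun l => K * expR (- (4^-1 * l)))).
      - near=> l; rewrite -ler_norml; apply: HK => //; near: l; exact: nbhs_pinfty_gt.
      - by rewrite -oppr0; apply: cvgN; exact: eK.
      - exact: eK.
    by move/cvg_at_rightP : (contour_flux_cvg0 s01); apply; split => //; exact: cvg_harmonic.
  - by apply: continuous_compact_integrable; [exact: segment_compact|apply: continuous_subspaceT => ?; exact: cvg_cst].
  - move=> n s /=; rewrite in_itv/= => s01.
    have e1 l : 0 < l -> expR (- (4^-1 * l)) <= 1.
      by move=> l0; rewrite -expR0 ler_expR oppr_le0 mulr_ge0// ltW.
    apply: (le_trans (ler_normB _ _)); rewrite mulr_natl mulr2n; apply: lerD.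
      by apply: (le_trans (HK s _ s01 (m0 n))); rewrite ler_piMr// e1.
    by apply: (le_trans (HK s _ s01 (d0 n))); rewrite ler_piMr// e1.
rewrite (eq_cvg _ _ E) in h.
rewrite Rintegral_cst//= mul0r in fl.
apply/eqP; rewrite -subr_eq0; apply/eqP.
exact: (cvg_unique _ h fl).
Unshelve. all: by end_near. Qed.

End contour_shift_limit.

(** * Size of the integral over the slanted contour *)

Section contour_bound.
Local Open Scope classical_set_scope.
Context {R : realType}.
Variables (nu k A B u r : R).
Hypotheses (nu_ge : 1 / 2 <= nu) (k0 : 0 < k) (A0 : 0 <= A) (B0 : 0 <= B) (u0 : 0 <= u).
Hypothesis r_itv : 0 < r < pi / 2.
Hypothesis saddle : A * saddleT r + B * saddleS r <= 4 * u.
Local Notation Re := (@complex.Re R).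
Local Notation Im := (@complex.Im R).
Local Notation Psi := (kernel_exponent nu k A B u).
Let mu := @lebesgue_measure R.

Let th (l : R) := 2 * r + ramp l.
Local Notation z := (contour th).
Local Notation P := (contour_integrand nu k A B u th ramp').

(** The number V r of the overview; its derivative is 4 u - A [saddleT] - B [saddleS], so the
    hypothesis [saddle] reads V' >= 0. *)
Definition saddle_value : R := - (A * (2 * r * sin r / cos r)) + B * (2 * r * cos r / sin r) + 4 * u * r.

Let cr : 0 < cos r.
Proof. exact: cos_gt0_acute. Qed.

Let phase (x y : R) := A * ((x * sinh x - y * sin y) / (cosh x + cos y)) +
  B * ((x * sinh x + y * sin y) / (cosh x - cos y)) + 2 * u * y.

(** The first-order effects of the slant on the three terms add up to (ramp l / 2) V'(r) >= 0. *)
Lemma phase_ge (l : R) : 0 < l -> saddle_value <= phase l (th l).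
Proof.
move=> l0; case/andP: (r_itv) => r0 rp; have h := saddle.
have b0 := ramp_ge0 l0; have b1 := ramp_le l0; have b2 := ramp_le1 l0.
have HA := ler_wpM2l A0 (@Re_tanh_shift R r l (ramp l) ltac:(by rewrite (ltW r0)) l0 b0 b1 b2).
have HB := ler_wpM2l B0 (@Re_coth_shift R r l (ramp l) r_itv l0 b0 b1 b2).
rewrite /phase -/(th l) in HA HB *.
have : 0 <= ramp l / 2 * (4 * u - (A * saddleT r + B * saddleS r)).
  by rewrite mulr_ge0 ?subr_ge0// divr_ge0.
rewrite /saddle_value; rewrite /th in HA HB *.
set X := _ / (cosh l + _) in HA *; set Y := _ / (cosh l - _) in HB *.
set X0 := _ / cos r in HA *; set Y0 := _ / sin r in HB *.
lra.
Qed.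

(** The tanh term contributes A T l^2 / (256 (l + cos r)) >= A T (l - cos r) / 256, and the slant
    (ramp l / 2) V' >= V' (l - cos r) / 256. As A T + V' = 4 u - B S, the rate no longer involves A
    and survives at A = 0. *)
Lemma phase_ge_strong (l : R) : 0 < l <= 1 ->
  saddle_value + (4 * u - B * saddleS r) * (l - cos r) / 256 <= phase l (th l) /\
  saddle_value <= phase l (th l).
Proof.
move=> /andP[l0 l1]; split; last exact: phase_ge.
case/andP: (r_itv) => r0 rp; have h := saddle; have c0 := cr.
have b0 := ramp_ge0 l0; have b1 := ramp_le l0; have b2 := ramp_le1 l0.
have b3 : l / 32 <= ramp l by apply: ramp_ge; rewrite l0.
have r0' : 0 <= r < pi / 2 by rewrite (ltW r0).
have HA := ler_wpM2l A0 (@Re_tanh_shift_strong R r l (ramp l) r0' ltac:(by rewrite l0) b3 b1).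
have HB := ler_wpM2l B0 (@Re_coth_shift R r l (ramp l) r_itv l0 b0 b1 b2).
have [T0 _] := andP (saddleT_le r0').
have AT := mulr_ge0 A0 T0.
have lc : 0 < l + cos r by lra.
have G : (l - cos r) / 256 <= l ^+ 2 / (256 * (l + cos r)).
  have lc256 : 0 < 256 * (l + cos r) by lra.
  rewrite ler_pdivlMr//; have := sqr_ge0 (cos r); nra.
have G2 : (l - cos r) / 256 <= l / 64 by lra.
have G3 : 0 <= (4 * u - (A * saddleT r + B * saddleS r)) * (ramp l / 2 - (l - cos r) / 256).
  by rewrite mulr_ge0 ?subr_ge0//; lra.
have G4 := ler_wpM2l AT G.
rewrite /phase /saddle_value /th.
rewrite -(mulrA (saddleT r)) in HA.
set Z := l ^+ 2 / _ in G G4 HA *.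
set X := _ / (cosh l + _) in HA *; set Y := _ / (cosh l - _) in HB *.
set X0 := _ / cos r in HA *; set Y0 := _ / sin r in HB *.
lra.
Qed.

Let amplitude (l : R) := (l ^+ 2 + th l ^+ 2) / (sinh l ^+ 2 + sin (th l) ^+ 2).

Let amplitude_gt0 (l : R) : 0 < l -> 0 < amplitude l.
Proof.
move=> l0; have s0 : 0 < sinh l by exact: lt_le_trans (sinh_ge (ltW l0)).
by rewrite divr_gt0// ltr_pwDl ?exprn_gt0 ?sqr_ge0.
Qed.

Let Re_PsiE (l : R) : 0 < l ->
  Re (Psi (z 1 l)) = nu / 2 * ln (amplitude l) - k * phase l (th l).
Proof. by move=> l0; rewrite /contour mul1r Re_kernel_exponent. Qed.

Let amplitude_le (l : R) : 0 < l -> ln (amplitude l) <= ln 64 - 2 * ln (cos r).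
Proof.
move=> l0; have r0' : 0 <= r < pi / 2 by case/andP: r_itv => /ltW -> ->.
have c0 := cr.
have -> : ln 64 - 2 * ln (cos r) = ln (64 / cos r ^+ 2).
  by rewrite ln_div ?posrE ?exprn_gt0// lnXn// mulr_natl.
rewrite ler_ln ?posrE ?amplitude_gt0 ?divr_gt0 ?exprn_gt0//.
rewrite ler_pdivrMr; first exact: (quotient_sinh_le r0' l0 (ramp_ge0 l0) (ramp_le l0) (ramp_le1 l0)).
have s0 : 0 < sinh l by exact: lt_le_trans (sinh_ge (ltW l0)).
by rewrite ltr_pwDl ?exprn_gt0 ?sqr_ge0.
Qed.

Let amplitude_le1 (l : R) : 1 <= l -> ln (amplitude l) <= ln 104 - l.
Proof.
move=> l1; have l0 : 0 < l by lra.
rewrite (_ : ln 104 - l = ln (104 * expR (- l))); last first.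
  by rewrite lnM ?posrE ?expR_gt0// expRK.
rewrite ler_ln ?posrE ?amplitude_gt0//; last by rewrite mulr_gt0 ?expR_gt0.
rewrite ler_pdivrMr; first apply: quotient_sinh_le_exp => //.
  have p2 := @pihalf_lt2 R; have := ramp_ge0 l0; have := ramp_le1 l0.
  by case/andP: r_itv => ? ? ? ?; rewrite /th; apply/andP; split; lra.
have s0 : 0 < sinh l by exact: lt_le_trans (sinh_ge (ltW l0)).
by rewrite ltr_pwDl ?exprn_gt0 ?sqr_ge0.
Qed.

Let ln64 : 0 <= ln (64 : R) /\ ln (64 : R) <= ln 104.
Proof. by split; [apply: ln_ge0; lra|rewrite ler_ln ?posrE//; lra]. Qed.

Let ln4 : 2 * ln 2 <= (ln 104 : R).
Proof.
have -> : 2 * ln 2 = ln (2 ^+ 2) :> R by rewrite lnXn// mulr_natl.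
by rewrite ler_ln ?posrE//; lra.
Qed.

(** One constant for all regimes: the multiple of ln 104 covers the amplitude, with cos r >= 1/2 in
    the regular case, and the summand 1 covers l / 4 on (0, 1) as well as the offset in
    [contour_bound_singular]. *)
Definition bound_const : R := expR (nu * (ln 104 + ln 104) + 1).

Let far (l : R) : 1 <= l ->
  expR (Re (Psi (z 1 l))) <= expR (- (k * saddle_value)) * (bound_const * expR (- (4^-1 * l))).
Proof.
move=> l1; have l0 : 0 < l by lra.
rewrite /bound_const -!expRD ler_expR Re_PsiE//.
have h1 := ler_wpM2l (ltW k0) (phase_ge l0).
have n := nu_ge; have n0 : 0 <= nu / 2 by lra.
have h2 := ler_wpM2l n0 (amplitude_le1 l1).
have [l64 l65] := ln64.
have n2 : 0 <= nu * ln 104 by rewrite mulr_ge0//; lra.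
have : 4^-1 * l <= nu / 2 * l by rewrite ler_wpM2r ?(ltW l0)//; lra.
set X := phase l (th l) in h1 *; set Y := ln (amplitude l) in h2 *; set f := saddle_value in h1 *.
lra.
Qed.

Lemma contour_bound_regular (l : R) : 0 < l -> 1 / 2 <= cos r ->
  expR (Re (Psi (z 1 l))) <= expR (- (k * saddle_value)) * (bound_const * expR (- (4^-1 * l))).
Proof.
move=> l0 c2; have [|l1] := leP 1 l; first exact: far.
rewrite /bound_const -!expRD ler_expR Re_PsiE//.
have h1 := ler_wpM2l (ltW k0) (phase_ge l0).
have n := nu_ge; have n0 : 0 <= nu / 2 by lra.
have h2 := ler_wpM2l n0 (amplitude_le l0).
have [l64 l65] := ln64; have l4 := ln4.
have c3 : - ln 2 <= ln (cos r).
  by rewrite -lnV ?posrE// ler_ln ?posrE ?cr//; lra.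
have h3 : nu / 2 * (ln 64 - 2 * ln (cos r)) <= nu / 2 * (ln 104 + ln 104).
  by rewrite ler_wpM2l//; lra.
have n2 : 0 <= nu * ln 104 by rewrite mulr_ge0//; lra.
set X := phase l (th l) in h1 *; set Y := ln (amplitude l) in h2 *; set f := saddle_value in h1 *.
lra.
Qed.

(* The rate [1 / (256 cos r)] of the last exponential gives back one power of
   [cos r] after integration, whence the exponent [nu - 1] of the theorem. *)
Lemma contour_bound_singular (l : R) : 0 < l -> 1 <= k * (4 * u - B * saddleS r) * cos r ->
  expR (Re (Psi (z 1 l))) <= expR (- (k * saddle_value)) *
    (bound_const * expR (- (4^-1 * l)) +
     bound_const * (cos r)^-1 `^ nu * expR (- ((256 * cos r)^-1 * l))).
Proof.
move=> l0 hs; have c0 := cr; have c256 : 0 < 256 * cos r by lra.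
have e1 : 0 <= bound_const * expR (- (4^-1 * l)) by rewrite mulr_ge0 ?expR_ge0.
have e2 : 0 <= bound_const * (cos r)^-1 `^ nu * expR (- ((256 * cos r)^-1 * l)).
  by rewrite !mulr_ge0 ?expR_ge0 ?powR_ge0.
have [l1|l1] := leP 1 l.
  by apply: (le_trans (far l1)); rewrite ler_wpM2l ?expR_ge0// lerDl.
apply: (@le_trans _ _ (expR (- (k * saddle_value)) *
  (bound_const * (cos r)^-1 `^ nu * expR (- ((256 * cos r)^-1 * l))))); last first.
  by rewrite ler_wpM2l ?expR_ge0// lerDr.
rewrite /bound_const /powR gt_eqF ?invr_gt0// -!expRD ler_expR Re_PsiE// lnV ?posrE//.
have n := nu_ge; have n0 : 0 <= nu / 2 by lra.
have h2 := ler_wpM2l n0 (amplitude_le l0).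
have [l64 l65] := ln64; have n2 : 0 <= nu * ln 104 by rewrite mulr_ge0//; lra.
have n3 : nu * ln 64 <= nu * ln 104 by rewrite ler_wpM2l//; lra.
have n4 : 0 <= nu * ln 64 by rewrite mulr_ge0//; lra.
have h1 : k * saddle_value + ((256 * cos r)^-1 * l - 1) <= k * phase l (th l).
  have [H1 H2] := @phase_ge_strong l ltac:(by rewrite l0 ltW).
  (* Up to l = cos r the exponent to be gained is at most 1, which the constant absorbs; beyond it,
     the hypothesis turns the rate of [phase_ge_strong] into 1 / (256 cos r). *)
  have [lc|lc] := leP l (cos r).
    have : (256 * cos r)^-1 * l <= 1 by rewrite mulrC ler_pdivrMr//; lra.
    by have := ler_wpM2l (ltW k0) H2; lra.
  have : (256 * cos r)^-1 * l - 1 <= k * ((4 * u - B * saddleS r) * (l - cos r) / 256).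
    apply: (@le_trans _ _ ((l - cos r) / (256 * cos r))).
      have -> : (l - cos r) / (256 * cos r) = (256 * cos r)^-1 * l - 1 / 256.
        by field; rewrite gt_eqF.
      by lra.
    rewrite ler_pdivrMr//.
    have lc' : 0 <= l - cos r by rewrite subr_ge0 ltW.
    have := ler_wpM2r lc' hs; lra.
  by have := ler_wpM2l (ltW k0) H1; lra.
set X := phase l (th l) in h1 *; set Y := ln (amplitude l) in h2 *; set f := saddle_value in h1 *.
set V := (256 * cos r)^-1 * l in h1 *.
lra.
Qed.

Let P_le (l : R) : 0 < l -> `|P 1 l| <= 2 * expR (Re (Psi (z 1 l))).
Proof. by move=> l0; apply: (contour_integrand_le nu k A B u r (s := 1)) => //; rewrite ler01 lexx. Qed.

Let intP : mu.-integrable `]0%R, +oo[ (EFin \o P 1).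
Proof.
apply: (integrable_contour_integrand nu_ge (ltW k0) A0 B0 u0 r_itv).
by rewrite ler01 lexx.
Qed.

Lemma Rintegral_expN (c : R) : 0 < c -> \int[mu]_(l in `]0%R, +oo[) expR (- (c * l)) = c^-1.
Proof. by move=> c0; rewrite /Rintegral integral_expN. Qed.

(** The two exponentials integrate to 4 and 256 cos r, and dz contributes a factor 2: 520 = 2 (4 +
    256). The second integral turns (cos r)^(-nu) into (cos r)^(1 - nu); the first carries no power,
    hence the cutoff of alpha at 0. *)
Lemma contour_integral_bound (alpha := Num.max (nu - 1) 0) :
  1 / 2 <= cos r \/ 1 <= k * (4 * u - B * saddleS r) * cos r ->
  `|\int[mu]_(l in `]0%R, +oo[) P 1 l| <=
  520 * bound_const * expR (- (k * saddle_value)) * (cos r)^-1 `^ alpha.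
Proof.
move=> hr; have c0 := cr.
have K0 : 0 <= bound_const by exact: expR_ge0.
have E0 : 0 <= expR (- (k * saddle_value)) by exact: expR_ge0.
set K := bound_const in K0 *; set E := expR _ in E0 *.
have ci1 : 1 <= (cos r)^-1 by rewrite invf_ge1 // cos_le1.
have a0 : 0 <= alpha by rewrite /alpha le_max lexx orbT.
have p1 : 1 <= (cos r)^-1 `^ alpha.
  by rewrite -[X in X <= _](powRr0 (cos r)^-1) ler_powR.
have pn : (cos r)^-1 `^ nu * cos r <= (cos r)^-1 `^ alpha.
  have cv0 : 0 <= (cos r)^-1 by rewrite invr_ge0 ltW.
  have -> : (cos r)^-1 `^ nu = (cos r)^-1 `^ (nu - 1) * (cos r)^-1.
    rewrite -[X in _ = _ * X](powRr1 cv0) -powRD ?subrK//.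
    by apply/implyP => _; rewrite gt_eqF// invr_gt0.
  rewrite mulfVK ?gt_eqF//; apply: ler_powR => //.
  by rewrite /alpha le_max lexx.
have D : measurable (`]0%R, +oo[ : set (measurableTypeR R)) by exact: measurable_itv.
pose g l := 2 * E * K * expR (- (4^-1 * l)) +
  2 * E * (K * (cos r)^-1 `^ nu) * expR (- ((256 * cos r)^-1 * l)).
have i1 (a c : R) : 0 < c -> mu.-integrable `]0%R, +oo[ (EFin \o (fun l => a * expR (- (c * l)))).
  move=> cp; rewrite (_ : _ \o _ = (fun l => a%:E * (expR (- (c * l)))%:E)%E)//.
  by apply: integrableZl => //; exact: integrable_expN.
have q0 : (0 : R) < 4^-1 by rewrite invr_gt0.
have q1 : 0 < (256 * cos r)^-1 by rewrite invr_gt0; lra.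
have Pg l : 0 < l -> `|P 1 l| <= g l.
  move=> l0; apply: (le_trans (P_le l0)); rewrite /g.
  case: hr => h.
    have := contour_bound_regular l0 h; rewrite -/K -/E.
    have : 0 <= 2 * E * (K * (cos r)^-1 `^ nu) * expR (- ((256 * cos r)^-1 * l)).
      by rewrite !mulr_ge0 ?expR_ge0 ?powR_ge0.
    set w := _ * expR (- (_^-1 * l)); lra.
  have := contour_bound_singular l0 h; rewrite -/K -/E; lra.
pose g1 l := 2 * E * K * expR (- (4^-1 * l)).
pose g2 l := 2 * E * (K * (cos r)^-1 `^ nu) * expR (- ((256 * cos r)^-1 * l)).
have ig : mu.-integrable `]0%R, +oo[ (EFin \o g).
  rewrite (_ : EFin \o g = ((EFin \o g1) \+ (EFin \o g2))%E)//.
  by apply: integrableD => //; exact: i1.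
apply: (le_trans (le_normr_Rintegral D intP)).
apply: (le_trans (le_Rintegral D (integrable_norm intP) ig _)).
  by move=> l /=; rewrite in_itv/= andbT; exact: Pg.
rewrite /g RintegralD//; [|exact: i1|exact: i1].
rewrite !RintegralZl//; [|exact: integrable_expN|exact: integrable_expN].
rewrite !Rintegral_expN// !invrK.
have EK : 0 <= E * K by rewrite mulr_ge0.
have := ler_wpM2l EK p1; have := ler_wpM2l EK pn.
set p := _ `^ alpha; set p' := _ `^ nu; lra.
Qed.

End contour_bound.

(** * The saddle point *)

Section saddle_selection.
Local Open Scope classical_set_scope.
Context {R : realType}.
Variables (A B u k : R).
Hypotheses (A0 : 0 <= A) (B0 : 0 <= B) (u0 : 0 < u) (k0 : 0 < k).
Local Notation SV := (saddle_value A B u).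

Lemma saddleS_pihalf : saddleS (pi / 2 : R) = pi.
Proof. by rewrite /saddleS sin_pihalf cos_pihalf; field. Qed.

Lemma continuous_saddleS (r : R) : 0 < r <= 2 -> {for r, continuous (@saddleS R)}.
Proof.
move=> /andP[r0 r2]; apply: differentiable_continuous; apply/derivable1_diffP.
have := @is_derive_saddleS R r; rewrite r0 => H.
by case: (H ltac:(lra)).
Qed.

Lemma continuous_saddleT (r : R) : cos r != 0 -> {for r, continuous (@saddleT R)}.
Proof.
move=> c0; rewrite /saddleT.
have cc : {for r, continuous (@cos R)} by exact: continuous_cos.
have cs : {for r, continuous (@sin R)} by exact: continuous_sin.
apply: cvgM.
  apply: cvgM; first exact: cvg_cst.
  by apply: cvgD; [exact: cvg_id|exact: cvgM].
apply: cvgV; first by rewrite expf_neq0.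
by apply: cvgM.
Qed.

(** S and T vanish linearly at 0; this provides an angle with V' >= 0 at which the search for a
    critical point can start. *)
Lemma saddleS_small (r : R) : 0 < r <= 1 / 2 -> saddleS r <= 12 * r.
Proof.
move=> /andP[r0 r1].
have s3 : r / 3 <= sin r by apply: sin_ge_third; rewrite (ltW r0); lra.
rewrite /saddleS ler_pdivrMr; last by rewrite exprn_gt0//; lra.
have h1 := sin_ge3 (ltW r0); have h2 := cos_ge2 (ltW r0).
have r3 : 0 < r ^+ 3 by rewrite exprn_gt0.
have r2 : 0 < r ^+ 2 by rewrite exprn_gt0.
have e3 : r ^+ 3 = r * r ^+ 2 by rewrite exprS.
have q2 : r ^+ 2 <= 1 / 4 by nra.
have : (r - r ^+ 3 / 6) * (1 - r ^+ 2 / 2) <= sin r * cos r.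
  by apply: ler_pM => //; nra.
have : (r / 3) ^+ 2 <= sin r ^+ 2 by rewrite lerXn2r ?nnegrE//; lra.
rewrite e3; set X := r ^+ 2 in r2 q2 *.
have -> : (r / 3) ^+ 2 = X / 9 by rewrite /X; field.
move=> a1 a2.
have : 12 * r * (X / 9) <= 12 * r * sin r ^+ 2 by rewrite ler_wpM2l//; lra.
have : 0 <= r * X * X by rewrite !mulr_ge0// ltW.
lra.
Qed.

Lemma saddleT_small (r : R) : 0 < r <= 1 / 2 -> saddleT r <= 12 * r.
Proof.
move=> /andP[r0 r1].
have h2 := cos_ge2 (ltW r0).
have c1 : 3 / 4 <= cos r by nra.
rewrite /saddleT ler_pdivrMr; last by rewrite exprn_gt0//; lra.
have := sin_mul_cos_le (ltW r0); have : 1 / 2 <= cos r ^+ 2 by nra.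
nra.
Qed.

Lemma saddle_value_loss (r r' : R) : 0 < r -> r <= r' -> r' <= pi / 2 ->
  A = 0 \/ r' < pi / 2 ->
  SV r' <= SV r + (4 * u - B * saddleS r) * (r' - r).
Proof.
move=> r0 rr rp hA.
have p2 := @pihalf_lt2 R.
have t1 := @cot_tangent_le R r (r' - r) r0 ltac:(lra) ltac:(lra).
have er : r + (r' - r) = r' by ring.
rewrite er in t1.
have := ler_wpM2l B0 t1; rewrite mulr0 /saddle_value.
have : A * (2 * r * sin r / cos r) <= A * (2 * r' * sin r' / cos r').
  case: hA => [->|rp']; first by rewrite !mul0r.
  apply: ler_wpM2l => //.
  have c0 : 0 < cos r' by rewrite cos_gt0_pihalf//; apply/andP; split; lra.
  have c1 : cos r' <= cos r.
    rewrite -er; apply: cosD_le; [apply/andP; split; lra|apply/andP; split; lra|].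
    by rewrite ltW// cos_gt0_pihalf//; apply/andP; split; lra.
  have s1 : sin r <= sin r'.
    move: rr; rewrite le_eqVlt => /orP[/eqP->//|lt].
    by rewrite ltW// ltr_sin ?in_itv/=//; apply/andP; split; lra.
  have s0 : 0 <= sin r by have := @sin_ge_third _ r; lra.
  apply: ler_pM.
  - by rewrite mulr_ge0//; lra.
  - by rewrite invr_ge0; lra.
  - by apply: ler_pM => //; lra.
  - by rewrite lef_pV2 ?posrE//; lra.
rewrite -!(mulrA 2).
set X := _ / cos r'; set X' := _ / cos r; set Y := _ / sin r'; set Y' := _ / sin r.
lra.
Qed.

(* One descends from [r0] to an [r] at which one of the two alternatives
   required by the contour bound holds; the loss of [SV] is [O(1 / k)], so that
   of the exponential is a constant factor. *)
Lemma saddle_descent (r0 : R) : 0 < r0 <= pi / 2 -> A = 0 \/ r0 < pi / 2 ->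
  (forall r, 0 < r -> r <= r0 -> r < pi / 2 -> A * saddleT r + B * saddleS r <= 4 * u) ->
  cos r0 < 1 / 2 -> k * (4 * u - B * saddleS r0) * cos r0 < 1 ->
  exists r, [/\ 0 < r < pi / 2, r <= r0,
    1 / 2 = cos r \/ 1 = k * (4 * u - B * saddleS r) * cos r &
    SV r0 <= SV r + 3 / k].
Proof.
move=> /andP[r00 r0p] hA sd c0 h0.
have p2 := @pihalf_lt2 R.
have p1 := @pihalf_ge1 R.
(* The angle where cos r reaches 1/2, the lowest point of the descent. *)
pose r1 : R := acos (1 / 2).
have i1 : -1 <= (1 / 2 : R) <= 1 by apply/andP; split; lra.
have c1 : cos r1 = 1 / 2 by apply: acosK; rewrite in_itv.
have r1p : 0 < r1.
  by apply: acos_gt0; apply/andP; split; lra.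
have r10 : r1 < r0.
  have := @ltr_cos R r1 r0; rewrite !in_itv/= => <-.
  - by rewrite c1.
  - by rewrite (ltW r1p) acos_lepi.
  - by apply/andP; split; lra.
have loss r : r1 <= r -> r <= r0 -> r < pi / 2 -> k * (4 * u - B * saddleS r) * cos r <= 1 ->
    SV r0 <= SV r + 3 / k.
  move=> r1r rr0 rp hr.
  have rp0 : 0 < r by lra.
  have L := saddle_value_loss rp0 rr0 r0p hA.
  (* Since r0 <= pi / 2, the distance descended is at most 3 cos r: this is the 3 of the loss 3 /
     k. *)
  have s3 : (pi / 2 - r) / 3 <= cos r.
    have := @sin_ge_third R (pi / 2 - r); rewrite sinB sin_pihalf cos_pihalf; lra.
  have v0 : 0 <= 4 * u - B * saddleS r.
    have := sd r rp0 rr0 rp.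
    have : 0 <= A * saddleT r.
      by rewrite mulr_ge0//; have /andP[] := @saddleT_le R r ltac:(by rewrite (ltW rp0)).
    lra.
  have : (4 * u - B * saddleS r) * (r0 - r) <= (4 * u - B * saddleS r) * (3 * cos r).
    by rewrite ler_wpM2l//; lra.
  have : (4 * u - B * saddleS r) * (3 * cos r) <= 3 / k.
    by rewrite ler_pdivlMr//; lra.
  lra.
have [H1|H1] := leP (k * (4 * u - B * saddleS r1) * cos r1) 1.
  exists r1; split => //.
  - by apply/andP; split; lra.
  - exact: ltW.
  - by left; rewrite c1.
  - by apply: loss => //; lra.
(* [f] exceeds 1 at [r1] and is below 1 at [r0], so it takes the value 1 in between, and not at pi /
   2, where it vanishes. *)
pose f r := k * (4 * u - B * saddleS r) * cos r.
have cf : {within `[r1, r0], continuous f}.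
  apply: continuous_in_subspaceT => r; rewrite inE/= in_itv/= => /andP[? ?].
  apply: cvgM; last exact: continuous_cos.
  apply: cvgM; first exact: cvg_cst.
  apply: cvgB; first exact: cvg_cst.
  by apply: cvgM; [exact: cvg_cst|apply: continuous_saddleS; apply/andP; split; lra].
have f1 : Num.min (f r1) (f r0) <= 1 <= Num.max (f r1) (f r0).
  by rewrite ge_min le_max (ltW h0) (ltW H1) orbT.
have [r rI fr] := IVT (ltW r10) cf f1.
move: rI; rewrite in_itv/= => /andP[r1r rr0].
have rp : r < pi / 2.
  rewrite lt_neqAle (le_trans rr0 r0p) andbT; apply/eqP => rE.
  by move: fr; rewrite /f rE cos_pihalf mulr0 => /esym/eqP; rewrite oner_eq0.
exists r; split => //.
- by apply/andP; split; lra.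
- by right.
- by apply: loss => //; rewrite -/(f r) fr.
Qed.

End saddle_selection.

(** * The kernel as an integral over the half-line *)

Section symmetric_integrals.
Local Open Scope classical_set_scope.
Context {R : realType}.
Let mu := @lebesgue_measure R.
Local Open Scope ereal_scope.

Lemma integral_fold (g : R -> \bar R) : measurable_fun [set: R] g -> (forall x, 0 <= g x) ->
  \int[mu]_x g x = \int[mu]_(x in `]0%R, +oo[) g x + \int[mu]_(x in `]0%R, +oo[) g (- x)%R.
Proof.
move=> mg g0.
have mN : measurable_fun [set: R] (fun x => g (- x)%R).
  by apply: measurableT_comp => //; exact: measurable_oppr.
have U : [set: R] = `]-oo, 0%R] `|` `]0%R, +oo[.
  by apply/seteqP; split => x //= _; rewrite !in_itv/= andbT; case: (leP x 0%R) => ?; [left|right].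
rewrite {1}U ge0_integral_setU//=; last 2 first.
- by rewrite -U.
- apply/disj_setPS => x [] /=; rewrite !in_itv/= andbT => x0; rewrite ltNge x0//.
rewrite addeC; congr (_ + _).
rewrite integral_itv_obnd_cbnd; last exact: measurable_funTS.
rewrite (@ge0_integration_by_substitution0 _ (fun x => g (- x)%R))//.
by apply: eq_integral => x _; rewrite opprK.
Qed.

Lemma measurable_fun_symm (f : R -> R) (e : R) : measurable_fun (`]0%R, +oo[ : set R) f ->
  (forall x, f (- x)%R = (e * f x)%R) -> measurable_fun [set: R] f.
Proof.
move=> mf fN.
have U : [set: R] = `]-oo, 0%R[ `|` ([set 0%R] `|` `]0%R, +oo[).
  apply/seteqP; split => x //= _; rewrite !in_itv/= andbT.
  by case: (ltgtP x 0%R) => ?; [left|right; right|right; left].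
rewrite U; apply/measurable_funU => //; first exact: measurableU.
split; last by apply/measurable_funU => //; split => //; exact: measurable_fun_set1.
rewrite (_ : f = (fun x => e * f (- x))%R); last first.
  by apply/funext => x; rewrite -fN opprK.
apply: measurable_funM; first exact: measurable_cst.
apply: (@measurable_comp _ _ _ _ _ _ (`]0%R, +oo[ : set R)) => //.
- by move=> y [x /=]; rewrite !in_itv/= andbT => x0 <-; rewrite oppr_gt0.
Qed.

Lemma Rintegral_even (f : R -> R) : mu.-integrable `]0%R, +oo[ (EFin \o f) ->
  (forall x, f (- x)%R = f x) ->
  (\int[mu]_x f x = 2 * \int[mu]_(x in `]0%R, +oo[) f x)%R.
Proof.
move=> fi fN.
have mf : measurable_fun [set: R] f.
  apply: (@measurable_fun_symm _ 1%R); last by move=> x; rewrite mul1r.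
  by apply/measurable_EFinP; case/integrableP: fi.
have mf' : measurable_fun [set: R] (EFin \o f) by exact/measurable_EFinP.
rewrite /Rintegral integralE.
rewrite integral_fold//; last exact: measurable_funepos.
rewrite [X in _ - X]integral_fold//; last exact: measurable_funeneg.
have e1 : \int[mu]_(x in `]0%R, +oo[) (EFin \o f)^\+ (- x)%R = \int[mu]_(x in `]0%R, +oo[) (EFin \o f)^\+ x.
  by apply: eq_integral => x _; rewrite !funeposE /= fN.
have e2 : \int[mu]_(x in `]0%R, +oo[) (EFin \o f)^\- (- x)%R = \int[mu]_(x in `]0%R, +oo[) (EFin \o f)^\- x.
  by apply: eq_integral => x _; rewrite !funenegE /= fN.
rewrite e1 e2 [in RHS]integralE.
have p1 : \int[mu]_(x in `]0%R, +oo[) (EFin \o f)^\+ x \is a fin_num.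
  by apply: integrable_pos_fin_num.
have p2 : \int[mu]_(x in `]0%R, +oo[) (EFin \o f)^\- x \is a fin_num.
  by apply: integrable_neg_fin_num.
rewrite -(fineK p1) -(fineK p2) /=; ring.
Qed.

Lemma Rintegral_odd (f : R -> R) : mu.-integrable `]0%R, +oo[ (EFin \o f) ->
  (forall x, f (- x)%R = (- f x)%R) -> (\int[mu]_x f x = 0)%R.
Proof.
move=> fi fN.
have mf : measurable_fun [set: R] f.
  apply: (@measurable_fun_symm _ (-1)%R); last by move=> x; rewrite mulN1r.
  by apply/measurable_EFinP; case/integrableP: fi.
have mf' : measurable_fun [set: R] (EFin \o f) by exact/measurable_EFinP.
rewrite /Rintegral integralE.
rewrite integral_fold//; last exact: measurable_funepos.
rewrite [X in _ - X]integral_fold//; last exact: measurable_funeneg.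
have e1 : \int[mu]_(x in `]0%R, +oo[) (EFin \o f)^\+ (- x)%R = \int[mu]_(x in `]0%R, +oo[) (EFin \o f)^\- x.
  by apply: eq_integral => x _; rewrite funeposE funenegE /= fN.
have e2 : \int[mu]_(x in `]0%R, +oo[) (EFin \o f)^\- (- x)%R = \int[mu]_(x in `]0%R, +oo[) (EFin \o f)^\+ x.
  by apply: eq_integral => x _; rewrite funeposE funenegE /= fN opprK.
rewrite e1 e2.
have p1 : \int[mu]_(x in `]0%R, +oo[) (EFin \o f)^\+ x \is a fin_num.
  by apply: integrable_pos_fin_num.
have p2 : \int[mu]_(x in `]0%R, +oo[) (EFin \o f)^\- x \is a fin_num.
  by apply: integrable_neg_fin_num.
rewrite -(fineK p1) -(fineK p2) /=; ring.
Qed.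

End symmetric_integrals.

Section euclidean.
Context {R : realType} {n : nat}.
Implicit Types x y : 'rV[R]_n.

Lemma dotv_ge0 x : 0 <= dotv x x.
Proof. by apply: sumr_ge0 => j _; rewrite -expr2 sqr_ge0. Qed.

Lemma enorm_sqr x : enorm x ^+ 2 = dotv x x.
Proof. by rewrite /enorm sqr_sqrtr ?dotv_ge0. Qed.

Lemma enorm_ge0 x : 0 <= enorm x. Proof. exact: sqrtr_ge0. Qed.

Lemma enorm0 : enorm (0 : 'rV[R]_n) = 0.
Proof. by rewrite /enorm /dotv big1 ?sqrtr0// => j _; rewrite mxE mul0r. Qed.

Lemma dotvDD x y : dotv (x + y) (x + y) = dotv x x + dotv y y + 2 * dotv x y.
Proof.
rewrite /dotv mulr_sumr -!big_split /=; apply: eq_bigr => j _; rewrite !mxE; ring.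
Qed.

Lemma dotvBB x y : dotv (x - y) (x - y) = dotv x x + dotv y y - 2 * dotv x y.
Proof.
rewrite /dotv mulr_sumr -sumrN -!big_split /=; apply: eq_bigr => j _; rewrite !mxE; ring.
Qed.

End euclidean.

Section kernel_formula.
Local Open Scope classical_set_scope.
Local Open Scope complex_scope.
Context {R : realType} {n : nat}.
Variables (t : R) (x xi : 'rV[R]_n) (u : R).
Hypotheses (n0 : (0 < n)%N) (t0 : 0 < t).
Local Notation Re := (@complex.Re R).
Local Notation Im := (@complex.Im R).
Let mu := @lebesgue_measure R.
Let nu : R := n%:R / 2.
Let k : R := (4 * t)^-1.
Let A : R := enorm (x + xi) ^+ 2 / 2.
Let B : R := enorm (x - xi) ^+ 2 / 2.
Local Notation Psi := (kernel_exponent nu k A B u).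

Let integrand (l : R) : R[i] := (l_over_sinh l `^ (n%:R / 2))%:C *
     cexp (- ((4 * t)^-1)%:C *
           ((l_coth l * (enorm x ^+ 2 + enorm xi ^+ 2)
             - 2 * l_over_sinh l * dotv x xi)%:C
            - 2 * 'i * l%:C * u%:C)).

Let X (l : R) := l_coth l * (enorm x ^+ 2 + enorm xi ^+ 2) - 2 * l_over_sinh l * dotv x xi.

Let Re_integrand l : Re (integrand l) =
  l_over_sinh l `^ nu * expR (- (k * X l)) * cos (2 * k * u * l).
Proof.
rewrite /integrand -/(X l) Re_mul Re_cexp /= mul0r subr0 -mulrA; congr (_ * (expR _ * cos _)).
  by rewrite /k; ring.
by rewrite /k; ring.
Qed.

Let Im_integrand l : Im (integrand l) =
  l_over_sinh l `^ nu * expR (- (k * X l)) * sin (2 * k * u * l).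
Proof.
rewrite /integrand -/(X l) Im_mul Im_cexp /= mul0r addr0 -mulrA; congr (_ * (expR _ * sin _)).
  by rewrite /k; ring.
by rewrite /k; ring.
Qed.

Let l_over_sinhN (l : R) : l_over_sinh (- l) = l_over_sinh l.
Proof.
rewrite /l_over_sinh oppr_eq0; case: eqP => // _.
have -> : sinh (- l) = - sinh l by rewrite /sinh opprK; ring.
by rewrite invrN mulrNN.
Qed.

Let l_cothN (l : R) : l_coth (- l) = l_coth l.
Proof.
rewrite /l_coth oppr_eq0; case: eqP => // _.
have -> : sinh (- l) = - sinh l by rewrite /sinh opprK; ring.
have -> : cosh (- l) = cosh l by rewrite /cosh opprK; ring.
by rewrite invrN mulrN mulrNN.
Qed.

Let XN l : X (- l) = X l. Proof. by rewrite /X l_over_sinhN l_cothN. Qed.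

Let Re_integrandN l : Re (integrand (- l)) = Re (integrand l).
Proof. by rewrite !Re_integrand XN l_over_sinhN mulrN cosN. Qed.

Let Im_integrandN l : Im (integrand (- l)) = - Im (integrand l).
Proof. by rewrite !Im_integrand XN l_over_sinhN mulrN sinN mulrN. Qed.

(** From |x|^2 + |xi|^2 = A + B and 2 x.xi = A - B, the half-angle formulas for (cosh l - 1) / sinh
    l and (cosh l + 1) / sinh l separate the exponent into A l tanh (l/2) + B l coth (l/2). *)
Lemma kernel_integrandE (l : R) : 0 < l -> integrand l = cexp (Psi (l +i* 0)).
Proof.
move=> l0.
have s0 : 0 < sinh l by exact: lt_le_trans (sinh_ge (ltW l0)).
have c1 : cosh l - 1 != 0.
  have l2 : 0 < l ^+ 2 by rewrite exprn_gt0.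
  by rewrite gt_eqF// subr_gt0; have := cosh_ge2 (ltW l0); lra.
have c2 : cosh l + 1 != 0 by rewrite gt_eqF//; have := cosh_ge1 l; lra.
have E : l_over_sinh l `^ nu * expR (- (k * X l)) = expR (Re (Psi (l +i* 0))).
  rewrite Re_kernel_exponent// mulr0 sin0 cos0 mulr0 subr0 addr0 expr0n addr0 addr0.
  have los : l_over_sinh l = l / sinh l by rewrite /l_over_sinh gt_eqF.
  have q0 : 0 < l / sinh l by exact: divr_gt0.
  rewrite los /powR (gt_eqF q0) -expRD addr0 -expr_div_n lnXn// -(mulr_natl (ln _)); congr expR.
  have -> : X l = A * (l * sinh l / (cosh l + 1)) + B * (l * sinh l / (cosh l - 1)); last by field; apply/andP.
  rewrite /X los /l_coth gt_eqF// /A /B !enorm_sqr dotvDD dotvBB.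
  have sn : sinh l != 0 by rewrite gt_eqF.
  have cs : sinh l ^+ 2 = (cosh l - 1) * (cosh l + 1).
    by rewrite -[LHS](addKr 1) -cosh2; ring.
  have -> : l * sinh l / (cosh l + 1) = l * (cosh l - 1) / sinh l.
    have -> : cosh l - 1 = sinh l ^+ 2 / (cosh l + 1) by rewrite cs mulfK.
    by field; apply/andP.
  have -> : l * sinh l / (cosh l - 1) = l * (cosh l + 1) / sinh l.
    have -> : cosh l + 1 = sinh l ^+ 2 / (cosh l - 1) by rewrite cs mulrAC mulfV// mul1r.
    by field; apply/andP.
  by field; rewrite gt_eqF.
have I : Im (Psi (l +i* 0)) = 2 * k * u * l.
  rewrite Im_kernel_exponent// mul0r mulr0 sin0 !(mul0r, mulr0, atan0, addr0, subr0).
  by ring.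
apply: eq_complexP; first by rewrite Re_integrand Re_cexp E I.
by rewrite Im_integrand Im_cexp E I.
Qed.

Let K0 (l : R) := cexp (Psi (l +i* 0)).

Let K0_cont (l : R) : 0 < l -> ccont K0 l.
Proof.
move=> l0; rewrite /K0; apply: ccont_cexp.
apply: (@ccont_kernel_exponent _ nu k A B u _ (fun l : R => l +i* 0) l l0).
by split => /=; [exact: cvg_id|exact: cvg_cst].
Qed.

(** On the real axis l coth (l/2) >= 2, which gives the Gaussian in 2 B = |x - xi|^2. This makes the
    kernel integral converge and is also the final bound at u = 0. *)
Lemma Re_kernel_real_le (l : R) : 0 < l ->
  expR (Re (Psi (l +i* 0))) <= expR (- (k * (2 * B))) * (bound_const nu * expR (- (4^-1 * l))).
Proof.
move=> l0; rewrite /bound_const -!expRD ler_expR Re_kernel_exponent//.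
have k0 : 0 < k by rewrite invr_gt0 mulr_gt0.
have s0 : 0 < sinh l by exact: lt_le_trans (sinh_ge (ltW l0)).
have ch2 := cosh_ge2 (ltW l0).
have l2 : 0 < l ^+ 2 by rewrite exprn_gt0.
have A0 : 0 <= A by rewrite divr_ge0 ?sqr_ge0.
have B0 : 0 <= B by rewrite divr_ge0 ?sqr_ge0.
rewrite !(mulr0, mul0r, subr0, addr0) cos0.
have hA : 0 <= A * (l * sinh l / (cosh l + 1)).
  rewrite mulr_ge0//; apply: divr_ge0; last by lra.
  by apply: mulr_ge0; exact: ltW.
have hB : 2 * B <= B * (l * sinh l / (cosh l - 1)).
  rewrite mulrC ler_wpM2l// ler_pdivlMr; last by lra.
  exact: mul_sinh_ge2 (ltW l0).
have hk := ler_wpM2l (ltW k0) (lerD hA hB); rewrite add0r in hk.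
have nu1 : 1 / 2 <= nu by rewrite /nu ler_pM2r ?invr_gt0// ler1n.
have nu0 : 0 <= nu / 2 by lra.
have r0 : 0 <= (0 : R) < pi / 2 by rewrite lexx divr_gt0// pi_gt0.
have ln0 : 0 <= ln (104 : R) by apply: ln_ge0; lra.
have D0 : 0 < sinh l ^+ 2 + sin 0 ^+ 2 by rewrite ltr_pwDl ?exprn_gt0 ?sqr_ge0.
have n2 : 0 <= nu * ln 104 by rewrite mulr_ge0//; lra.
set q := (_ + _) / (_ + _).
have q0 : 0 < q by rewrite divr_gt0// ltr_pwDl ?exprn_gt0 ?sqr_ge0.
set Z := A * _ + B * _ in hk *.
have [l1|l1] := leP 1 l.
  have : ln q <= ln 104 - l.
    rewrite (_ : ln 104 - l = ln (104 * expR (- l))); last first.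
      by rewrite lnM ?posrE ?expR_gt0// expRK.
    rewrite ler_ln ?posrE//; last by rewrite mulr_gt0 ?expR_gt0.
    by rewrite ler_pdivrMr//; apply: quotient_sinh_le_exp => //; apply/andP; split; lra.
  move=> /(ler_wpM2l nu0).
  have : 4^-1 * l <= nu / 2 * l by rewrite ler_wpM2r ?(ltW l0)//; lra.
  lra.
have : ln q <= ln 104.
  rewrite ler_ln ?posrE// ler_pdivrMr//.
  have := @quotient_sinh_le R 0 l 0 r0 l0 (lexx 0) ltac:(lra) ltac:(lra).
  rewrite mulr0 addr0 cos0 expr1n divr1 => /le_trans; apply.
  by rewrite ler_wpM2r ?(ltW D0)//; lra.
move=> /(ler_wpM2l nu0); lra.
Qed.

Let integrable_K0 (f : R[i] -> R) : (forall z, `|f (cexp z)| <= expR (Re z)) ->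
  (forall l, 0 < l -> {for l, continuous (fun l => f (K0 l))}) ->
  mu.-integrable `]0%R, +oo[ (EFin \o (fun l => f (K0 l))).
Proof.
move=> fle fc.
set C := expR (- (k * (2 * B))) * bound_const nu.
have C0 : 0 <= C by rewrite mulr_ge0 ?expR_ge0.
have ig : mu.-integrable `]0%R, +oo[ (fun x => C%:E * (expR (- (4^-1 * x)))%:E)%E.
  by apply: integrableZl => //; apply: integrable_expN; rewrite invr_gt0.
apply: (le_integrable _ _ _ ig) => //.
  apply/measurable_EFinP; apply: open_continuous_measurable_fun => //.
  by move=> l; rewrite inE/= in_itv/= andbT => l0; exact: fc.
move=> l /=; rewrite in_itv/= andbT => l0; rewrite lee_fin [leRHS]ger0_norm; last first.
  by rewrite mulr_ge0 ?expR_ge0.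
apply: (le_trans (fle _)).
by rewrite /C -mulrA; exact: Re_kernel_real_le.
Qed.

Lemma Re_cexp_le (z : R[i]) : `|Re (cexp z)| <= expR (Re z).
Proof. by rewrite Re_cexp normrM ger0_norm ?expR_ge0// ler_piMr ?expR_ge0 ?cos_max. Qed.

Lemma Im_cexp_le (z : R[i]) : `|Im (cexp z)| <= expR (Re z).
Proof. by rewrite Im_cexp normrM ger0_norm ?expR_ge0// ler_piMr ?expR_ge0 ?sin_max. Qed.

Lemma Re_K0_integrable : mu.-integrable `]0%R, +oo[ (EFin \o (fun l => Re (K0 l))).
Proof. by apply: integrable_K0 => [|l l0]; [exact: Re_cexp_le|case: (K0_cont l0)]. Qed.

Lemma cintegral_kernel :
  cintegral integrand = (2 * \int[mu]_(l in `]0%R, +oo[) Re (K0 l))%:C.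
Proof.
have iR := Re_K0_integrable.
have iI : mu.-integrable `]0%R, +oo[ (EFin \o (fun l => Im (K0 l))).
  by apply: integrable_K0 => [|l l0]; [exact: Im_cexp_le|case: (K0_cont l0)].
have E l : l \in (`]0%R, +oo[%classic : set R) -> integrand l = K0 l.
  by rewrite inE/= in_itv/= andbT => l0; rewrite kernel_integrandE.
rewrite /cintegral Rintegral_even; last first.
- exact: Re_integrandN.
- apply: eq_integrable iR => // l lp.
  exact: (esym (congr1 (fun z => (Re z)%:E) (E l lp))).
rewrite Rintegral_odd; last first.
- exact: Im_integrandN.
- apply: eq_integrable iI => // l lp.
  exact: (esym (congr1 (fun z => (Im z)%:E) (E l lp))).
congr ((_ * _)%:C).
by apply: eq_Rintegral => l lp; exact: (congr1 Re (E l lp)).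
Qed.

End kernel_formula.

(** * Kernel bounds from the real axis and from the slanted contour *)

Section kernel_bounds.
Local Open Scope classical_set_scope.
Local Open Scope complex_scope.
Context {R : realType} {n : nat}.
Variables (t : R) (x xi : 'rV[R]_n).
Hypotheses (n0 : (0 < n)%N) (t0 : 0 < t).
Local Notation Re := (@complex.Re R).
Local Notation Im := (@complex.Im R).
Let mu := @lebesgue_measure R.
Let nu : R := n%:R / 2.
Let k : R := (4 * t)^-1.
Let A : R := enorm (x + xi) ^+ 2 / 2.
Let B : R := enorm (x - xi) ^+ 2 / 2.
Let Psi (u : R) := (kernel_exponent nu k A B u).
Let I (u : R) := \int[mu]_(l in `]0%R, +oo[) Re (cexp (Psi u (l +i* 0))).
Let front : R := (4 * pi * t) `^ (- (n%:R / 2) - 1).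

Let kernelE (u : R) : grushin_kernel t x xi u = (front * (2 * I u))%:C.
Proof.
rewrite /grushin_kernel.
have := cintegral_kernel x xi u n0 t0; rewrite /cintegral => ->.
by rewrite [RHS]rmorphM.
Qed.

Let norm_kernel (u : R) : `|grushin_kernel t x xi u| = (front * (2 * `|I u|))%:C.
Proof.
rewrite kernelE normc_def /= expr0n addr0 sqrtr_sqr !normrM ger0_norm ?powR_ge0//.
by rewrite (ger0_norm (_ : 0 <= 2)).
Qed.

Lemma grushin_kernelN (u : R) : grushin_kernel t x xi (- u) = grushin_kernel t x xi u.
Proof.
rewrite !kernelE; congr ((_ * (_ * _))%:C); apply: eq_Rintegral => l lI.
have l0 : 0 < l by move: lI; rewrite inE/= in_itv/= andbT.
rewrite !Re_cexp /Psi !Re_kernel_exponent// !Im_kernel_exponent//.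
rewrite !(mul0r, mulr0, sin0, addr0, subr0, oppr0, atan0, add0r, sub0r).
by rewrite !(mulrN, mulNr, opprK) cosN.
Qed.

Lemma kernel_bound_real (u : R) :
  `|grushin_kernel t x xi u| <=
  (front * (8 * bound_const nu * expR (- (k * enorm (x - xi) ^+ 2))))%:C.
Proof.
rewrite norm_kernel lecR ler_wpM2l ?powR_ge0//.
suff : `|I u| <= 4 * bound_const nu * expR (- (k * enorm (x - xi) ^+ 2)) by lra.
have D : measurable (`]0%R, +oo[ : set (measurableTypeR R)) by exact: measurable_itv.
have E : enorm (x - xi) ^+ 2 = 2 * B by rewrite /B; field.
rewrite E.
have iK := @Re_K0_integrable R n t x xi u n0 t0.
pose C := expR (- (k * (2 * B))) * bound_const nu.
have ig : mu.-integrable `]0%R, +oo[ (EFin \o (fun l => C * expR (- (4^-1 * l)))).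
  rewrite (_ : _ \o _ = (fun l => C%:E * (expR (- (4^-1 * l)))%:E)%E)//.
  by apply: integrableZl => //; apply: integrable_expN; rewrite invr_gt0.
apply: (le_trans (le_normr_Rintegral D iK)).
apply: (le_trans (le_Rintegral D (integrable_norm iK) ig _)).
  move=> l lI; have l0 : 0 < l by move: lI; rewrite /= in_itv/= andbT.
  have := Re_kernel_real_le x xi u n0 t0 l0.
  by rewrite -/nu -/k -/A -/B mulrA -/C; exact: (le_trans (Re_cexp_le (Psi u (l +i* 0)))).
rewrite RintegralZl//; last by apply: integrable_expN; rewrite invr_gt0.
rewrite Rintegral_expN ?invr_gt0// invrK /C; lra.
Qed.

(** By parity the kernel contains the half-line integral twice, so 1040 = 2 * 520. *)
Lemma kernel_bound_saddle (u r : R) (alpha := Num.max (nu - 1) 0) : 0 <= u -> 0 < r < pi / 2 ->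
  A * saddleT r + B * saddleS r <= 4 * u ->
  1 / 2 <= cos r \/ 1 <= k * (4 * u - B * saddleS r) * cos r ->
  `|grushin_kernel t x xi u| <=
  (front * (1040 * bound_const nu * expR (- (k * saddle_value A B u r)) * (cos r)^-1 `^ alpha))%:C.
Proof.
move=> u0 r_itv sd hr.
rewrite norm_kernel lecR ler_wpM2l ?powR_ge0//.
have nu_ge : 1 / 2 <= nu by rewrite /nu ler_pM2r ?invr_gt0// ler1n.
have k0 : 0 < k by rewrite invr_gt0 mulr_gt0.
have A0 : 0 <= A by rewrite divr_ge0 ?sqr_ge0.
have B0 : 0 <= B by rewrite divr_ge0 ?sqr_ge0.
have bd := contour_integral_bound nu_ge k0 A0 B0 u0 r_itv sd hr.
rewrite (contour_shift nu_ge (ltW k0) A0 B0 u0 r_itv) in bd.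
suff -> : I u = \int[mu]_(l in `]0%R, +oo[)
  contour_integrand nu k A B u (fun l : R => 2 * r + ramp l) ramp' 0 l by lra.
apply: eq_Rintegral => l _; rewrite /contour_integrand /contour !mul0r.
by rewrite [in RHS]Re_mul [Re (1 +i* 0)]/= [Im (1 +i* 0)]/= mulr1 mulr0 subr0.
Qed.

End kernel_bounds.

(** * Upper bounds on the distance *)

Section length_bound.
Local Open Scope classical_set_scope.
Context {R : realType}.

(* Neither function is assumed measurable: the integral of a nonnegative
   function is a supremum over simple functions below it. *)
Lemma ge0_integral_mono d (T : measurableType d) (mu : {measure set T -> \bar R})
    (D : set T) (f1 f2 : T -> \bar R) :
  (forall x, D x -> 0 <= f1 x)%E -> (forall x, D x -> f1 x <= f2 x)%E ->
  (\int[mu]_(x in D) f1 x <= \int[mu]_(x in D) f2 x)%E.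
Proof.
move=> f10 f12; rewrite (integral_mkcond D f1) (integral_mkcond D f2).
have h10 x : (0 <= (f1 \_ D) x)%E by apply: erestrict_ge0.
have h20 x : (0 <= (f2 \_ D) x)%E.
  by apply: erestrict_ge0 => // t /[dup] Dt /f12; apply: le_trans; exact: f10.
rewrite !ge0_integralTE//; apply: ereal_sup_le => _ [h hf <-]; exists h => // x.
by apply: (le_trans (hf x)); exact: lee_restrict.
Qed.

Lemma lipschitz_abs_continuous01 (V : normedModType R) (g : R -> V) (K : R) : 0 <= K ->
  (forall s s', 0 <= s -> s <= s' -> s' <= 1 -> `|g s' - g s| <= K * (s' - s)) ->
  abs_continuous01 g.
Proof.
move=> K0 gK e e0; exists (e / (K + 1)); first by rewrite divr_gt0//; lra.
move=> m a b ab _ lt_d.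
apply: (@le_lt_trans _ _ (\sum_(i < m) K * (b i - a i))).
  by apply: ler_sum => i _; have [a0 aib b1] := ab i; apply: gK.
rewrite -mulr_sumr; move: lt_d; rewrite ltr_pdivlMr; last by lra.
have : 0 <= \sum_(i < m) (b i - a i).
  by apply: sumr_ge0 => i _; have [_ aib _] := ab i; rewrite subr_ge0.
set S := \sum_(i < m) _; nra.
Qed.

Variable n : nat.
Implicit Types (p q : grushin_space R n).

Lemma cc_norm_le p v (a b : 'rV[R]_n) (L : R) : 0 <= L -> v = frame_comb p a b ->
  dotv a a + dotv b b <= L ^+ 2 -> (cc_norm p v <= L%:E)%E.
Proof.
move=> L0 vE le_L; rewrite /cc_norm.
have -> : L%:E = sqrte ((L ^+ 2)%:E) by rewrite /= sqrtr_sqr ger0_norm.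
rewrite lee_sqrt; last by rewrite lee_fin sqr_ge0.
apply: (@le_trans _ _ (dotv a a + dotv b b)%:E); last by rewrite lee_fin.
apply: ereal_inf_lbound; exists a, b; split => //; congr EFin.
by rewrite /dotv -big_split /=; apply: eq_bigr => j _; rewrite !expr2.
Qed.

(** The curve is differentiable on the whole line, so the two-sided derivative exists at the
    endpoints of [0, 1] too; a speed at most L over unit time gives length at most L. *)
Lemma cc_edist_le (g : R -> grushin_space R n) (a b : R -> 'rV[R]_n) (K L : R) :
  0 <= K -> 0 <= L ->
  (forall s s', 0 <= s -> s <= s' -> s' <= 1 -> `|g s' - g s| <= K * (s' - s)) ->
  (forall s : R, h^-1 *: (g (h + s) - g s) @[h --> 0^'] --> frame_comb (g s) (a s) (b s)) ->
  (forall s, dotv (a s) (a s) + dotv (b s) (b s) <= L ^+ 2) ->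
  (cc_edist (g 0%R) (g 1%R) <= L%:E)%E.
Proof.
move=> K0 L0 gK dg ab.
have d1 s : derive1 g s = frame_comb (g s) (a s) (b s).
  by apply/cvg_lim => //; exact: dg.
have dr s : derivable g s 1.
  apply/cvg_ex; exists (frame_comb (g s) (a s) (b s)).
  by under eq_fun do rewrite scaler1; exact: dg.
apply: (@le_trans _ _ (cc_length g)).
  apply: ereal_inf_lbound; exists g => //; split => //; split.
    exact: lipschitz_abs_continuous01 gK.
  by apply: aeW => s _; split => //; rewrite d1; exists (a s), (b s).
rewrite /cc_length.
apply: (@le_trans _ _ (\int[@lebesgue_measure R]_(s in `[0%R, 1%R]) L%:E)%E).
  apply: ge0_integral_mono => s _; first exact: sqrte_ge0.
  by apply: cc_norm_le (ab s) => //; rewrite d1.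
by rewrite integral_cst//= lebesgue_measure_itv/= lte01 sube0 mule1.
Qed.

Lemma d_CC_le p q (L : R) : (cc_edist p q <= L%:E)%E -> 0 <= d_CC p q <= L.
Proof.
move=> le_L.
have d0 : (0 <= cc_edist p q)%E.
  apply: le_ereal_inf_tmp => _ [g _ <-]; apply: integral_ge0 => s _; exact: sqrte_ge0.
rewrite /d_CC; apply/andP; split; first exact: fine_ge0.
by move: d0 le_L; case: (cc_edist p q) => //= r _; rewrite lee_fin.
Qed.

Lemma frame_combE p (a b : 'rV[R]_n) : frame_comb p a b = (a, dotv b p.1).
Proof.
rewrite [LHS]surjective_pairing /frame_comb /Xvec /Uvec; congr pair.
  rewrite (big_morph fst (id1 := 0) (op1 := +%R))//=.
  rewrite [RHS]row_sum_delta; apply: eq_bigr => j _ /=.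
  by rewrite scaler0 addr0.
rewrite (big_morph snd (id1 := 0) (op1 := +%R))//=.
by rewrite /dotv; apply: eq_bigr => j _ /=; rewrite scaler0 add0r.
Qed.

Lemma dotv_comb (c1 c2 : R) (A B : 'rV[R]_n) : dotv (c1 *: A + c2 *: B) (c1 *: A + c2 *: B) =
  c1 ^+ 2 * dotv A A + c2 ^+ 2 * dotv B B + 2 * c1 * c2 * dotv A B.
Proof.
rewrite /dotv !mulr_sumr -!big_split /=; apply: eq_bigr => j _; rewrite !mxE; ring.
Qed.

Lemma dotvZl (c : R) (A B : 'rV[R]_n) : dotv (c *: A) B = c * dotv A B.
Proof. by rewrite /dotv mulr_sumr; apply: eq_bigr => j _; rewrite !mxE mulrA. Qed.

Lemma dotvC (A B : 'rV[R]_n) : dotv A B = dotv B A.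
Proof. by rewrite /dotv; apply: eq_bigr => j _; rewrite mulrC. Qed.

Lemma is_derive_quotient (f : R -> R) (s d : R) : is_derive s 1 f d ->
  h^-1 * (f (h + s) - f s) @[h --> 0^'] --> d.
Proof.
move=> [df <-]; rewrite -derive1E /derive1.
by move/cvg_ex: df => [l]; under eq_fun do rewrite scaler1; move=> /[dup] H /cvg_lim ->.
Qed.

Lemma lipschitz_of_derive (f f' : R -> R) (c : R) : (forall s : R, is_derive s 1 f (f' s)) ->
  (forall s, `|f' s| <= c) -> forall s s', s <= s' -> `|f s' - f s| <= c * (s' - s).
Proof.
move=> df fc s s' ss.
have [] := @MVT_segment _ f f' s s' ss.
- by apply: derivable_within_continuous => z _; case: (df z).
move=> z _ ->; rewrite normrM [`|s' - s|]ger0_norm ?subr_ge0//.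
by rewrite ler_wpM2r ?subr_ge0.
Qed.

(** Geodesics of G conserve the momentum w dual to u, and along them U' = w |X|^2: such a curve is
    horizontal with coefficients alpha = X' and beta = w X. *)
Lemma planar_curve_edist_le (A B : 'rV[R]_n) (f1 f2 U f1' f2' U' : R -> R) (w c L : R)
    (X := fun s => f1 s *: A + f2 s *: B) :
  (forall s : R, is_derive s 1 f1 (f1' s)) -> (forall s : R, is_derive s 1 f2 (f2' s)) ->
  (forall s : R, is_derive s 1 U (U' s)) ->
  (forall s, [/\ `|f1' s| <= c, `|f2' s| <= c & `|U' s| <= c]) ->
  (forall s, U' s = w * dotv (X s) (X s)) -> 0 <= L ->
  (forall s, dotv (f1' s *: A + f2' s *: B) (f1' s *: A + f2' s *: B) + w ^+ 2 * dotv (X s) (X s) <= L ^+ 2) ->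
  (cc_edist (X 0%R, U 0%R) (X 1%R, U 1%R) <= L%:E)%E.
Proof.
move=> d1 d2 dU bd UE L0 speed.
pose g s : grushin_space R n := (X s, U s).
have c0 : 0 <= c by have [h _ _] := bd 0; rewrite (le_trans _ h).
apply: (@cc_edist_le g (fun s => f1' s *: A + f2' s *: B) (fun s => w *: X s)
   (c * `|A| + c * `|B| + c) L) => //.
- by rewrite !addr_ge0 ?mulr_ge0.
- move=> s s' _ ss _.
  have l1 := lipschitz_of_derive d1 (fun s => let: And3 h _ _ := bd s in h) ss.
  have l2 := lipschitz_of_derive d2 (fun s => let: And3 _ h _ := bd s in h) ss.
  have lU := lipschitz_of_derive dU (fun s => let: And3 _ _ h := bd s in h) ss.
  have n1 : `|X s' - X s| <= c * (s' - s) * `|A| + c * (s' - s) * `|B|.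
    have -> : X s' - X s = (f1 s' - f1 s) *: A + (f2 s' - f2 s) *: B.
      by rewrite /X !scalerBl opprD addrACA.
    apply: (le_trans (ler_normD _ _)); rewrite !normrZ.
    by apply: lerD; apply: ler_wpM2r.
  have a0 : 0 <= c * (s' - s) by rewrite mulr_ge0 ?subr_ge0.
  have a1 := mulr_ge0 a0 (normr_ge0 A); have a2 := mulr_ge0 a0 (normr_ge0 B).
  by rewrite prod_normE ge_max /=; apply/andP; split; lra.
- move=> s; rewrite frame_combE dotvZl -UE.
  have hX : h^-1 *: (X (h + s) - X s) @[h --> 0^'] --> f1' s *: A + f2' s *: B.
    have -> : (fun h => h^-1 *: (X (h + s) - X s)) =
      (fun h => (h^-1 * (f1 (h + s) - f1 s)) *: A + (h^-1 * (f2 (h + s) - f2 s)) *: B).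
      apply/funext => h.
      by rewrite /X -!scalerA -scalerDr !scalerBl opprD addrACA.
    by apply: cvgD; apply: cvgZr_tmp; exact: is_derive_quotient.
  exact: (cvg_pair hX (is_derive_quotient (dU s))).
- by move=> s; rewrite dotvZl dotvC dotvZl mulrA -expr2.
Qed.

Lemma line_edist_le (x xi : 'rV[R]_n) : (cc_edist ((x, 0%R) : grushin_space R n) (xi, 0%R) <= (enorm (x - xi))%:E)%E.
Proof.
have := @planar_curve_edist_le x xi (fun s => 1 - s) id (fun=> 0) (fun=> -1) (fun=> 1) (fun=> 0) 0 1 (enorm (x - xi)).
rewrite /= subr0 subrr !scale1r !scale0r addr0 add0r; apply.
- by move=> s; drv_eq; ring.
- by move=> s; rewrite normrN1 normr1 normr0.
- by move=> s; rewrite mul0r.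
- exact: enorm_ge0.
- move=> s; rewrite expr0n mul0r addr0 enorm_sqr scaleN1r addrC.
  by rewrite le_eqVlt -opprB /dotv; apply/orP; left; apply/eqP; apply: eq_bigr => j _; rewrite !mxE; ring.
Qed.

(* The curve is [cos (w (s - 1/2)) A + sin (w (s - 1/2)) B], of constant speed. *)
Lemma arc_edist_le (A B : 'rV[R]_n) (w u : R) :
  u = dotv A A * (w + sin w) / 2 + dotv B B * (w - sin w) / 2 ->
  (cc_edist (((cos (w / 2) *: A - sin (w / 2) *: B)%R, 0%R) : grushin_space R n)
            ((cos (w / 2) *: A + sin (w / 2) *: B)%R, u) <=
   (`|w| * Num.sqrt (dotv A A + dotv B B))%:E)%E.
Proof.
move=> uE.
pose psi s : R := w * (s - 1 / 2).
(* An antiderivative of w |X|^2. Its mixed term is even in psi, hence equal at psi = - w/2 and psi =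
   w/2, so A.B does not enter u. *)
pose V s : R := dotv A A * (w * s / 2 + sin (2 * psi s) / 4) +
   dotv B B * (w * s / 2 - sin (2 * psi s) / 4) - dotv A B * cos (2 * psi s) / 2.
pose U s := V s - V 0.
pose X s := cos (psi s) *: A + sin (psi s) *: B.
have c1 s := cos2Dsin2 (psi s).
have := @planar_curve_edist_le A B (fun s => cos (psi s)) (fun s => sin (psi s)) U
  (fun s => - w * sin (psi s)) (fun s => w * cos (psi s)) (fun s => w * dotv (X s) (X s)) w
  (`|w| * (1 + dotv A A + dotv B B + 2 * `|dotv A B|)) (`|w| * Num.sqrt (dotv A A + dotv B B)).
have AA := dotv_ge0 A; have BB := dotv_ge0 B.
have p0 : psi 0 = - (w / 2) by rewrite /psi; field.
have p1 : psi 1 = w / 2 by rewrite /psi; field.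
have U0 : U 0 = 0 by rewrite /U subrr.
have U1 : U 1 = u.
  rewrite /U /V p0 p1 uE mulrN sinN cosN.
  have -> : 2 * (w / 2) = w by field.
  by field.
have S0 := sqrtr_ge0 (dotv A A + dotv B B).
have AB := normr_ge0 (dotv A B).
have w0 := normr_ge0 w.
rewrite /= U0 U1 p0 p1 cosN sinN scaleNr; apply.
- by move=> s; rewrite /psi; drv_eq; ring.
- by move=> s; rewrite /psi; drv_eq; ring.
- move=> s; rewrite /U /V /X dotv_comb; rewrite /psi; drv_eq.
  rewrite -/(psi s) sin_double cos_double cos2sin2.
  by field.
- move=> s; have ns := sin_max (psi s); have nc := cos_max (psi s).
  have k1 : 1 <= 1 + dotv A A + dotv B B + 2 * `|dotv A B| by lra.
  have wk : `|w| <= `|w| * (1 + dotv A A + dotv B B + 2 * `|dotv A B|) by rewrite ler_peMr.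
  split.
  + by rewrite normrM normrN; apply: le_trans wk; rewrite ler_piMr.
  + by rewrite normrM; apply: le_trans wk; rewrite ler_piMr.
  rewrite normrM ler_wpM2l// /X dotv_comb.
  have h : cos (psi s) ^+ 2 <= 1 /\ sin (psi s) ^+ 2 <= 1.
    by have := c1 s; have := sqr_ge0 (cos (psi s)); have := sqr_ge0 (sin (psi s)); split; lra.
  apply: (le_trans (ler_normD _ _)).
  have q1 : `|cos (psi s) ^+ 2 * dotv A A + sin (psi s) ^+ 2 * dotv B B| <= dotv A A + dotv B B.
    rewrite ger0_norm; last by apply: addr_ge0; apply: mulr_ge0 => //; exact: sqr_ge0.
    by case: h => ? ?; apply: lerD; rewrite ler_piMl.
  have q2 : `|2 * cos (psi s) * sin (psi s) * dotv A B| <= 2 * `|dotv A B|.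
    rewrite !normrM (ger0_norm (_ : 0 <= 2))// ler_wpM2r// -mulrA ler_piMr//.
    by rewrite mulr_ile1.
  lra.
- by [].
- by rewrite mulr_ge0.
- move=> s; rewrite exprMn sqr_sqrtr ?addr_ge0// /X !dotv_comb.
  rewrite real_normK ?num_real// le_eqVlt; apply/orP; left; apply/eqP.
  transitivity (w ^+ 2 * ((cos (psi s) ^+ 2 + sin (psi s) ^+ 2) * (dotv A A + dotv B B))).
    by ring.
  by rewrite c1 mul1r.
Qed.

End length_bound.

(** * Critical points of V and the values taken there *)

Section saddle_point.
Local Open Scope classical_set_scope.
Context {R : realType}.
Variables (A B u : R).
Hypotheses (A0 : 0 <= A) (B0 : 0 <= B) (u0 : 0 < u).
Local Notation SV := (saddle_value A B u).

(** V' >= 0 at a small angle. If A > 0, T is unbounded near pi / 2 and V' becomes nonpositive; if A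
    = 0, the sign of V' at the end is decided by B S(pi/2) = B pi against 4 u. *)
Lemma saddle_point_exists :
  (exists2 r, 0 < r < pi / 2 & A * saddleT r + B * saddleS r = 4 * u) \/
  (A = 0 /\ B * pi <= 4 * u).
Proof.
have A0' := A0; have B0' := B0; have u0' := u0.
have p2 := @pihalf_lt2 R.
have p1 := @pihalf_ge1 R.
have [[AE Bu]|nAB] := pselect (A = 0 /\ B * pi <= 4 * u); [by right|left].
pose f r := A * saddleT r + B * saddleS r.
(* Small enough for 12 a (A + B) <= 4 u, given [saddleT_small] and [saddleS_small]. *)
pose a := Num.min (1 / 2) (u / (4 * (A + B) + 1)).
have D0 : 0 < 4 * (A + B) + 1 by lra.
have a0 : 0 < a by rewrite lt_min !divr_gt0.
have a1 : a <= 1 / 2 by rewrite ge_min lexx.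
have a2 : a * (4 * (A + B) + 1) <= u by rewrite -ler_pdivlMr// ge_min lexx orbT.
have fa : f a <= 4 * u.
  have aI : 0 < a <= 1 / 2 by rewrite a0.
  have := ler_wpM2l A0 (saddleT_small aI); have := ler_wpM2l B0 (saddleS_small aI).
  rewrite /f; lra.
have root (b : R) : a <= b -> b < pi / 2 -> 4 * u <= f b ->
    exists2 r, 0 < r < pi / 2 & f r = 4 * u.
  move=> ab bp fb.
  have cf : {within `[a, b], continuous f}.
    apply: continuous_in_subspaceT => r; rewrite inE/= in_itv/= => /andP[? ?].
    have c0 : 0 < cos r by rewrite cos_gt0_pihalf//; apply/andP; split; lra.
    apply: cvgD; apply: cvgM; try exact: cvg_cst.
      by apply: continuous_saddleT; rewrite gt_eqF.
    by apply: continuous_saddleS; apply/andP; split; lra.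
  have [] := IVT (v := 4 * u) ab cf; first by rewrite ge_min le_max fa fb orbT.
  move=> r; rewrite in_itv/= => /andP[? ?] fr; exists r => //.
  by apply/andP; split; lra.
have [AE|An0] := eqVneq A 0.
  have Bu : 4 * u < B * pi by rewrite ltNge; apply/negP => ?; apply: nAB.
  have cf : {within `[a, pi / 2], continuous f}.
    apply: continuous_in_subspaceT => r; rewrite inE/= in_itv/= => /andP[? ?].
    rewrite (_ : f = (fun r => B * saddleS r)); last by apply/funext => y; rewrite /f AE mul0r add0r.
    apply: cvgM; first exact: cvg_cst.
    by apply: continuous_saddleS; apply/andP; split; lra.
  have ap : a <= pi / 2 by lra.
  have fp : f (pi / 2) = B * pi by rewrite /f AE mul0r add0r saddleS_pihalf.
  have [] := IVT (v := 4 * u) ap cf; first by rewrite ge_min le_max fa fp (ltW Bu) orbT.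
  move=> r; rewrite in_itv/= => /andP[ar rp] fr; exists r => //.
  apply/andP; split; first by lra.
  rewrite lt_neqAle rp andbT; apply/eqP => rE.
  by move: fr; rewrite rE fp; lra.
have Ap : 0 < A by rewrite lt_neqAle eq_sym An0.
(* The cosine of the right end b, chosen with 2 A / m >= 4 u; since b >= 1, A T(b) already exceeds
   this. *)
pose m := Num.min (1 / 2) (A / (2 * u + A)).
have m0 : 0 < m by rewrite lt_min !divr_gt0//; lra.
have m1 : m <= 1 / 2 by rewrite ge_min lexx.
have m2 : m * (2 * u + A) <= A by rewrite -ler_pdivlMr; [rewrite ge_min lexx orbT|lra].
pose b := acos m.
have mI : -1 <= m <= 1 by apply/andP; split; lra.
have cb : cos b = m by apply: acosK; rewrite in_itv.
have b0 : 0 <= b by exact: acos_ge0.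
have b1 : 1 <= b.
  have := cos_ge2 b0; rewrite cb; nra.
have bp : b < pi / 2.
  have bpi : b <= pi by exact: acos_lepi.
  have := @ltr_cos R b (pi / 2); rewrite !in_itv/= => <-.
  - by rewrite cos_pihalf cb.
  - by rewrite b0.
  - by apply/andP; split; lra.
apply: (root b) => //; first by lra.
have sb : 0 <= sin b by have := @sin_ge_third R b; lra.
have : A * 2 / m <= A * saddleT b.
  rewrite -mulrA ler_wpM2l// /saddleT cb ler_pdivlMr; last by rewrite exprn_gt0.
  have -> : 2 / m * m ^+ 2 = 2 * m by field; rewrite gt_eqF.
  have := mulr_ge0 sb (ltW m0); lra.
have : 4 * u <= A * 2 / m by rewrite ler_pdivlMr//; nra.
have : 0 <= B * saddleS b by rewrite mulr_ge0// saddleS_ge0.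
rewrite /f; lra.
Qed.

(* The second case is the cut locus: for [x + xi = 0] and large [u] there is no
   critical point in (0, pi/2), and [pi/2] takes its place. *)
Definition is_saddle (r : R) := (r < pi / 2 /\ A * saddleT r + B * saddleS r = 4 * u) \/
  [/\ r = pi / 2, A = 0 & B * pi <= 4 * u].

(** [r0] determines the length of the curve, [r] the contour. The last clause prepares the bound of
    1 / cos r by the weight; it follows from 1 <= k (4 u - B S) cos r <= 4 k u cos r. *)
Lemma saddle_select (k : R) : 0 < k ->
  exists r0 r, [/\ 0 < r0 <= pi / 2, is_saddle r0, 0 < r < pi / 2, r <= r0 &
   [/\ A * saddleT r + B * saddleS r <= 4 * u,
       1 / 2 <= cos r \/ 1 <= k * (4 * u - B * saddleS r) * cos r,
       SV r0 <= SV r + 3 / k &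
       (cos r)^-1 <= 2 \/ (cos r)^-1 <= 4 * k * u /\ 1 <= r0]].
Proof.
have A0' := A0; have B0' := B0; have u0' := u0.
move=> k0; have p2 := @pihalf_lt2 R; have p1 := @pihalf_ge1 R.
have [r0 r0p sr0] : exists2 r0, 0 < r0 <= pi / 2 & is_saddle r0.
  have [[r /andP[rp rlt] E]|[AE Bu]] := saddle_point_exists.
    by exists r; [rewrite rp ltW|left].
  by exists (pi / 2); [apply/andP; split; lra|right].
have [r00 r0le] := andP r0p.
have sd r : 0 < r -> r <= r0 -> r < pi / 2 -> A * saddleT r + B * saddleS r <= 4 * u.
  move=> rp rr rlt; case: sr0 => [[lt0 E]|[rE AE Bu]].
    rewrite -E lerD// ler_wpM2l//.
      by apply: saddleT_nondecr => //; exact: ltW.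
    by apply: saddleS_nondecr => //; lra.
  rewrite AE mul0r add0r; apply: le_trans Bu; rewrite -saddleS_pihalf ler_wpM2l//.
  by apply: saddleS_nondecr => //; lra.
have hA : A = 0 \/ r0 < pi / 2 by case: sr0 => [[? _]|[_ ? _]]; [right|left].
have c0 (r : R) : 0 < r < pi / 2 -> 0 < cos r.
  exact: cos_gt0_acute.
have inv2 (r : R) : 1 / 2 <= cos r -> (cos r)^-1 <= 2.
  move=> h; rewrite -[leRHS]invrK lef_pV2 ?posrE ?invr_gt0//; lra.
have k3 : 0 <= 3 / k by rewrite divr_ge0// ltW.
have inv4 (r : R) : 0 < r < pi / 2 -> 1 <= k * (4 * u - B * saddleS r) * cos r ->
    (cos r)^-1 <= 4 * k * u.
  move=> rp h; have cp := c0 r rp.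
  rewrite -[leLHS]mul1r ler_pdivrMr//.
  have S0 : 0 <= saddleS r by apply: saddleS_ge0; case/andP: rp => /ltW.
  have := mulr_ge0 (mulr_ge0 (ltW k0) (mulr_ge0 B0 S0)) (ltW cp); lra.
have r01 : cos r0 < 1 / 2 -> 1 <= r0 by have := cos_ge2 (ltW r00); nra.
have [h|h] := leP (1 / 2) (cos r0).
  have rp : 0 < r0 < pi / 2.
    rewrite r00 lt_neqAle r0le andbT; apply/eqP => rE.
    by move: h; rewrite rE cos_pihalf; lra.
  exists r0, r0; split => //; split; [|by left|lra|by left; exact: inv2].
  by case/andP: rp => ? ?; exact: sd.
have [h1|h1] := leP 1 (k * (4 * u - B * saddleS r0) * cos r0).
  have rp : 0 < r0 < pi / 2.
    rewrite r00 lt_neqAle r0le andbT; apply/eqP => rE.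
    by move: h1; rewrite rE cos_pihalf mulr0; lra.
  exists r0, r0; split => //; split; [|by right|lra|by right; split; [exact: inv4|exact: r01]].
  by case/andP: rp => ? ?; exact: sd.
have [r [rp rr hr loss]] := saddle_descent A0 B0 k0 r0p hA sd h h1.
exists r0, r; split => //; split => //.
- by case/andP: rp => ? ?; exact: sd.
- by case: hr => [->|<-]; [left|right].
- case: hr => E; first by left; apply: inv2; rewrite -E.
  by right; split; [apply: inv4 => //; rewrite -E|exact: r01].
Qed.

(** Eliminating u through V' = 0 leaves a sum of squares, the squared speed of the arc. *)
Lemma saddle_value_interior (r : R) : 0 < r < pi / 2 -> A * saddleT r + B * saddleS r = 4 * u ->
  SV r = 2 * r ^+ 2 * (A / cos r ^+ 2 + B / sin r ^+ 2).
Proof.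
move=> rp E; have p2 := @pihalf_lt2 R; case/andP: rp => r0 rlt.
have c0 : cos r != 0 by rewrite gt_eqF// cos_gt0_acute// r0.
have s0 : sin r != 0 by rewrite gt_eqF//; have := @sin_ge_third R r; lra.
by rewrite /saddle_value -E /saddleT /saddleS; field; apply/andP.
Qed.

(** The quotient by cos (pi/2) = 0 is 0 by convention, which is the right value on the cut locus,
    where A = 0. *)
Lemma saddle_value_end : SV (pi / 2) = 2 * pi * u.
Proof. by rewrite /saddle_value cos_pihalf invr0 !(mulr0, mul0r) oppr0 !add0r; field. Qed.

(** One lower bound for each entry of the minimum: 2 u <= d0^2 serves d0^2 / (4 t), and 2 A /
    cos(r)^2 = (|x + xi| / cos r)^2 <= d0^2 serves d0 / |x + xi|. *)
Lemma saddle_value_ge (r : R) : 0 < r <= pi / 2 -> is_saddle r -> 0 <= SV r /\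
  (1 <= r -> 2 * u <= SV r /\ 2 * A / cos r ^+ 2 <= SV r).
Proof.
have A0' := A0; have B0' := B0; have u0' := u0.
move=> /andP[r0 rle] [[rlt E]|[-> AE Bu]].
  have rp : 0 < r < pi / 2 by rewrite r0.
  rewrite saddle_value_interior//.
  have p2 := @pihalf_lt2 R.
  have c0 : 0 < cos r by exact: cos_gt0_acute.
  have s0 : 0 < sin r by have := @sin_ge_third R r; lra.
  have a1 : 0 <= A / cos r ^+ 2 by rewrite divr_ge0 ?sqr_ge0.
  have a2 : 0 <= B / sin r ^+ 2 by rewrite divr_ge0 ?sqr_ge0.
  split; first by apply: mulr_ge0; [apply: mulr_ge0 => //; exact: sqr_ge0|exact: addr_ge0].
  move=> r1.
  have r2 : r <= r ^+ 2 by nra.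
  set X := A / _ in a1 *; set Y := B / _ in a2 *.
  split; last first.
    rewrite -mulrA -/X.
    have : 0 <= (r ^+ 2 - 1) * X by rewrite mulr_ge0//; nra.
    have : 0 <= r ^+ 2 * Y by rewrite mulr_ge0 ?sqr_ge0.
    lra.
  have sc := sin_mul_cos_le (ltW r0); have sc0 := mulr_ge0 (ltW s0) (ltW c0).
  have EX : A * saddleT r <= 4 * r * X.
    rewrite (_ : A * saddleT r = 2 * (r + sin r * cos r) * X); last by rewrite /saddleT /X; ring.
    by rewrite ler_wpM2r//; lra.
  have EY : B * saddleS r <= 4 * r * Y.
    rewrite (_ : B * saddleS r = 2 * (r - sin r * cos r) * Y); last by rewrite /saddleS /Y; ring.
    by rewrite ler_wpM2r//; lra.
  have : 4 * u <= 4 * r * (X + Y) by lra.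
  have : r * (X + Y) <= r ^+ 2 * (X + Y) by rewrite ler_wpM2r// addr_ge0.
  lra.
rewrite saddle_value_end AE mulr0 mul0r; have p1 := @pihalf_ge1 R.
have : 0 <= pi * u by rewrite mulr_ge0 ?pi_ge0// ltW.
have : 2 * u <= pi * u by rewrite ler_wpM2r ?(ltW u0)//; lra.
by move=> ? ?; split; [lra|move=> _; split; lra].
Qed.

End saddle_point.

(** * The curve whose squared length is the critical value *)

Section saddle_distance.
Context {R : realType} {n : nat}.
Variables (x xi : 'rV[R]_n) (u : R).
Hypotheses (n0 : (0 < n)%N) (u0 : 0 < u).
Let A : R := enorm (x + xi) ^+ 2 / 2.
Let B : R := enorm (x - xi) ^+ 2 / 2.

Lemma dotv_eq0 (v : 'rV[R]_n) : dotv v v = 0 -> v = 0.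
Proof.
move=> /eqP; rewrite /dotv psumr_eq0 => [/allP h|j _]; last by rewrite -expr2 sqr_ge0.
apply/rowP => j; have := h j; rewrite mem_index_enum => /(_ isT) /implyP /(_ isT).
by rewrite mulf_eq0 orbb mxE => /eqP.
Qed.

Lemma dotvB_sym : dotv (xi - x) (xi - x) = dotv (x - xi) (x - xi).
Proof. by rewrite /dotv; apply: eq_bigr => j _; rewrite !mxE; ring. Qed.

Lemma dotvZZ (c : R) (v : 'rV[R]_n) : dotv (c *: v) (c *: v) = c ^+ 2 * dotv v v.
Proof. by rewrite dotvZl dotvC dotvZl mulrA expr2. Qed.

(** The arc cos psi V1 + sin psi V2, |psi| <= r, joins x to xi once cos r V1 and sin r V2 are half
    the sum and half the difference of the endpoints, up to sign. Its rise equals u exactly when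
    V'(r) = 0. [e] is the sign of the vertical coordinate. *)
Lemma edist_saddle_le (e r : R) : e = 1 \/ e = - 1 -> 0 < r <= pi / 2 -> is_saddle A B u r ->
  (cc_edist ((x, 0%R) : grushin_space R n) (xi, (e * u)%R) <=
   (Num.sqrt (saddle_value A B u r))%:E)%E.
Proof.
move=> eE /andP[r0 rle]; have p2 := @pihalf_lt2 R; have p1 := @pihalf_ge1 R.
have ee : e * e = 1 by case: eE => ->; rewrite ?mulr1 ?mulrNN ?mulr1.
have ne : `|e| = 1 by case: eE => ->; rewrite ?normrN1 ?normr1.
have se (y : R) : sin (e * y) = e * sin y by case: eE => ->; rewrite ?mul1r ?mulN1r ?sinN.
have ce (y : R) : cos (e * y) = cos y by case: eE => ->; rewrite ?mul1r ?mulN1r ?cosN.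
have AE : dotv (x + xi) (x + xi) = 2 * A by rewrite /A enorm_sqr; field.
have BE : dotv (xi - x) (xi - x) = 2 * B by rewrite dotvB_sym /B enorm_sqr; field.
pose w := e * (2 * r).
have w2 : w / 2 = e * r by rewrite /w; field.
have absw : `|w| = 2 * r by rewrite /w normrM ne mul1r ger0_norm//; lra.
case=> [[rlt E]|[rE A0 Bu]].
  have rp : 0 < r < pi / 2 by rewrite r0.
  have c0 : 0 < cos r by exact: cos_gt0_acute.
  have s0 : 0 < sin r by have := @sin_ge_third R r; lra.
  pose V1 := (2 * cos r)^-1 *: (x + xi); pose V2 := (e / (2 * sin r)) *: (xi - x).
  have d1 : dotv V1 V1 = A / (2 * cos r ^+ 2).
    by rewrite dotvZZ AE; field; rewrite gt_eqF.
  have d2 : dotv V2 V2 = B / (2 * sin r ^+ 2).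
    rewrite dotvZZ BE expr_div_n (expr2 e) ee; by field; rewrite gt_eqF.
  have uE : e * u = dotv V1 V1 * (w + sin w) / 2 + dotv V2 V2 * (w - sin w) / 2.
    rewrite d1 d2 /w se sin_double.
    have -> : u = (A * saddleT r + B * saddleS r) / 4 by rewrite E; field.
    by rewrite /saddleT /saddleS; field; rewrite !gt_eqF.
  have := arc_edist_le uE; rewrite w2 ce se.
  have h1 : cos r *: V1 = (1 / 2) *: (x + xi).
    by rewrite /V1 scalerA; congr (_ *: _); field; rewrite gt_eqF.
  have h2 : (e * sin r) *: V2 = (1 / 2) *: (xi - x).
    rewrite /V2 scalerA; congr (_ *: _).
    have -> : e * sin r * (e / (2 * sin r)) = (e * e) * (sin r / (2 * sin r)) by ring.
    by rewrite ee; field; rewrite gt_eqF.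
  rewrite h1 h2.
  have -> : (1 / 2) *: (x + xi) - (1 / 2) *: (xi - x) = x.
    by apply/rowP => j; rewrite !mxE; field.
  have -> : (1 / 2) *: (x + xi) + (1 / 2) *: (xi - x) = xi.
    by apply/rowP => j; rewrite !mxE; field.
  rewrite absw d1 d2 saddle_value_interior//.
  suff -> : 2 * r * Num.sqrt (A / (2 * cos r ^+ 2) + B / (2 * sin r ^+ 2)) =
    Num.sqrt (2 * r ^+ 2 * (A / cos r ^+ 2 + B / sin r ^+ 2)) by [].
  have -> : 2 * r ^+ 2 * (A / cos r ^+ 2 + B / sin r ^+ 2) =
     (2 * r) ^+ 2 * (A / (2 * cos r ^+ 2) + B / (2 * sin r ^+ 2)).
    by field; rewrite !gt_eqF.
  by rewrite sqrtrM ?sqr_ge0// sqrtr_sqr ger0_norm//; lra.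
have pi0 := @pi_gt0 R.
have xx : x + xi = 0 by apply: dotv_eq0; rewrite AE A0 mulr0.
have q0 : 0 <= 2 * u / pi - B / 2.
  rewrite subr_ge0 ler_pdivlMr//; lra.
(* At angle pi / 2 the coefficient of [V1] vanishes at both ends, so its direction is free; n >= 1
   supplies one. Its length is dictated by the height u, and the square of that length is
   nonnegative by B pi <= 4 u. *)
pose V1 : 'rV[R]_n := Num.sqrt (2 * u / pi - B / 2) *: delta_mx 0 (Ordinal n0).
pose V2 := (e / 2) *: (xi - x).
have d1 : dotv V1 V1 = 2 * u / pi - B / 2.
  rewrite dotvZZ sqr_sqrtr// /dotv (bigD1 (Ordinal n0))//= big1 => [|j jn].
    by rewrite !mxE !eqxx /= mulr1 addr0 mulr1.
  by rewrite !mxE eqxx /= (negbTE jn) mulr0.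
have d2 : dotv V2 V2 = B / 2.
  by rewrite dotvZZ BE expr_div_n (expr2 e) ee; field.
have uE : e * u = dotv V1 V1 * (w + sin w) / 2 + dotv V2 V2 * (w - sin w) / 2.
  rewrite d1 d2 /w se rE.
  have -> : 2 * (pi / 2) = pi :> R by field.
  by rewrite sinpi; move: (pi) pi0 => p p0; field; rewrite gt_eqF.
have := arc_edist_le uE; rewrite w2 ce se rE cos_pihalf sin_pihalf scale0r mulr1.
have h2 : e *: V2 = (1 / 2) *: (xi - x).
  by rewrite /V2 scalerA mulrA ee.
rewrite h2 absw d1 d2 rE saddle_value_end.
have xE : x = - xi by apply/eqP; rewrite -addr_eq0 xx.
have -> : 0 - (1 / 2) *: (xi - x) = x.
  by rewrite xE; apply/rowP => j; rewrite !mxE; field.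
have -> : 0 + (1 / 2) *: (xi - x) = xi.
  by rewrite xE; apply/rowP => j; rewrite !mxE; field.
suff -> : 2 * (pi / 2) * Num.sqrt (2 * u / pi - B / 2 + B / 2) = Num.sqrt (2 * pi * u) by [].
have -> : 2 * pi * u = pi ^+ 2 * (2 * u / pi - B / 2 + B / 2) by move: (pi) pi0 => p p0; field; rewrite gt_eqF.
rewrite sqrtrM ?sqr_ge0// sqrtr_sqr ger0_norm ?(ltW pi0)//.
by congr (_ * _); field.
Qed.

End saddle_distance.

(** * Replacing the length of the curve by the distance *)

Section weight.
Local Open Scope classical_set_scope.
Context {R : realType}.
Variables (t a : R).
Hypotheses (t0 : 0 < t) (a0 : 0 < a).
Implicit Types d : R.

Let y d := d ^+ 2 / (4 * t).

Lemma oneD_le_exp (dl X : R) : 0 < dl <= 1 -> 0 <= X -> 1 + X <= dl^-1 * expR (dl * X).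
Proof.
move=> /andP[d0 d1] X0.
have h := expR_ge1Dx (dl * X).
rewrite mulrC ler_pdivlMr//.
apply: le_trans h; nra.
Qed.

(** 1 + y(d0) <= (1 + y(d)) (1 + y(d0) - y(d)), and an exponential of arbitrarily small rate absorbs
    the last factor. *)
Lemma weight_second (d d0 dl : R) : 0 <= d <= d0 -> 0 < dl <= 1 ->
  1 + y d0 <= 2 * dl^-1 * (1 + y d) * expR (dl * (y d0 - y d)).
Proof.
move=> /andP[dp dd] dlp.
have y0 : 0 <= y d by rewrite divr_ge0 ?sqr_ge0// mulr_ge0// ltW.
have yy : y d <= y d0.
  rewrite ler_pM2r ?invr_gt0 ?mulr_gt0// lerXn2r ?nnegrE//; exact: le_trans dd.
have X0 : 0 <= y d0 - y d by rewrite subr_ge0.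
have := oneD_le_exp dlp X0.
set E := dl^-1 * _ => h.
have -> : 2 * dl^-1 * (1 + y d) * expR (dl * (y d0 - y d)) = 2 * (1 + y d) * E.
  by rewrite /E; ring.
have h2 : (1 + y d) * (1 + (y d0 - y d)) <= (1 + y d) * E by rewrite ler_wpM2l//; lra.
have : 0 <= y d * (y d0 - y d) by rewrite mulr_ge0.
have : 0 <= (1 + y d) * E.
  by rewrite mulr_ge0//; lra.
lra.
Qed.

(** The hypothesis says that d / a is the smaller entry at d; for d > 0 it means 4 t <= a d. Then
    (d0 - d)^2 <= d0^2 - d^2 = 4 t X <= a d X, so d0 - d <= (a + d) (1 + X), and the exponential
    absorbs 1 + X. *)
Lemma weight_first (d d0 dl : R) : 0 <= d <= d0 -> 0 < dl <= 1 -> d / a <= y d ->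
  d = 0 \/ 1 + d0 / a <= 2 * dl^-1 * (1 + d / a) * expR (dl * (y d0 - y d)).
Proof.
move=> /andP[dp dd] dlp day; have [->|dn0] := eqVneq d 0; [by left|right].
have dgt : 0 < d by rewrite lt_neqAle eq_sym dn0.
have at0 := a0; have tt0 := t0.
have yy : y d <= y d0.
  rewrite ler_pM2r ?invr_gt0 ?mulr_gt0// lerXn2r ?nnegrE//; exact: le_trans dd.
set X := y d0 - y d; have X0 : 0 <= X by rewrite subr_ge0.
have ta : 4 * t <= d * a.
  move: day; rewrite /y ler_pdivrMr// mulrAC ler_pdivlMr ?mulr_gt0// expr2 -mulrA.
  by rewrite ler_pM2l.
have dX : d0 ^+ 2 - d ^+ 2 = 4 * t * X by rewrite /X /y; field; rewrite gt_eqF.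
have sq : (d0 - d) ^+ 2 <= ((a + d) * (1 + X)) ^+ 2.
  have : 4 * t * X <= d * a * X by rewrite ler_wpM2r.
  have : (d0 - d) ^+ 2 <= d0 ^+ 2 - d ^+ 2 by nra.
  have : d * a * X <= (a + d) ^+ 2 * (1 + X) ^+ 2.
    apply: ler_pM => //; first by rewrite mulr_ge0// ltW.
      nra.
    nra.
  rewrite exprMn; lra.
have le1 : d0 - d <= (a + d) * (1 + X).
  have p : 0 <= (a + d) * (1 + X) by rewrite mulr_ge0//; lra.
  by rewrite -ler_sqr ?nnegrE ?subr_ge0.
have h := oneD_le_exp dlp X0.
have : (a + d) * (1 + X) <= (a + d) * (dl^-1 * expR (dl * X)) by rewrite ler_wpM2l//; lra.
set E := dl^-1 * _ in h *; move=> h2.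
have -> : 2 * dl^-1 * (1 + d / a) * expR (dl * X) = 2 * (a + d) * E / a.
  by rewrite /E; field; rewrite !gt_eqF//; case/andP: dlp.
have -> : 1 + d0 / a = (a + d0) / a by field; rewrite gt_eqF.
rewrite ler_pM2r ?invr_gt0//.
nra.
Qed.

End weight.

Section distance_weight.
Context {R : realType}.
Variables (t a : R).
Hypotheses (t0 : 0 < t) (a0 : 0 <= a).

Definition distance_weight (d : R) : R :=
  if a == 0 then 1 + d ^+ 2 / (4 * t) else Num.min (1 + d / a) (1 + d ^+ 2 / (4 * t)).

Lemma distance_weight_ge1 (d : R) : 0 <= d -> 1 <= distance_weight d.
Proof.
move=> d0; have h : 1 <= 1 + d ^+ 2 / (4 * t).
  by rewrite lerDl divr_ge0 ?sqr_ge0// mulr_ge0// ltW.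
by rewrite /distance_weight; case: eqP => // _; rewrite le_min h andbT lerDl divr_ge0.
Qed.

Lemma distance_weight_le (dl d d0 : R) : 0 <= d <= d0 -> 0 < dl <= 1 ->
  distance_weight d0 <=
  2 * dl^-1 * distance_weight d * expR (dl * (d0 ^+ 2 / (4 * t) - d ^+ 2 / (4 * t))).
Proof.
move=> dd dlp; have h := weight_second t0 dd dlp.
rewrite /distance_weight; have [//|an0] := eqVneq a 0.
have ap : 0 < a by rewrite lt_neqAle eq_sym an0.
have h2 : Num.min (1 + d0 / a) (1 + d0 ^+ 2 / (4 * t)) <= 1 + d0 ^+ 2 / (4 * t).
  by rewrite ge_min lexx orbT.
have [lt1|_] := ltP (1 + d / a) (1 + d ^+ 2 / (4 * t)); last exact: le_trans h.
have le1 : d / a <= d ^+ 2 / (4 * t) by have := ltW lt1; rewrite lerD2l.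
have [dE|h1] := weight_first t0 ap dd dlp le1.
  by apply: le_trans h2 (le_trans h _); rewrite dE expr0n !mul0r.
by apply: le_trans h1; rewrite ge_min lexx.
Qed.

(** The rate 1 / (al + 1) is chosen so that the al-th power of the exponential loss is at most
    exp(X), which is the ratio of the two Gaussians. *)
Lemma weighted_gaussian_le (al d d0 : R) : 0 <= al -> 0 <= d <= d0 ->
  distance_weight d0 `^ al * expR (- ((4 * t)^-1 * d0 ^+ 2)) <=
  (2 * (al + 1)) `^ al * distance_weight d `^ al * expR (- (4 * t)^-1 * d ^+ 2).
Proof.
move=> al0 dd; pose dl := (al + 1)^-1.
have al1 : 0 < al + 1 by lra.
have dlp : 0 < dl <= 1.
  by rewrite /dl invr_gt0 al1/= invf_le1//; lra.
have := distance_weight_le dd dlp; rewrite {1}/dl invrK.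
have [d00 dle] := andP dd.
have m1 := distance_weight_ge1 d00; have m2 := distance_weight_ge1 (le_trans d00 dle).
set X := _ - _ => key.
have X0 : 0 <= X.
  rewrite subr_ge0 ler_pM2r ?invr_gt0 ?mulr_gt0// ler_sqr ?nnegrE//.
  exact: le_trans dle.
have : distance_weight d0 `^ al <=
    (2 * (al + 1) * distance_weight d * expR (dl * X)) `^ al.
  by apply: ge0_ler_powR => //; rewrite nnegrE ?mulr_ge0 ?expR_ge0//; lra.
rewrite powRM ?expR_ge0//; last by rewrite mulr_ge0//; lra.
rewrite powRM; [|lra|lra].
rewrite -expRM; set P := _ * distance_weight d `^ al => h.
have P0 : 0 <= P by rewrite mulr_ge0 ?powR_ge0.
apply: (le_trans (ler_wpM2r (expR_ge0 _) h)).
rewrite -mulrA -expRD ler_wpM2l// ler_expR.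
have -> : - (4 * t)^-1 * d ^+ 2 = X - (4 * t)^-1 * d0 ^+ 2 by rewrite /X; field; rewrite gt_eqF.
have dlal : dl * al <= 1 by rewrite /dl mulrC ler_pdivrMr//; lra.
have := ler_wpM2r X0 dlal; lra.
Qed.

(** The second entry comes from 1 / cos r <= 4 k u <= 2 k d0^2, the first from 1 / cos r <= 1 / cos
    r0 <= d0 / a. If a > 0 the cut locus is excluded, so cos r0 > 0. *)
Lemma inv_cos_le_weight (B u r0 r : R) (A := a ^+ 2 / 2) (d := Num.sqrt (saddle_value A B u r0)) :
  0 <= B -> 0 < u -> 0 < r0 <= pi / 2 -> is_saddle A B u r0 -> 0 < r < pi / 2 -> r <= r0 ->
  (cos r)^-1 <= 2 \/ (cos r)^-1 <= 4 * (4 * t)^-1 * u /\ 1 <= r0 ->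
  (cos r)^-1 <= 2 * distance_weight d.
Proof.
move=> B0 u0 r0p sr0 rp rr cr.
have A0 : 0 <= A by rewrite divr_ge0 ?sqr_ge0.
have [sv0 sv1] := saddle_value_ge A0 B0 u0 r0p sr0.
have d0 : 0 <= d by exact: sqrtr_ge0.
have dE : d ^+ 2 = saddle_value A B u r0 by rewrite sqr_sqrtr.
have k0 : 0 < (4 * t)^-1 by rewrite invr_gt0 mulr_gt0.
case: cr => [|[cr r01]].
  have := distance_weight_ge1 d0; lra.
have [s1 s2] := sv1 r01; rewrite -dE in s1 s2.
have c0 := cos_gt0_acute rp.
have snd : (cos r)^-1 <= 2 * (1 + d ^+ 2 / (4 * t)).
  apply: (le_trans cr); have := ler_wpM2l (ltW k0) s1; lra.
rewrite /distance_weight; have [//|an0] := eqVneq a 0.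
have ap : 0 < a by rewrite lt_neqAle eq_sym an0.
suff fst : (cos r)^-1 <= 2 * (1 + d / a).
  by have [_|_] := ltP (1 + d / a) (1 + d ^+ 2 / (4 * t)).
case: sr0 => [[r0lt _]|[_ A00 _]]; last first.
  have := divr_gt0 (exprn_gt0 2 ap) (ltr0n R 2); rewrite -/A A00 ltxx; by [].
have c00 : 0 < cos r0 by apply: cos_gt0_acute; rewrite r0lt andbT; case/andP: r0p.
have cc : (cos r)^-1 <= (cos r0)^-1.
  rewrite lef_pV2 ?posrE//; move: rr; rewrite le_eqVlt => /orP[/eqP->//|rr].
  case/andP: rp => ? ?.
  apply/ltW; have := @ltr_cos R r r0; rewrite !in_itv/= => -> //; apply/andP; split; lra.
have : (a / cos r0) ^+ 2 <= d ^+ 2.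
  by apply: le_trans s2; rewrite /A expr_div_n; lra.
rewrite ler_sqr ?nnegrE// ?divr_ge0 ?(ltW c00)// ler_pdivrMr//.
have -> : 2 * (1 + d / a) = 2 + 2 * (d / a) by ring.
move=> h; have : (cos r0)^-1 <= d / a by rewrite ler_pdivlMr// mulrC ler_pdivrMr.
have : 0 <= d / a by rewrite divr_ge0.
lra.
Qed.

End distance_weight.

(** * The kernel bound in terms of the length of the curve *)

Section kernel_bound.
Context {R : realType} {n : nat}.
Variables (t : R) (x xi : 'rV[R]_n).
Hypotheses (n0 : (0 < n)%N) (t0 : 0 < t).
Local Notation nu := (n%:R / 2 : R).
Local Notation alpha := (Num.max (nu - 1) 0 : R).
Local Notation a := (enorm (x + xi)).
Local Notation front := ((4 * pi * t) `^ (- nu - 1)).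
Local Notation C0 := (1040 * bound_const nu * expR 3 : R).

Lemma enorm_eq0 (v : 'rV[R]_n) : (enorm v == 0) = (v == 0).
Proof.
apply/eqP/eqP => [v0|->]; last by rewrite enorm0.
by apply: dotv_eq0; rewrite -enorm_sqr v0 expr0n.
Qed.

Lemma kernel_bound_saddle_distance (u : R) : exists2 d0 : R,
  (cc_edist ((x, 0%R) : grushin_space R n) (xi, u) <= d0%:E)%E &
  (`|grushin_kernel t x xi u| <= (front * (C0 * (2 * distance_weight t a d0) `^ alpha
     * expR (- ((4 * t)^-1 * d0 ^+ 2))))%:C%C).
Proof.
have combine (b c p e q E : R) : 0 <= b -> 0 <= c <= p -> 0 <= e -> e <= q * E ->
    b * e * c <= b * q * p * E.
  move=> b0 /andP[c0 cp] e0 eq; have := ler_wpM2l b0 (ler_pM e0 c0 eq cp); lra.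
have bc : 0 < bound_const nu by exact: expR_gt0.
have e3 : 1 <= expR 3 :> R by have := expR_ge1Dx (3 : R); lra.
have al0 : 0 <= alpha by rewrite le_max lexx orbT.
have a0 : 0 <= a by exact: enorm_ge0.
have k0 : 0 < (4 * t)^-1 by rewrite invr_gt0 mulr_gt0.
have mulk3 : (4 * t)^-1 * (3 / (4 * t)^-1) = 3.
  by rewrite mulrCA mulfV ?gt_eqF// mulr1.
(* At u = 0 the critical angle degenerates to 0: a straight segment and the unshifted contour take
   over. *)
have [->|u0] := eqVneq u 0.
  exists (enorm (x - xi)); first exact: line_edist_le.
  apply: le_trans (kernel_bound_real x xi n0 t0 0) _.
  rewrite lecR ler_wpM2l ?powR_ge0// ler_wpM2r ?expR_ge0//.
  have w1 := distance_weight_ge1 t0 a0 (enorm_ge0 (x - xi)).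
  have : 1 `^ alpha <= (2 * distance_weight t a (enorm (x - xi))) `^ alpha.
    by apply: ge0_ler_powR => //; rewrite ?nnegrE; lra.
  rewrite powR1; set p := _ `^ alpha => p1.
  have p3 : 1 * 1 <= expR 3 * p by rewrite ler_pM.
  have := ler_wpM2l (ltW bc) p3.
  lra.
pose A : R := a ^+ 2 / 2; pose B : R := enorm (x - xi) ^+ 2 / 2.
have A0 : 0 <= A by rewrite divr_ge0 ?sqr_ge0.
have B0 : 0 <= B by rewrite divr_ge0 ?sqr_ge0.
have [e eE [v v0 uE]] : exists2 e : R, e = 1 \/ e = -1 & exists2 v, 0 < v & u = e * v.
  have [up|un] := ltP 0 u; first by exists 1; [left|exists u => //; rewrite mul1r].
  exists (-1); first by right.
  by exists (- u); [rewrite oppr_gt0 lt_neqAle u0|rewrite mulN1r opprK].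
have KE : grushin_kernel t x xi u = grushin_kernel t x xi v.
  by rewrite uE; case: eE => ->; [rewrite mul1r|rewrite mulN1r grushin_kernelN].
have [r0 [r [r0p sr0 rp rr [sd hr loss cr]]]] := saddle_select A0 B0 v0 k0.
have [sv0 sv1] := saddle_value_ge A0 B0 v0 r0p sr0.
have c0 := cos_gt0_acute rp.
exists (Num.sqrt (saddle_value A B v r0)).
  by rewrite uE; exact: edist_saddle_le.
set d0 := Num.sqrt _; have d00 : 0 <= d0 by exact: sqrtr_ge0.
have dE : d0 ^+ 2 = saddle_value A B v r0 by rewrite sqr_sqrtr.
rewrite KE; apply: le_trans (kernel_bound_saddle n0 t0 (ltW v0) rp sd hr) _.
rewrite lecR; apply: ler_wpM2l; first exact: powR_ge0.
have w1 := distance_weight_ge1 t0 a0 d00.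
have cw : (cos r)^-1 <= 2 * distance_weight t a d0 
  by exact: (inv_cos_le_weight t0 a0 B0 v0 r0p sr0 rp rr cr).
(* The descent from [r0] to [r] loses at most 3 / k in V, hence the factor exp(3). *)
have ew : expR (- ((4 * t)^-1 * saddle_value A B v r)) <=
    expR 3 * expR (- ((4 * t)^-1 * d0 ^+ 2)).
  rewrite -expRD ler_expR dE.
  have := ler_wpM2l (ltW k0) loss; set s0 := saddle_value _ _ _ _; set s1 := saddle_value _ _ _ _.
  by rewrite (mulrDr _ s1) mulk3; lra.
have pw : (cos r)^-1 `^ alpha <= (2 * distance_weight t a d0) `^ alpha.
  apply: (ge0_ler_powR al0) cw; rewrite nnegrE; first by rewrite invr_ge0 ltW.
  exact: mulr_ge0 (ler0n R 2) (le_trans ler01 w1).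
have b0 : 0 <= 1040 * bound_const nu := mulr_ge0 (ler0n R 1040) (ltW bc).
have cp : 0 <= (cos r)^-1 `^ alpha <= (2 * distance_weight t a d0) `^ alpha.
  by rewrite powR_ge0.
exact: (combine _ _ _ _ _ _ b0 cp (expR_ge0 _) ew).
Qed.

End kernel_bound.

Theorem theorem4p1 (R : realType) (n : nat) (hn : (1 <= n)%N) :
  let alpha : R := Num.max (n%:R / 2 - 1) 0 in
  exists2 C : R, 0 < C &
    forall (x xi : 'rV[R]_n) (u t : R),
      let d : R := d_CC ((x, 0) : grushin_space R n) (xi, u) in
      let second : R := 1 + d ^+ 2 / (4 * t) in
      let m : R := if x + xi == 0 then second
                   else Num.min (1 + d / enorm (x + xi)) second in
      0 < t ->
      `|grushin_kernel t x xi u| <=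
        (C * t `^ (- (n%:R / 2) - 1) * m `^ alpha
           * expR (- (4 * t)^-1 * d ^+ 2))%:C%C.
Proof.
move=> alpha.
have al0 : 0 <= alpha by rewrite le_max lexx orbT.
have pi0 := @pi_gt0 R.
pose C0 : R := 1040 * bound_const (n%:R / 2) * expR 3.
have C00 : 0 < C0 := mulr_gt0 (mulr_gt0 (ltr0n R 1040) (expR_gt0 _)) (expR_gt0 _).
(* The factors come from the prefactor of the kernel, the contour integral and the descent, the 2 in
   1 / cos r <= 2 * weight, and the passage from d0 to the distance. *)
exists ((4 * pi) `^ (- (n%:R / 2) - 1) * C0 * 2 `^ alpha * (2 * (alpha + 1)) `^ alpha).
  have al1 : 0 < 2 * (alpha + 1) by lra.
  have pi4 : 0 < 4 * pi :> R by lra.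
  exact: mulr_gt0 (mulr_gt0 (mulr_gt0 (powR_gt0 _ pi4) C00) (powR_gt0 _ (ltr0n R 2))) (powR_gt0 _ al1).
move=> x xi u t d second m t0.
have mE : m = distance_weight t (enorm (x + xi)) d by rewrite /distance_weight enorm_eq0.
have [d0 dle bd] := kernel_bound_saddle_distance x xi hn t0 u.
have dd := d_CC_le dle.
apply: (le_trans bd); rewrite lecR mE.
have a0 := enorm_ge0 (x + xi).
have [dp dd0] := andP dd.
have w1 := distance_weight_ge1 t0 a0 (le_trans dp dd0).
have := weighted_gaussian_le t0 a0 al0 dd.
rewrite -/d (powRM _ (_ : 0 <= 4 * pi)) ?(ltW t0) ?mulr_ge0 ?(ltW pi0)//.
rewrite (powRM _ (_ : 0 <= 2) (_ : 0 <= distance_weight _ _ _)) ?(le_trans _ w1)// -/alpha.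
set P := (4 * pi) `^ _; set T := t `^ _; set W := 2 `^ alpha; set E := expR _; set E' := expR _.
set Q := (2 * _) `^ _; set w := _ `^ alpha; set w' := _ `^ alpha => h.
have PT : 0 <= P * T * C0 * W.
  exact: mulr_ge0 (mulr_ge0 (mulr_ge0 (powR_ge0 _ _) (powR_ge0 _ _)) (ltW C00)) (powR_ge0 _ _).
have := ler_wpM2l PT h; rewrite /C0; lra.
Qed.
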